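(* Let $(\mathcal{X},\omega)$ be a Kähler manifold of complex dimension $n+1\geq 2$, let $\iota\colon M\hookrightarrow\mathcal{X}$ be a strictly pseudoconvex real hypersurface, and let $\theta$ be a pseudohermitian structure on $M$ with $d\theta=\iota^{*}\omega$. Let $H$ be the $(1,0)$-mean curvature vector of $M$, $A$ the holomorphic sectional torsion of $(M,\theta)$, $K$ the Tanaka–Webster holomorphic sectional curvature of $(M,\theta)$, and $\tilde K$ the holomorphic sectional curvature of $(\mathcal{X},\omega)$. Then $(M,\theta)$ is pseudohermitian $\mathbb{C}$-convex if and only if $$|A(Z)|\leq |H|^2\qquad\text{for all } Z\in T^{(1,0)}(M),\ Z\neq 0. \quad (\ast)$$ In this case, $$K(Z)\geq \frac{\tilde K(Z)+|H|^2}{2}\qquad\text{for all } Z\in T^{(1,0)}(M),\ Z\neq 0. \quad (\ast\ast)$$ Moreover, the inequalities $(\ast)$ and $(\ast\ast)$ are sharp, in the sense that there exist pseudohermitian $\mathbb{C}$-convex $(M,\theta)\subset(\mathcal{X},\omega)$ with $d\theta=\iota^*\omega$ and nonzero $Z\in T^{(1,0)}(M)$ at which equality holds in both.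
   Context: Pseudohermitian structure: for a strictly pseudoconvex real hypersurface $M\subset\mathcal{X}$, $T^{(1,0)}(M)=T^{(1,0)}(\mathcal{X})\cap\mathbb{C}T(M)$ and $H(M)=\mathrm{Re}\,T^{(1,0)}(M)$. A pseudohermitian structure is a real nonvanishing 1-form $\theta$ on $M$ with kernel $H(M)$ and with $d\theta$ positive definite on $H(M)$. The Reeb field $T$ satisfies $T\rfloor d\theta=0$, $\theta(T)=1$. For a local frame $Z_\alpha$ ($\alpha=1,\dots,n$) of $T^{(1,0)}(M)$, $Z_{\bar\alpha}=\overline{Z_\alpha}$, with $\{\theta^\alpha,\theta^{\bar\alpha},\theta\}$ dual to $\{Z_\alpha,Z_{\bar\alpha},T\}$, one has $d\theta=i h_{\alpha\bar\beta}\theta^\alpha\wedge\theta^{\bar\beta}$ with $h_{\alpha\bar\beta}$ positive definite Hermitian; indices are raised and lowered with $h_{\alpha\bar\beta}$. The Tanaka–Webster connection $\nabla$ is given by $\nabla Z_\alpha=\omega_\alpha{}^\beta Z_\beta$, $\nabla Z_{\bar\alpha}=\omega_{\bar\alpha}{}^{\bar\beta}Z_{\bar\beta}$, $\nabla T=0$, where $d\theta^\beta=\theta^\alpha\wedge\omega_\alpha{}^\beta+A^\beta{}_{\bar\alpha}\theta\wedge\theta^{\bar\alpha}$ and $dh_{\alpha\bar\beta}=\omega_\alpha{}^\gamma h_{\gamma\bar\beta}+h_{\alpha\bar\gamma}\omega_{\bar\beta}{}^{\bar\gamma}$. The (symmetric) tensor $A_{\alpha\beta}$ is the pseudohermitian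 torsion. The Tanaka–Webster curvature $R_\alpha{}^\beta{}_{\gamma\bar\sigma}$ is the coefficient of $\theta^\gamma\wedge\theta^{\bar\sigma}$ in $d\omega_\alpha{}^\beta-\omega_\alpha{}^\gamma\wedge\omega_\gamma{}^\beta$. For nonzero $Z=\zeta^\alpha Z_\alpha$ with $|Z|^2=h_{\alpha\bar\beta}\zeta^\alpha\overline{\zeta^\beta}$, put $$K(Z)=\tfrac12 R_{\alpha\bar\beta\gamma\bar\sigma}\zeta^\alpha\overline{\zeta^{\beta}}\zeta^\gamma\overline{\zeta^{\sigma}}/|Z|^4,\qquad A(Z)=iA_{\alpha\beta}\zeta^\alpha\zeta^\beta/|Z|^2 .$$ Ambient geometry: in local coordinates $\omega=i g_{j\bar k}dz^j\wedge d\bar z^k$; $\langle\cdot,\cdot\rangle$ is the complex bilinear extension with $\langle\partial_j,\partial_{\bar k}\rangle=g_{j\bar k}$, $\langle\partial_j,\partial_k\rangle=0$; $|V|^2=\langle V,\overline V\rangle$. $\widetilde\nabla$ is the Chern connection of $\omega$, with curvature $\widetilde R(X,Y)Z=\widetilde\nabla_X\widetilde\nabla_YZ-\widetilde\nabla_Y\widetilde\nabla_XZ-\widetilde\nabla_{[X,Y]}Z$, and $\tilde K(Z)=\langle\widetilde R(Z,\overline Z)Z,\overline Z\rangle/|Z|^4$. Second fundamental form: $\mathrm{II}(X,Y)=\widetilde\nabla_XY-\nabla_XY$ for sections $X,Y$ of $\mathbb{C}T(M)$ (suitably extended to $\mathcal{X}$). The $(1,0)$-mean curvature vector is $H=\frac1n\sum_{\alpha=1}^n\mathrm{II}(Z_{\bar\alpha},Z_\alpha)$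 for a local unitary frame $Z_\alpha$ of $T^{(1,0)}(M)$; it is a section of the orthogonal complement of $T^{(1,0)}(M)$ in $T^{(1,0)}(\mathcal{X})$. Put $\mu=\frac12(H+\overline H)$ and $h(X,Y)=\langle\mathrm{II}(X,Y),\mu\rangle/|\mu|$ for $X,Y\in H(M)$. When $d\theta=\iota^*\omega$, $(M,\theta)$ is called pseudohermitian $\mathbb{C}$-convex if $h$ is positive semi-definite on $H(M)$. *)

(* Defs.v *)
From HB Require Import structures.
From mathcomp Require Import all_boot all_order all_algebra.
From mathcomp Require Import all_classical all_reals all_analysis.
From mathcomp Require Import complex.

Set Implicit Arguments.
Unset Strict Implicit.
Unset Printing Implicit Defensive.

Import Order.TTheory GRing.Theory Num.Theory.
Import numFieldNormedType.Exports.

Local Open Scope classical_set_scope.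
Local Open Scope ring_scope.

(* Chart coordinates: (x, y) : cspace R m is the point z = x + iy of C^m, seen
   as a real normed space.  A complexified tangent vector
   V = sum_j a_j d/dz_j + sum_j b_j d/dzbar_j is the pair (a, b), and a
   complexified covector sum_j p_j dz_j + sum_j q_j dzbar_j the pair (p, q).
   All fields and forms on a real hypersurface are represented in charts by
   fields and forms on open subsets of cspace; conditions on them are imposed
   only at points of the hypersurface and along its tangent vectors, so that
   only the restriction (resp. the pullback) matters. *)
Definition cspace (R : realType) (m : nat) : normedModType R :=
  ('rV[R]_m * 'rV[R]_m)%type.
Definition cvec (R : realType) (m : nat) : lmodType R[i] :=
  ('rV[R[i]]_m * 'rV[R[i]]_m)%type.

Definition imC {R : realType} : R[i] := Complex 0 1.

Section Calculus.
Context {R : realType} {m : nat}.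
Local Notation E := (cspace R m).
Local Notation C := R[i].
Local Notation CV := (cvec R m).

Fixpoint Ck (k : nat) (U : set E) (f : E -> R) : Prop :=
  (forall x, U x -> {for x, continuous f}) /\
  (if k is k'.+1 then
     forall v : E, (forall x, U x -> derivable f x v) /\ Ck k' U ('D_v f)
   else True).

Definition smooth (U : set E) (f : E -> R) : Prop := forall k, Ck k U f.

Definition csmooth (U : set E) (f : E -> C) : Prop :=
  smooth U (fun x => complex.Re (f x)) /\ smooth U (fun x => complex.Im (f x)).

Definition rowsmooth (U : set E) (a : E -> 'rV[C]_m) : Prop :=
  forall j, csmooth U (fun x => a x 0 j).

Definition vsmooth (U : set E) (V : E -> CV) : Prop :=
  rowsmooth U (fun x => (V x).1) /\ rowsmooth U (fun x => (V x).2).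

Definition dirder (v : E) (f : E -> C) (x : E) : C :=
  Complex ('D_v (fun y => complex.Re (f y)) x)
          ('D_v (fun y => complex.Im (f y)) x).

Definition ex (j : 'I_m) : E := (delta_mx 0 j, 0).
Definition ey (j : 'I_m) : E := (0, delta_mx 0 j).

(* d/dz_j and d/dzbar_j *)
Definition dz (j : 'I_m) (f : E -> C) (x : E) : C :=
  2^-1 * (dirder (ex j) f x - imC * dirder (ey j) f x).
Definition dzbar (j : 'I_m) (f : E -> C) (x : E) : C :=
  2^-1 * (dirder (ex j) f x + imC * dirder (ey j) f x).

Definition cder (x : E) (V : CV) (f : E -> C) : C :=
  \sum_j (V.1 0 j * dz j f x + V.2 0 j * dzbar j f x).

Definition cderv (x : E) (V : CV) (W : E -> CV) : CV :=
  (\row_j cder x V (fun y => (W y).1 0 j),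
   \row_j cder x V (fun y => (W y).2 0 j)).

Definition bracket (X Y : E -> CV) (x : E) : CV :=
  cderv x (X x) Y - cderv x (Y x) X.

(* complex conjugation, for vectors as well as for covectors *)
Definition cconj (V : CV) : CV := (map_mx conjc V.2, map_mx conjc V.1).

Definition holo (a : 'rV[C]_m) : CV := (a, 0).

Definition app (p V : CV) : C := \sum_j (p.1 0 j * V.1 0 j + p.2 0 j * V.2 0 j).

Definition wedge (p q V W : CV) : C := app p V * app q W - app p W * app q V.

(* V and W are extended with constant coefficients, so [V, W] = 0. *)
Definition dform (p : E -> CV) (x : E) (V W : CV) : C :=
  cder x V (fun y => app (p y) W) - cder x W (fun y => app (p y) V).

Definition metric (g : 'M[C]_m) (V W : CV) : C :=
  \sum_j \sum_k g j k * (V.1 0 j * W.2 0 k + W.1 0 j * V.2 0 k).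

Definition sqnorm (g : 'M[C]_m) (V : CV) : C := metric g V (cconj V).

(* omega = i g_{jk} dz^j /\ dzbar^k *)
Definition kform (g : 'M[C]_m) (V W : CV) : C :=
  imC * \sum_j \sum_k g j k * (V.1 0 j * W.2 0 k - W.1 0 j * V.2 0 k).

Definition kahler_metric (D : set E) (g : E -> 'M[C]_m) : Prop :=
  [/\ forall j k, csmooth D (fun x => g x j k),
      forall x, D x -> forall j k, g x k j = conjc (g x j k),
      forall x, D x -> forall a, a != 0 -> 0 < sqnorm (g x) (holo a)
    & forall x, D x -> forall V1 V2 V3 : CV,
        cder x V1 (fun y => kform (g y) V2 V3)
        - cder x V2 (fun y => kform (g y) V1 V3)
        + cder x V3 (fun y => kform (g y) V1 V2) = 0].

(* (christoffel g x j) l k = Gamma^k_{jl} = (d_j g_{l mbar}) g^{mbar k} *)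
Definition christoffel (g : E -> 'M[C]_m) (x : E) (j : 'I_m) : 'M[C]_m :=
  (\matrix_(l, k) dz j (fun y => g y l k) x) *m invmx (g x).

(* Chern connection, extended to T^(0,1) by conjugation *)
Definition chern (g : E -> 'M[C]_m) (x : E) (V : CV) (W : E -> CV) : CV :=
  cderv x V W
  + (\sum_j V.1 0 j *: ((W x).1 *m christoffel g x j),
     \sum_j V.2 0 j *: ((W x).2 *m map_mx conjc (christoffel g x j))).

Definition chern_curvature (g : E -> 'M[C]_m) (X Y Z : E -> CV) (x : E) : CV :=
  chern g x (X x) (fun y => chern g y (Y y) Z)
  - chern g x (Y x) (fun y => chern g y (X y) Z)
  - chern g x (bracket X Y x) Z.

(* The curvature is tensorial: the vector is extended with constant
   coefficients in the chart. *)
Definition Ktilde (g : E -> 'M[C]_m) (x : E) (a : 'rV[C]_m) : C :=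
  metric (g x)
    (chern_curvature g (fun=> holo a) (fun=> cconj (holo a)) (fun=> holo a) x)
    (cconj (holo a))
  / sqnorm (g x) (holo a) ^+ 2.

(* C T_x(S) for an embedded submanifold S: the vectors that annihilate the
   smooth functions vanishing on S near x *)
Definition tangent (S : set E) (x : E) (V : CV) : Prop :=
  forall (U : set E) (f : E -> R), open U -> U x -> smooth U f ->
    (forall y, U y -> S y -> f y = 0) -> cder x V (fun y => (f y)%:C%C) = 0.

Definition defining_function (S : set E) (x : E) (rho : E -> R) : Prop :=
  exists U : set E,
    [/\ open U, U x, smooth U rho,
        forall y, U y -> (S y <-> rho y = 0)
      & exists v : E, 'D_v rho x != 0].

Definition levi_form (rho : E -> R) (x : E) (a : 'rV[C]_m) : C :=
  \sum_j \sum_k dz j (dzbar k (fun y => (rho y)%:C%C)) x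
                * a 0 j * conjc (a 0 k).

End Calculus.

Section Transition.
Context {R : realType} {m : nat}.
Local Notation E := (cspace R m).

Definition zcoord (k : 'I_m) (x : E) : R[i] := Complex (x.1 0 k) (x.2 0 k).

Definition holomorphic (D : set E) (t : E -> E) : Prop :=
  forall k, csmooth D (fun y => zcoord k (t y)) /\
    forall x, D x -> forall j, dzbar j (fun y => zcoord k (t y)) x = 0.

Definition pushforward (t : E -> E) (x : E) (V : cvec R m) : cvec R m :=
  let J : 'M[R[i]]_m := \matrix_(j, k) dz j (fun y => zcoord k (t y)) x in
  (V.1 *m J, V.2 *m map_mx conjc J).

End Transition.

Record kahlerManifold (R : realType) (m : nat) := KahlerManifold {
  km_space :> topologicalType;
  km_hausdorff : hausdorff_space km_space;
  km_second_countable : @second_countable km_space;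
  chart : Type;
  cdom : chart -> set km_space;
  cmap : chart -> km_space -> cspace R m;
  cinv : chart -> cspace R m -> km_space;
  kmetric : chart -> cspace R m -> 'M[R[i]]_m;
  cimg := fun c => cmap c @` cdom c;
  ctrans := fun c c' x => cmap c' (cinv c x);
  km_cover : forall p, exists c, cdom c p;
  km_open_dom : forall c, open (cdom c);
  km_open_img : forall c, open (cimg c);
  km_cmapK : forall c p, cdom c p -> cinv c (cmap c p) = p;
  km_cmap_cont : forall c p, cdom c p -> {for p, continuous (cmap c)};
  km_cinv_cont : forall c x, cimg c x -> {for x, continuous (cinv c)};
  km_trans_holo : forall c c',
    holomorphic (cimg c `&` [set x | cdom c' (cinv c x)]) (ctrans c c');
  km_kahler : forall c, kahler_metric (cimg c) (kmetric c);
  km_metric_trans : forall c c' x, cimg c x -> cdom c' (cinv c x) ->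
    forall V W, metric (kmetric c x) V W =
      metric (kmetric c' (ctrans c c' x))
        (pushforward (ctrans c c') x V) (pushforward (ctrans c c') x W)
}.

Section Hypersurface.
Context {R : realType} {m : nat} (X : kahlerManifold R m) (M : set X).

Definition trace_in (c : chart X) : set (cspace R m) :=
  cimg c `&` [set x | M (cinv c x)].

Definition real_hypersurface : Prop :=
  forall c x, trace_in c x -> exists rho, defining_function (trace_in c) x rho.

Definition strictly_pseudoconvex : Prop :=
  forall c x, trace_in c x ->
    exists2 rho, defining_function (trace_in c) x rho
    & forall a, a != 0 -> tangent (trace_in c) x (holo a) ->
        0 < levi_form rho x a.

(* The 1-form theta on M is given in each chart by a form whose pullback to
   M is theta.  A real vector X is in H(M) = Re T^(1,0)(M) iff its
   (1,0)-part is tangent to M; dtheta(X, J X) = - 2 i dtheta(Z, Zbar) for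
   X = Z + Zbar. *)
Record pseudohermitian (theta : chart X -> cspace R m -> cvec R m) : Prop := {
  ph_smooth : forall c x, trace_in c x ->
    exists2 U : set (cspace R m), open U /\ U x & vsmooth U (theta c);
  ph_trans : forall c c' x, trace_in c x -> cdom c' (cinv c x) ->
    forall V, tangent (trace_in c) x V ->
      app (theta c x) V =
      app (theta c' (ctrans c c' x)) (pushforward (ctrans c c') x V);
  ph_real : forall c x, cimg c x -> cconj (theta c x) = theta c x;
  ph_nonvanishing : forall c x, trace_in c x ->
    exists2 V, tangent (trace_in c) x V & app (theta c x) V != 0;
  ph_kernel : forall c x, trace_in c x -> forall V, cconj V = V ->
    tangent (trace_in c) x V ->
    (app (theta c x) V = 0 <-> tangent (trace_in c) x (holo V.1));
  ph_positive : forall c x, trace_in c x -> forall a, a != 0 ->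
    tangent (trace_in c) x (holo a) ->
    0 < - imC * dform (theta c) x (holo a) (cconj (holo a))
}.

(* dtheta = iota^* omega *)
Definition induces (theta : chart X -> cspace R m -> cvec R m) : Prop :=
  forall c x, trace_in c x -> forall V W,
    tangent (trace_in c) x V -> tangent (trace_in c) x W ->
    dform (theta c) x V W = kform (kmetric c x) V W.

End Hypersurface.

(* A local frame Z_alpha of T^(1,0)(M), with the Reeb field T, the dual
   coframe theta^alpha, the matrix h_{alpha betabar}, the connection forms
   om alpha beta = omega_alpha^beta and the torsion coefficients
   tor beta alpha = A^beta_{alphabar}. *)
Record frame (R : realType) (m n : nat) := Frame {
  Z : 'I_n -> cspace R m -> 'rV[R[i]]_m;
  reeb : cspace R m -> cvec R m;
  eta : 'I_n -> cspace R m -> cvec R m;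
  hmx : cspace R m -> 'M[R[i]]_n;
  om : 'I_n -> 'I_n -> cspace R m -> cvec R m;
  tor : 'I_n -> 'I_n -> cspace R m -> R[i]
}.

Section TanakaWebster.
Context {R : realType} {m n : nat}.
Local Notation E := (cspace R m).
Local Notation C := R[i].
Local Notation CV := (cvec R m).
Implicit Types (S U : set E) (theta : E -> CV) (g : E -> 'M[C]_m).
Implicit Types (F : frame R m n) (x : E) (a : 'rV[C]_m) (V : CV).

Definition ZV F (al : 'I_n) x : CV := holo (Z F al x).

Record tw_frame S theta U F : Prop := {
  tw_smooth : [/\ forall al, rowsmooth U (Z F al), vsmooth U (reeb F),
    forall al, vsmooth U (eta F al),
    forall al be, csmooth U (fun x => hmx F x al be)
    & (forall al be, vsmooth U (om F al be)) /\
      (forall al be, csmooth U (tor F al be))];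
  tw_tangent : forall x, U x -> S x -> forall al, tangent S x (ZV F al x);
  tw_frameP : forall x, U x -> S x -> forall a, tangent S x (holo a) ->
    a = \sum_al app (eta F al x) (holo a) *: Z F al x;
  tw_reeb : forall x, U x -> S x ->
    [/\ cconj (reeb F x) = reeb F x, tangent S x (reeb F x),
        app (theta x) (reeb F x) = 1
      & forall V, tangent S x V -> dform theta x (reeb F x) V = 0];
  tw_dual : forall x, U x -> S x -> forall al,
    [/\ forall be, app (eta F al x) (ZV F be x) = (al == be)%:R,
        forall be, app (eta F al x) (cconj (ZV F be x)) = 0
      & app (eta F al x) (reeb F x) = 0];
  tw_h : forall x, U x -> S x -> forall V W, tangent S x V -> tangent S x W ->
    dform theta x V W = imC * \sum_al \sum_be hmx F x al be *
      wedge (eta F al x) (cconj (eta F be x)) V W;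
  tw_structure : forall x, U x -> S x -> forall be V W,
    tangent S x V -> tangent S x W ->
    dform (eta F be) x V W =
      \sum_al wedge (eta F al x) (om F al be x) V W
      + \sum_al tor F be al x * wedge (theta x) (cconj (eta F al x)) V W;
  tw_metric : forall x, U x -> S x -> forall al be V, tangent S x V ->
    cder x V (fun y => hmx F y al be) =
      \sum_ga app (om F al ga x) V * hmx F x ga be
      + \sum_ga hmx F x al ga * app (cconj (om F be ga x)) V
}.

Definition tw_frame_at S theta x F : Prop :=
  exists2 U, open U /\ U x & tw_frame S theta U F.

Definition unitary_frame_at S theta x F : Prop :=
  exists2 U, open U /\ U x &
    tw_frame S theta U F /\ (forall y, U y -> S y -> hmx F y = 1%:M).

(* R_alpha^beta_{gamma sigmabar}: the coefficient of
   theta^gamma /\ theta^sigmabar is the value at (Z_gamma, Z_sigmabar). *)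
Definition tw_curvature F x (al be ga si : 'I_n) : C :=
  dform (om F al be) x (ZV F ga x) (cconj (ZV F si x))
  - \sum_ka wedge (om F al ka x) (om F ka be x) (ZV F ga x) (cconj (ZV F si x)).

Definition tw_curvature_low F x (al be ga si : 'I_n) : C :=
  \sum_ka hmx F x ka be * tw_curvature F x al ka ga si.

Definition torsion_low F x (al be : 'I_n) : C :=
  conjc (\sum_ga hmx F x ga be * tor F ga al x).

(* zeta^alpha, for the vector with (1,0)-part a *)
Definition zeta F x a (al : 'I_n) : C := app (eta F al x) (holo a).

Definition levi_sqnorm F x a : C :=
  \sum_al \sum_be hmx F x al be * zeta F x a al * conjc (zeta F x a be).

Definition Ksec F x a : C :=
  2^-1 * (\sum_al \sum_be \sum_ga \sum_si tw_curvature_low F x al be ga si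
    * zeta F x a al * conjc (zeta F x a be)
    * zeta F x a ga * conjc (zeta F x a si))
  / levi_sqnorm F x a ^+ 2.

Definition Asec F x a : C :=
  imC * (\sum_al \sum_be torsion_low F x al be * zeta F x a al * zeta F x a be)
  / levi_sqnorm F x a.

(* nabla_V Y for the Tanaka-Webster connection, where
   Y = eta^be(Y) Z_be + eta^bebar(Y) Z_bebar + theta(Y) T along M *)
Definition tw_nabla theta F x V (Y : E -> CV) : CV :=
  \sum_be (cder x V (fun y => app (eta F be y) (Y y))
           + \sum_al app (eta F al x) (Y x) * app (om F al be x) V)
      *: ZV F be x
  + \sum_be (cder x V (fun y => app (cconj (eta F be y)) (Y y))
             + \sum_al app (cconj (eta F al x)) (Y x)
                       * app (cconj (om F al be x)) V)
      *: cconj (ZV F be x)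
  + cder x V (fun y => app (theta y) (Y y)) *: reeb F x.

Definition second_ff g theta F x V (Y : E -> CV) : CV :=
  chern g x V Y - tw_nabla theta F x V Y.

Definition mean_curvature g theta F x : CV :=
  (n%:R)^-1 *: \sum_al second_ff g theta F x (cconj (ZV F al x)) (ZV F al).

Definition normalized_second_ff g theta F H x V (Y : E -> CV) : C :=
  let mu := 2^-1 *: (H + cconj H) in
  metric (g x) (second_ff g theta F x V Y) mu / sqrtC (sqnorm (g x) mu).

End TanakaWebster.

Section Main.
Context {R : realType} {m : nat} (n : nat) (X : kahlerManifold R m) (M : set X).
Variable theta : chart X -> cspace R m -> cvec R m.

(* H at the point x of the chart c, computed in a local unitary frame *)
Definition is_mean_curvature (c : chart X) (x : cspace R m) (H : cvec R m) :=
  exists2 F : frame R m n, unitary_frame_at (trace_in M c) (theta c) x F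
    & H = mean_curvature (kmetric c) (theta c) F x.

(* K(Z) = k for Z = sum_j a_j d/dz_j *)
Definition is_Ksec (c : chart X) (x : cspace R m) (a : 'rV[R[i]]_m) (k : R[i]) :=
  exists2 F : frame R m n, tw_frame_at (trace_in M c) (theta c) x F
    & k = Ksec F x a.

Definition is_Asec (c : chart X) (x : cspace R m) (a : 'rV[R[i]]_m) (t : R[i]) :=
  exists2 F : frame R m n, tw_frame_at (trace_in M c) (theta c) x F
    & t = Asec F x a.

(* The sections of H(M) near x are the fields Y + Ybar with Y a section of
   T^(1,0)(M). *)
Definition Cconvex : Prop :=
  forall c x, trace_in M c x ->
  forall (F : frame R m n) (H : cvec R m) (U : set (cspace R m))
    (Y : cspace R m -> 'rV[R[i]]_m),
  tw_frame_at (trace_in M c) (theta c) x F -> is_mean_curvature c x H ->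
  open U -> U x -> rowsmooth U Y ->
  (forall y, U y -> trace_in M c y -> tangent (trace_in M c) y (holo (Y y))) ->
  let V := fun y => holo (Y y) + cconj (holo (Y y)) in
  0 <= normalized_second_ff (kmetric c) (theta c) F H x (V x) V.

End Main.

(* Main.v *)
Require Import Defs.
From HB Require Import structures.
From mathcomp Require Import all_boot all_order all_algebra.
From mathcomp Require Import all_classical all_reals all_analysis.
From mathcomp Require Import complex ring lra.

Set Implicit Arguments.
Unset Strict Implicit.
Unset Printing Implicit Defensive.

Import Order.TTheory GRing.Theory Num.Theory.
Import numFieldNormedType.Exports.

Local Open Scope classical_set_scope.
Local Open Scope ring_scope.

(* Let xi be the (1,0)-part of the Reeb field T. As dtheta is the pullback of omega,
   T _| dtheta = 0 says that xi is orthogonal to T^(1,0)(M), so xi spans the normal line, and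
   differentiating <Z, conj xi> = 0 along M expresses all components of II through xi, dtheta
   and the pseudohermitian torsion: H = i xi, and for X = Z + Zbar the number h(X, X) is a
   positive multiple of |Z|^2 (|H|^2 + Re A(Z)). Since A(lambda Z) = lambda^2 A(Z) for
   |lambda| = 1, C-convexity is equivalent to |A(Z)| <= |H|^2. Comparing the curvatures of the
   Chern and Tanaka-Webster connections on T^(1,0)(M) gives the Gauss equation
     K(Z) = Ktilde(Z) / 2 + |H|^2 - |A(Z)|^2 / (2 |H|^2),
   from which the curvature bound follows. Both bounds are equalities for the tube |Re z| = 1
   in C^(n+1) and a real vector Z orthogonal to Re z: there |A(Z)| = |H|^2 = 1/4. *)

(** * Real and complex calculus *)

(** [Ck] asks only for iterated directional derivatives, so additivity of ['D_v f] in [v] and the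
    symmetry of second derivatives must be proved before [cder] and [bracket] obey the usual rules.
    Identities about a frame hold on M alone and may be differentiated only along tangent vectors.
    Covariant derivatives are therefore not computed in coordinates. Those in the direction Zbar,
    and that of Z along T, are read off from brackets: the Chern connection is torsion-free, and the
    structure equations give the components of the bracket. Those in the direction Z come from
    differentiating inner products. A frame is one matrix with rows Z_alpha, so index sums become
    matrix products. H is computed in a unitary frame but A and K in any frame; uniqueness of the
    Reeb field links them. In the Gauss equation |H|^2 collects two equal halves: the square of
    II(Zbar, Z), and the Reeb component of [Z, Zbar], where the two connections differ by i |H|^2
    theta. As H, A and K are defined through frames, the example needs one explicit frame with its
    connection forms. *)

Section Lines.
Context {R : realType} {V : normedModType R}.
Implicit Types (f : V -> R) (x v w : V).

Lemma is_derive_linear (L : V -> R) x v :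
  (forall t u y, L (t *: u + y) = t * L u + L y) -> is_derive x v L (L v).
Proof.
move=> linL.
have cL : (fun h : R => h^-1 *: ((L \o shift x) (h *: v) - L x)) @ 0^' --> L v.
  apply: (@cvg_trans _ (((fun=> L v) : R -> R) @ (0 : R)^')); last exact: cvg_cst.
  apply: near_eq_cvg; near=> h.
  have h0 : h != 0 by near: h; exact: nbhs_dnbhs_neq.
  by rewrite /= linL addrK /GRing.scale /= mulKf.
have dL : derivable L x v by apply/cvg_ex; exists (L v).
by apply: DeriveDef => //; exact: cvg_lim cL.
Unshelve. all: by end_near. Qed.

Lemma is_derive_translate f c x v : derivable f (c + x) v ->
  is_derive x v (fun y => f (c + y)) ('D_v f (c + x)).
Proof.
have eg : (fun h : R => h^-1 *: (((fun y => f (c + y)) \o shift x) (h *: v) - f (c + x))) =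
    (fun h : R => h^-1 *: ((f \o shift (c + x)) (h *: v) - f (c + x))).
  by apply/funext => h /=; rewrite addrCA.
by move=> d; apply: DeriveDef; rewrite /derivable /derive eg.
Qed.

(** The one-variable mean value theorem for f along the line through x, on [0, t] or [t, 0].
    Bounding the intermediate point by |s| <= |t| hides the sign of t from the later estimates. *)
Lemma MVT_line f x w (t : R) :
  (forall s : R, `|s| <= `|t| -> derivable f (s *: w + x) w) ->
  exists2 s : R, `|s| <= `|t| & f (t *: w + x) - f x = t * 'D_w f (s *: w + x).
Proof.
move=> df; pose g (s : R) := f (s *: w + x).
have dg (s : R) : `|s| <= `|t| -> is_derive s (1 : R) g ('D_w f (s *: w + x)).
  move=> /df d; have eg : (fun h : R => h^-1 *: ((g \o shift s) (h *: (1 : R)) - g s)) =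
      (fun h : R => h^-1 *: ((f \o shift (s *: w + x)) (h *: w) - f (s *: w + x))).
    apply/funext => h; rewrite /g /= /GRing.scale /= mulr1.
    by rewrite (_ : (h + s) *: w + x = h *: w + (s *: w + x)) // scalerDl addrA.
  by apply: DeriveDef; rewrite /derivable /derive eg.
have g0 : g 0 = f x by rewrite /g scale0r add0r.
have cg a b : (forall s, a <= s <= b -> `|s| <= `|t|) ->
    {within `[a, b], continuous g}.
  move=> ab; apply: derivable_within_continuous => s; rewrite in_itv /= => /ab /dg.
  by case.
have [t0|t0|t0] := ltgtP t 0.
- have in_t s : t <= s <= 0 -> `|s| <= `|t|.
    by move=> /andP[ts s0]; rewrite !ler0_norm ?lerN2 // ltW.
  have [|s] := MVT t0 _ (cg _ _ in_t) (df := fun s => 'D_w f (s *: w + x)).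
    by move=> s; rewrite in_itv /= => /andP[ts s0]; apply/dg/in_t; rewrite !ltW.
  rewrite in_itv /= => /andP[ts s0]; rewrite g0 sub0r mulrN => e.
  exists s; first by apply: in_t; rewrite !ltW.
  by rewrite -/(g t) mulrC; lra.
- have in_t s : 0 <= s <= t -> `|s| <= `|t|.
    by move=> /andP[s0 st]; rewrite !ger0_norm // ltW.
  have [|s] := MVT t0 _ (cg _ _ in_t) (df := fun s => 'D_w f (s *: w + x)).
    by move=> s; rewrite in_itv /= => /andP[ts s0]; apply/dg/in_t; rewrite !ltW.
  rewrite in_itv /= => /andP[ts s0]; rewrite g0 subr0 => e.
  exists s; first by apply: in_t; rewrite !ltW.
  by rewrite -/(g t) mulrC; lra.
- by exists 0; rewrite t0 ?lexx // scale0r add0r subrr mul0r.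
Qed.

Lemma nbhs_plane (A : set V) x v w : nbhs x A ->
  exists2 d : R, 0 < d & forall s r, `|s| <= d -> `|r| <= d -> A (s *: v + (r *: w + x)).
Proof.
move=> /nbhs_ballP[e /= e0 eA].
have K0 : 0 < `|v| + `|w| + 1 by rewrite ltr_wpDl ?addr_ge0.
(* The summand 1 keeps the denominator positive when v = w = 0 and makes the final inequality
   strict. *)
exists (e / (`|v| + `|w| + 1)); first exact: divr_gt0.
move=> s r sd rd; apply: eA; rewrite -ball_normE /ball_ /=.
rewrite addrA opprD addrCA subrr addr0 normrN.
apply: (le_lt_trans (ler_normD _ _)); rewrite !normrZ.
apply: (@le_lt_trans _ _ (e / (`|v| + `|w| + 1) * (`|v| + `|w|))).
  by rewrite mulrDr lerD // ler_wpM2r.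
by rewrite mulrAC ltr_pdivrMr // ltr_pM2l // ltrDl.
Qed.

Lemma continuous_near f x (e : R) : {for x, continuous f} -> 0 < e ->
  \forall y \near x, `|f y - f x| <= e.
Proof. by move/cvgrPdist_le => cf /cf; apply: filterS => y; rewrite distrC. Qed.

(** The mean value theorem is applied once along each direction. This two-dimensional first-order
    expansion stands in for Fréchet differentiability: additivity of the derivative in the direction
    and the tangent space of the tube both rest on it. *)
Lemma C1_plane (U : set V) f x v w (e : R) : open U -> U x ->
  (forall u y, u = v \/ u = w -> U y -> derivable f y u) ->
  {for x, continuous ('D_v f)} -> {for x, continuous ('D_w f)} -> 0 < e ->
  exists2 d : R, 0 < d & forall s r : R, `|s| <= d -> `|r| <= d ->
    `|f (s *: v + (r *: w + x)) - f x - (s * 'D_v f x + r * 'D_w f x)|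
      <= e * (`|s| + `|r|).
Proof.
move=> oU Ux df cv cw e0.
have near_x u : {for x, continuous ('D_u f)} ->
    \forall y \near x, U y /\ `|'D_u f y - 'D_u f x| <= e.
  move=> cu; apply: filterI; first exact: (open_nbhs_nbhs (conj oU Ux)).
  exact: (continuous_near cu e0).
have [d d0 dA] := nbhs_plane v w (filterI (near_x v cv) (near_x w cw)).
exists d => // s r sd rd.
have dA0 r' : `|r'| <= `|r| -> U (r' *: w + x) /\ `|'D_w f (r' *: w + x) - 'D_w f x| <= e.
  move=> r'r; have := dA 0 r' _ (le_trans r'r rd).
  by rewrite normr0 (ltW d0) scale0r add0r => /(_ isT) [].
have [s' s'le ->] : exists2 s' : R, `|s'| <= `|s| &
    f (s *: v + (r *: w + x)) = f (r *: w + x) + s * 'D_v f (s' *: v + (r *: w + x)).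
  have [|s' s'le e'] := @MVT_line f (r *: w + x) v s; last first.
    by exists s' => //; rewrite -e' subrKC.
  move=> s' s's; apply: df; first by left.
  by have [[]] := dA s' r (le_trans s's sd) rd.
have [r' r'le ->] : exists2 r' : R, `|r'| <= `|r| &
    f (r *: w + x) = f x + r * 'D_w f (r' *: w + x).
  have [|r' r'le e'] := @MVT_line f x w r; last first.
    by exists r' => //; rewrite -e' subrKC.
  by move=> r' /dA0[Ur _]; apply: df => //; right.
have [[_ hv] _] := dA s' r (le_trans s'le sd) rd.
have [_ hw] := dA0 r' r'le.
move: hv hw; move: ('D_v f _) ('D_v f x) ('D_w f (r' *: w + x)) ('D_w f x) (f x).
move=> a b c c' z ab cc'.
have -> : z + r * c + s * a - z - (s * b + r * c') = s * (a - b) + r * (c - c') by ring.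
apply: (le_trans (ler_normD _ _)); rewrite !normrM mulrDr.
by apply: lerD; rewrite [leRHS]mulrC ler_wpM2l.
Qed.

(** Directional derivatives need not be additive in the direction; continuity of the two derivatives
    at x makes them so. The expansion of [C1_plane] is used with s = h a and r = h b, its tolerance
    divided by |a| + |b| + 1. *)
Lemma derive_plane (U : set V) f x v w (a b : R) : open U -> U x ->
  (forall u y, u = v \/ u = w -> U y -> derivable f y u) ->
  {for x, continuous ('D_v f)} -> {for x, continuous ('D_w f)} ->
  'D_(a *: v + b *: w) f x = a * 'D_v f x + b * 'D_w f x.
Proof.
move=> oU Ux df cv cw; apply: cvg_lim => //; apply/cvgrPdist_le => e e0.
have K0 : 0 < `|a| + `|b| + 1 by rewrite ltr_wpDl ?addr_ge0.
have [d d0 dA] := C1_plane oU Ux df cv cw (divr_gt0 e0 K0).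
near=> h.
have h0 : h != 0 by near: h; exact: nbhs_dnbhs_neq.
have hd : `|h| <= d / (`|a| + `|b| + 1).
  near: h; apply: dnbhs0_le; exact: divr_gt0.
have ha : `|h * a| <= d /\ `|h * b| <= d.
  by move: hd; rewrite ler_pdivlMr // => hd; split; apply: le_trans hd;
    rewrite normrM ler_wpM2l // -?addrA ?lerDl ?addr_ge0 // addrCA lerDl addr_ge0.
have := dA (h * a) (h * b) ha.1 ha.2.
have -> : (h * a) *: v + ((h * b) *: w + x) = h *: (a *: v + b *: w) + x.
  by rewrite scalerDr !scalerA addrA.
rewrite /= [in X in _ -> X]/GRing.scale /=.
move: (f _) (f x) ('D_v f x) ('D_w f x) => z z' p q le.
rewrite distrC -(ler_pM2l (_ : 0 < `|h|)) ?normr_gt0 // -normrM.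
rewrite [in leLHS]mulrBr mulVKf //.
have -> : h * (a * p + b * q) = h * a * p + h * b * q by ring.
apply: (le_trans le); rewrite !normrM -mulrDr [_ / _]mulrC mulrCA ler_wpM2l //.
by rewrite -mulrA ler_pdivrMl // mulrC ler_wpM2r ?ltW // ltrDl.
Unshelve. all: by end_near. Qed.

(** Apply the mean value theorem along u to the increment of f in the direction u', and once more to
    ['D_u f] along u': the second difference is t^2 times a mixed derivative at a nearby point. The
    second difference itself is symmetric in u and u'. *)
Lemma mixed_difference (U : set V) f x u u' (e : R) : open U -> U x ->
  (forall y, U y -> derivable f y u) -> (forall y, U y -> derivable ('D_u f) y u') ->
  {for x, continuous ('D_u' ('D_u f))} -> 0 < e ->
  exists2 d : R, 0 < d & forall t, 0 < t -> t <= d ->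
    `|(f (t *: u + (t *: u' + x)) - f (t *: u + x) - f (t *: u' + x) + f x) / t ^+ 2
      - 'D_u' ('D_u f) x| <= e.
Proof.
move=> oU Ux df ddf cu e0.
have near_x : \forall y \near x, U y /\ `|'D_u' ('D_u f) y - 'D_u' ('D_u f) x| <= e.
  apply: filterI; first exact: (open_nbhs_nbhs (conj oU Ux)).
  exact: (continuous_near cu e0).
have [d d0 dA] := nbhs_plane u u' near_x.
exists d => // t t0 td.
have tn : `|t| = t by rewrite gtr0_norm.
rewrite -tn in td.
pose G y := f (t *: u' + y) - f y.
have dG s : `|s| <= `|t| -> is_derive (s *: u + x) u G
    ('D_u f (s *: u + (t *: u' + x)) - 'D_u f (s *: u + x)).
  move=> s_t; rewrite [s *: u + (t *: u' + x)]addrCA; apply: is_deriveB.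
    apply: is_derive_translate; apply: df; rewrite addrCA.
    by have [] := dA s t (le_trans s_t td) td.
  apply: derivableP; apply: df.
  have := dA s 0 (le_trans s_t td); rewrite normr0 (ltW d0) scale0r add0r.
  by move=> /(_ isT) [].
have [s s_le eG] : exists2 s : R, `|s| <= `|t| &
    G (t *: u + x) - G x = t * 'D_u G (s *: u + x).
  by apply: MVT_line => s /dG [].
have [r r_le eF] : exists2 r : R, `|r| <= `|t| &
    'D_u f (t *: u' + (s *: u + x)) - 'D_u f (s *: u + x)
    = t * 'D_u' ('D_u f) (r *: u' + (s *: u + x)).
  apply: (@MVT_line ('D_u f) (s *: u + x) u' t) => r r_le.
  by apply: ddf; rewrite addrCA; have [] := dA s r (le_trans s_le td) (le_trans r_le td).
have [_] := dA s r (le_trans s_le td) (le_trans r_le td).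
rewrite [s *: u + (r *: u' + x)]addrCA.
have [_ DG] := dG s s_le; move: eG; rewrite DG [s *: u + (t *: u' + x)]addrCA eF.
rewrite /G [t *: u' + (t *: u + x)]addrCA.
move: ('D_u' ('D_u f) x) ('D_u' _ _) (f (t *: u + _)) (f x) (f (t *: u + x)) (f (t *: u' + x)).
move=> b a z1 z2 z3 z4 eG ab.
rewrite (_ : _ / _ = a) // (_ : z1 - z3 - z4 + z2 = t ^+ 2 * a).
  by rewrite mulrC mulKf // expf_neq0 // gt_eqF.
rewrite expr2 -mulrA -eG. by ring.
Qed.

(** One and the same second difference approximates both mixed derivatives, each within e / 2. *)
Lemma derive_symmetric (U : set V) f x v w : open U -> U x ->
  (forall u y, u = v \/ u = w -> U y -> derivable f y u) ->
  (forall y, U y -> derivable ('D_v f) y w) -> (forall y, U y -> derivable ('D_w f) y v) ->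
  {for x, continuous ('D_w ('D_v f))} -> {for x, continuous ('D_v ('D_w f))} ->
  'D_v ('D_w f) x = 'D_w ('D_v f) x.
Proof.
move=> oU Ux df dv dw cv cw.
apply/eqP; rewrite -subr_eq0 -normr_le0; apply/ler_addgt0Pl => e e0; rewrite addr0.
have dfv y : U y -> derivable f y v by apply: df; left.
have dfw y : U y -> derivable f y w by apply: df; right.
have e2 : 0 < e / 2 by exact: divr_gt0.
have [d d0 dA] := mixed_difference oU Ux dfv dv cv e2.
have [d' d'0 d'A] := mixed_difference oU Ux dfw dw cw e2.
pose t := Num.min d d'.
have t0 : 0 < t by rewrite lt_min d0.
have [td td'] : t <= d /\ t <= d' by rewrite !ge_min !lexx orbT.
have := dA t t0 td; have := d'A t t0 td'.
rewrite [t *: w + (t *: v + x)]addrCA.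
move: ('D_v ('D_w f) x) ('D_w ('D_v f) x) (f _) (f x) (f (t *: v + x)) (f (t *: w + x)).
move=> a b z1 z2 z3 z4.
rewrite (_ : z1 - z4 - z3 = z1 - z3 - z4); last by ring.
set D := (_ + z2) / _ => h1 h2.
rewrite (_ : a - b = (D - b) - (D - a)); last by ring.
by apply: (le_trans (ler_normB _ _)); lra.
Qed.

Lemma is_derive_mul (a b : V -> R) x v : derivable a x v -> derivable b x v ->
  is_derive x v (fun y => a y * b y) ('D_v a x * b x + a x * 'D_v b x).
Proof.
move=> da db; apply: DeriveDef; first exact: (derivableM da db).
by rewrite (deriveM da db) addrC; congr (_ + _); exact: mulrC.
Qed.

Lemma derive_mulB (a b c d : V -> R) x v :
  derivable a x v -> derivable b x v -> derivable c x v -> derivable d x v ->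
  'D_v (fun y => a y * b y - c y * d y) x =
  'D_v a x * b x + a x * 'D_v b x - ('D_v c x * d x + c x * 'D_v d x).
Proof.
move=> da db dc dd; have [dab <-] := is_derive_mul da db; have [dcd <-] := is_derive_mul dc dd.
by rewrite -(deriveB dab dcd).
Qed.

Lemma derive_mulD (a b c d : V -> R) x v :
  derivable a x v -> derivable b x v -> derivable c x v -> derivable d x v ->
  'D_v (fun y => a y * b y + c y * d y) x =
  'D_v a x * b x + a x * 'D_v b x + ('D_v c x * d x + c x * 'D_v d x).
Proof.
move=> da db dc dd; have [dab <-] := is_derive_mul da db; have [dcd <-] := is_derive_mul dc dd.
by rewrite -(deriveD dab dcd).
Qed.

End Lines.

(** * Functions of class C^k in terms of directional derivatives *)

Section RealCalculus.
Context {R : realType} {m : nat}.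
Local Notation E := (cspace R m).
Implicit Types (U : set E) (f g : E -> R) (x v w : E).

Lemma derive_locally_eq U f g x v : open U -> U x -> (forall y, U y -> f y = g y) ->
  'D_v f x = 'D_v g x.
Proof.
move=> oU Ux fg; have [->|v0] := eqVneq v 0; first by rewrite !derive0.
apply: near_eq_derive => //.
by near=> y; apply: fg; near: y; exact: open_nbhs_nbhs.
Unshelve. all: by end_near. Qed.

Lemma derivable_locally_eq U f g x v : open U -> U x -> (forall y, U y -> f y = g y) ->
  derivable f x v -> derivable g x v.
Proof.
move=> oU Ux fg; have [->|v0] := eqVneq v 0; first by move=> _; exact: derivable0.
apply: near_eq_derivable => //.
by near=> y; apply: fg; near: y; exact: open_nbhs_nbhs.
Unshelve. all: by end_near. Qed.

Lemma continuous_locally_eq U f g x : open U -> U x -> (forall y, U y -> f y = g y) ->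
  {for x, continuous f} -> {for x, continuous g}.
Proof.
move=> oU Ux fg; rewrite /prop_for /continuous_at -(fg _ Ux) => cf.
have nU : \forall y \near x, f y = g y.
  by apply: filterS (open_nbhs_nbhs (conj oU Ux)) => y Uy; exact: fg.
by apply: cvg_trans cf; exact: near_eq_cvg.
Qed.

Lemma Ck_eq k U f g : open U -> (forall y, U y -> f y = g y) -> Ck k U f -> Ck k U g.
Proof.
move=> oU; elim: k f g => [|k IH] f g fg /= [cf df]; split => //.
- by move=> x Ux; apply: (continuous_locally_eq oU Ux fg); apply: cf.
- by move=> x Ux; apply: (continuous_locally_eq oU Ux fg); apply: cf.
- move=> v; have [d1 d2] := df v; split.
    by move=> x Ux; apply: (derivable_locally_eq oU Ux fg); apply: d1.
  by apply: IH d2 => y Uy; exact: (derive_locally_eq v oU Uy fg).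
Qed.

Lemma CkW k U f : Ck k.+1 U f -> Ck k U f.
Proof.
elim: k f => [|k IH] f [cf df]; split => // v; have [d1 d2] := df v; split => //.
exact: IH.
Qed.

Lemma Ck_sub k U U' f : U' `<=` U -> Ck k U f -> Ck k U' f.
Proof.
move=> sU; elim: k f => [|k IH] f [cf df]; split => //; try by move=> x /sU; apply: cf.
move=> v; have [d1 d2] := df v; split; last exact: IH.
by move=> x /sU; apply: d1.
Qed.

Lemma Ck_cst k U c : Ck k U (fun=> c).
Proof.
elim: k c => [|k IH] c; split => //; try by move=> x _; exact: cvg_cst.
move=> v; split; first by move=> x _; exact: derivable_cst.
rewrite (_ : 'D_v (fun=> c) = fun=> 0) //.
by apply/funext => x; exact: derive_cst.
Qed.

Lemma CkD k U f g : open U -> Ck k U f -> Ck k U g -> Ck k U (fun x => f x + g x).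
Proof.
move=> oU; elim: k f g => [|k IH] f g [cf df] [cg dg]; split => //;
  try by move=> x Ux; apply: continuousD; [exact: cf|exact: cg].
move=> v; have [d1 d2] := df v; have [e1 e2] := dg v; split.
  by move=> x Ux; apply: derivableD; [exact: d1|exact: e1].
apply: (Ck_eq (f := fun x => 'D_v f x + 'D_v g x)) => //; last exact: IH.
by move=> y Uy; rewrite deriveD //; [exact: d1|exact: e1].
Qed.

Lemma CkM k U f g : open U -> Ck k U f -> Ck k U g -> Ck k U (fun x => f x * g x).
Proof.
move=> oU; elim: k f g => [|k IH] f g Cf Cg.
  case: Cf => cf _; case: Cg => cg _; split => // x Ux.
  by apply: continuousM; [exact: cf|exact: cg].
have [cf df] := Cf; have [cg dg] := Cg; split.
  by move=> x Ux; apply: continuousM; [exact: cf|exact: cg].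
move=> v; have [d1 d2] := df v; have [e1 e2] := dg v; split.
  by move=> x Ux; apply: derivableM; [exact: d1|exact: e1].
apply: (Ck_eq (f := fun x => f x * 'D_v g x + g x * 'D_v f x)) => //.
  by move=> y Uy; rewrite deriveM //; [exact: d1|exact: e1].
by apply: CkD => //; apply: IH => //; exact: CkW.
Qed.

Lemma CkV k U f : open U -> (forall x, U x -> f x != 0) -> Ck k U f ->
  Ck k U (fun x => (f x)^-1).
Proof.
move=> oU f0; elim: k => [|k IH] Cf.
  by case: Cf => cf _; split => // x Ux; apply: continuousV; [exact: f0|exact: cf].
have [cf df] := Cf; split.
  by move=> x Ux; apply: continuousV; [exact: f0|exact: cf].
move=> v; have [d1 d2] := df v; split.
  by move=> x Ux; apply: derivableV; [exact: f0|exact: d1].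
have Cf' := IH (CkW Cf).
apply: (Ck_eq (f := fun x => (-1 * ((f x)^-1 * (f x)^-1)) * 'D_v f x)) => //.
  move=> y Uy; rewrite deriveV; [|exact: f0|exact: d1].
  by rewrite mulN1r /GRing.scale /= -exprVn expr2.
by apply: CkM => //; apply: CkM; [done|exact: Ck_cst|exact: CkM].
Qed.

Lemma C1_derivable U f x v : Ck 1 U f -> U x -> derivable f x v.
Proof. by move=> [_ df] Ux; have [d _] := df v; exact: d. Qed.

Lemma C1_continuous U f x v : Ck 1 U f -> U x -> {for x, continuous ('D_v f)}.
Proof. by move=> [_ df] Ux; have [_ [c _]] := df v; exact: c. Qed.

Lemma schwarz U f x v w : open U -> U x -> Ck 2 U f -> 'D_v ('D_w f) x = 'D_w ('D_v f) x.
Proof.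
move=> oU Ux C2f; have C1f := CkW C2f.
have C1d u : Ck 1 U ('D_u f) by have [_ /(_ u) []] := C2f.
apply: (derive_symmetric oU Ux) => [u y _ Uy|y Uy|y Uy| |].
- exact: C1_derivable C1f Uy.
- exact: (C1_derivable (C1d v) Uy).
- exact: (C1_derivable (C1d w) Uy).
- exact: (C1_continuous (C1d v) Ux).
- exact: (C1_continuous (C1d w) Ux).
Qed.

Lemma smooth_eq U f g : open U -> (forall y, U y -> f y = g y) -> smooth U f -> smooth U g.
Proof. by move=> oU fg sf k; apply: Ck_eq (sf k). Qed.

Lemma smooth_sub U U' f : U' `<=` U -> smooth U f -> smooth U' f.
Proof. by move=> sU sf k; apply: Ck_sub (sf k). Qed.

Lemma smooth_cst U c : smooth U (fun=> c).
Proof. by move=> k; exact: Ck_cst. Qed.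

Lemma smoothD U f g : open U -> smooth U f -> smooth U g -> smooth U (fun x => f x + g x).
Proof. by move=> oU sf sg k; exact: CkD. Qed.

Lemma smoothM U f g : open U -> smooth U f -> smooth U g -> smooth U (fun x => f x * g x).
Proof. by move=> oU sf sg k; exact: CkM. Qed.

Lemma smoothN U f : open U -> smooth U f -> smooth U (fun x => - f x).
Proof.
move=> oU sf; apply: (smooth_eq (f := fun x => -1 * f x)) => //.
  by move=> y _; rewrite mulN1r.
by apply: smoothM => //; exact: smooth_cst.
Qed.

Lemma smoothV U f : open U -> (forall x, U x -> f x != 0) -> smooth U f ->
  smooth U (fun x => (f x)^-1).
Proof. by move=> oU f0 sf k; exact: CkV. Qed.

Lemma smooth_derive U f v : smooth U f -> smooth U ('D_v f).
Proof. by move=> sf k; have [_ /(_ v) []] := sf k.+1. Qed.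

Lemma smooth_derivable U f x v : smooth U f -> U x -> derivable f x v.
Proof. by move=> sf Ux; have [_ /(_ v) [d _]] := sf 1%N; exact: d. Qed.

End RealCalculus.

(** * Complex-valued functions and complexified tangent vectors *)

Section ComplexCalculus.
Context {R : realType} {m : nat}.
Local Notation E := (cspace R m).
Local Notation C := R[i].
Local Notation CV := (cvec R m).
Implicit Types (U : set E) (f g : E -> C) (x v w : E) (V W : CV).

Lemma conjcE (a : C) : conjc a = Complex (complex.Re a) (- complex.Im a).
Proof. by case: a. Qed.

Lemma mulcE (a b : C) : a * b =
  Complex (complex.Re a * complex.Re b - complex.Im a * complex.Im b)
          (complex.Re a * complex.Im b + complex.Im a * complex.Re b).
Proof. by case: a; case: b. Qed.

Lemma addcE (a b : C) : a + b =
  Complex (complex.Re a + complex.Re b) (complex.Im a + complex.Im b).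
Proof. by case: a; case: b. Qed.

Lemma conjcM (a b : C) : conjc (a * b) = conjc a * conjc b.
Proof. exact: rmorphM. Qed.

Lemma conjcD (a b : C) : conjc (a + b) = conjc a + conjc b.
Proof. exact: rmorphD. Qed.

Lemma conjcN (a : C) : conjc (- a) = - conjc a.
Proof. exact: rmorphN. Qed.

Lemma conjc_sum (I : Type) (r : seq I) (P : pred I) (F : I -> C) :
  conjc (\sum_(i <- r | P i) F i) = \sum_(i <- r | P i) conjc (F i).
Proof. exact: rmorph_sum. Qed.

Lemma csmooth_eq U f g : open U -> (forall y, U y -> f y = g y) -> csmooth U f -> csmooth U g.
Proof.
by move=> oU fg [sr si]; split; [apply: smooth_eq sr|apply: smooth_eq si] => // y Uy; rewrite fg.
Qed.

Lemma csmooth_sub U U' f : U' `<=` U -> csmooth U f -> csmooth U' f.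
Proof. by move=> sU [sr si]; split; [apply: smooth_sub sr|apply: smooth_sub si]. Qed.

Lemma csmooth_cst U c : csmooth U (fun=> c).
Proof. by split; exact: smooth_cst. Qed.

Lemma csmoothD U f g : open U -> csmooth U f -> csmooth U g -> csmooth U (fun x => f x + g x).
Proof.
move=> oU [fr fi] [gr gi]; split.
  by apply: (smooth_eq _ _ (smoothD oU fr gr)) => // y _; rewrite addcE.
by apply: (smooth_eq _ _ (smoothD oU fi gi)) => // y _; rewrite addcE.
Qed.

Lemma csmoothM U f g : open U -> csmooth U f -> csmooth U g -> csmooth U (fun x => f x * g x).
Proof.
move=> oU [fr fi] [gr gi]; split.
  apply: (smooth_eq (f := fun y => complex.Re (f y) * complex.Re (g y)
      + - (complex.Im (f y) * complex.Im (g y)))) => //; first by move=> y _; rewrite mulcE.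
  by apply: smoothD => //; [|apply: smoothN => //]; exact: smoothM.
apply: (smooth_eq (f := fun y => complex.Re (f y) * complex.Im (g y)
    + complex.Im (f y) * complex.Re (g y))) => //; first by move=> y _; rewrite mulcE.
by apply: smoothD => //; exact: smoothM.
Qed.

Lemma csmooth_conj U f : open U -> csmooth U f -> csmooth U (fun x => conjc (f x)).
Proof.
move=> oU [fr fi]; split; first by apply: smooth_eq fr => // y _; rewrite conjcE.
by apply: (smooth_eq (f := fun y => - complex.Im (f y))) => //;
  [move=> y _; rewrite conjcE|exact: smoothN].
Qed.

Lemma csmooth_real U (f : E -> R) : smooth U f -> csmooth U (fun x => (f x)%:C%C).
Proof. by split => //; exact: smooth_cst. Qed.

Lemma csmoothN U f : open U -> csmooth U f -> csmooth U (fun x => - f x).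
Proof.
move=> oU sf; apply: (csmooth_eq (f := fun x => -1 * f x)) => //.
  by move=> y _; rewrite mulN1r.
by apply: csmoothM => //; exact: csmooth_cst.
Qed.

(** Written as conj f / |f|^2, the inverse has a real denominator, which reduces the claim to
    [smoothV]. *)
Lemma csmoothV U f : open U -> (forall x, U x -> f x != 0) -> csmooth U f ->
  csmooth U (fun x => (f x)^-1).
Proof.
move=> oU f0 sf.
pose q y := complex.Re (f y * conjc (f y)).
have qE y : f y * conjc (f y) = (q y)%:C%C.
  by rewrite /q; case: (f y) => a b; apply/eqP; rewrite eq_complex /=; apply/andP; split;
    apply/eqP; ring.
have q0 y : U y -> q y != 0.
  move=> Uy; apply/negP => /eqP q0; move: (qE y); rewrite q0 => /eqP.
  by rewrite mulf_eq0 conjc_eq0 orbb (negbTE (f0 _ Uy)).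
apply: (csmooth_eq (f := fun y => conjc (f y) * ((q y)^-1)%:C%C)) => //.
  move=> y Uy; apply: (mulfI (f0 _ Uy)); rewrite mulrA qE mulfV; last exact: f0.
  by rewrite -rmorphM mulfV ?q0.
apply: csmoothM => //; first exact: csmooth_conj.
apply: csmooth_real; apply: smoothV => //.
by have [] := csmoothM oU sf (csmooth_conj oU sf).
Qed.

Lemma csmooth_sum (I : Type) (r : seq I) (P : pred I) U (F : I -> E -> C) : open U ->
  (forall i, csmooth U (F i)) -> csmooth U (fun x => \sum_(i <- r | P i) F i x).
Proof.
move=> oU sF; elim: r => [|i r IH].
  by apply: (csmooth_eq _ _ (csmooth_cst U 0)) => // y _; rewrite big_nil.
case Pi : (P i); last by apply: csmooth_eq IH => // y _; rewrite big_cons Pi.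
by apply: (csmooth_eq _ _ (csmoothD oU (sF i) IH)) => // y _; rewrite big_cons Pi.
Qed.

Lemma csmooth_prod (I : Type) (r : seq I) (P : pred I) U (F : I -> E -> C) : open U ->
  (forall i, csmooth U (F i)) -> csmooth U (fun x => \prod_(i <- r | P i) F i x).
Proof.
move=> oU sF; elim: r => [|i r IH].
  by apply: (csmooth_eq _ _ (csmooth_cst U 1)) => // y _; rewrite big_nil.
case Pi : (P i); last by apply: csmooth_eq IH => // y _; rewrite big_cons Pi.
by apply: (csmooth_eq _ _ (csmoothM oU (sF i) IH)) => // y _; rewrite big_cons Pi.
Qed.

Lemma dirder_eq U f g v x : open U -> U x -> (forall y, U y -> f y = g y) ->
  dirder v f x = dirder v g x.
Proof.
move=> oU Ux fg; rewrite /dirder.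
by congr Complex; apply: (derive_locally_eq v oU Ux) => y /fg ->.
Qed.

Lemma csmooth_dirder U f v : csmooth U f -> csmooth U (dirder v f).
Proof. by move=> [sr si]; split => /=; exact: smooth_derive. Qed.

Lemma dirder_cst v (c : C) x : dirder v (fun=> c) x = 0.
Proof. by rewrite /dirder !derive_cst. Qed.

Lemma dirderD U f g v x : U x -> csmooth U f -> csmooth U g ->
  dirder v (fun y => f y + g y) x = dirder v f x + dirder v g x.
Proof.
move=> Ux [fr fi] [gr gi]; rewrite /dirder addcE /=.
congr Complex.
  rewrite -deriveD; [|exact: smooth_derivable fr Ux|exact: smooth_derivable gr Ux].
  by congr (derive _ x v); apply/funext => y; rewrite addcE.
rewrite -deriveD; [|exact: smooth_derivable fi Ux|exact: smooth_derivable gi Ux].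
by congr (derive _ x v); apply/funext => y; rewrite addcE.
Qed.

Lemma dirderM U f g v x : U x -> csmooth U f -> csmooth U g ->
  dirder v (fun y => f y * g y) x = dirder v f x * g x + f x * dirder v g x.
Proof.
move=> Ux [fr fi] [gr gi].
have d1 : derivable _ x v := smooth_derivable fr Ux.
have d2 : derivable _ x v := smooth_derivable fi Ux.
have e1 : derivable _ x v := smooth_derivable gr Ux.
have e2 : derivable _ x v := smooth_derivable gi Ux.
rewrite /dirder.
have -> : (fun y => complex.Re (f y * g y)) = fun y =>
    complex.Re (f y) * complex.Re (g y) - complex.Im (f y) * complex.Im (g y).
  by apply/funext => y; rewrite mulcE.
have -> : (fun y => complex.Im (f y * g y)) = fun y =>
    complex.Re (f y) * complex.Im (g y) + complex.Im (f y) * complex.Re (g y).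
  by apply/funext => y; rewrite mulcE.
rewrite (derive_mulB d1 e1 d2 e2) (derive_mulD d1 e2 d2 e1).
move: (derive _ x v) (derive _ x v) (derive _ x v) (derive _ x v) (f x) (g x).
move=> a b c d [r s] [r' s']; apply/eqP; rewrite eq_complex /=.
by apply/andP; split; apply/eqP; ring.
Qed.

Lemma dirder_conj U f v x : U x -> csmooth U f ->
  dirder v (fun y => conjc (f y)) x = conjc (dirder v f x).
Proof.
move=> Ux [fr fi]; rewrite /dirder [RHS]conjcE /=; congr Complex.
  by congr (derive _ x v); apply/funext => y; rewrite conjcE.
rewrite -deriveN; last exact: smooth_derivable fi Ux.
by congr (derive _ x v); apply/funext => y; rewrite conjcE.
Qed.

Lemma dirderC U f v w x : open U -> U x -> csmooth U f ->
  dirder v (dirder w f) x = dirder w (dirder v f) x.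
Proof.
move=> oU Ux [/(_ 2%N) fr /(_ 2%N) fi].
have dE v' w' : dirder v' (dirder w' f) x = Complex ('D_v' ('D_w' (fun y => complex.Re (f y))) x)
    ('D_v' ('D_w' (fun y => complex.Im (f y))) x) by [].
by rewrite !dE (schwarz v w oU Ux fr) (schwarz v w oU Ux fi).
Qed.

(** The real coordinate fields d/dx_j ([true]) and d/dy_j ([false]). [coefv V] holds the complex
    coefficients of V in this basis, from d/dz = (d/dx - i d/dy) / 2 and its conjugate. Smoothness
    controls real directional derivatives, so the rules for [cder] are derived through this
    expansion. *)
Definition basisv (p : bool * 'I_m) : E := if p.1 then ex p.2 else ey p.2.
Definition coefv V (p : bool * 'I_m) : C :=
  if p.1 then 2^-1 * (V.1 0 p.2 + V.2 0 p.2) else 2^-1 * imC * (V.2 0 p.2 - V.1 0 p.2).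

Lemma cderE x V f : cder x V f = \sum_p coefv V p * dirder (basisv p) f x.
Proof.
rewrite -(pair_bigA _ (fun b j => coefv V (b, j) * dirder (basisv (b, j)) f x)) /=.
rewrite big_bool /= -big_split /=; apply: eq_bigr => j _.
rewrite /coefv /basisv /dz /dzbar /=.
by move: (dirder _ f x) (dirder _ f x) (V.1 0 j) (V.2 0 j) => *; ring.
Qed.

Lemma coefvL (c : C) V W p : coefv (c *: V + W) p = c * coefv V p + coefv W p.
Proof. by rewrite /coefv; case: p => -[] j /=; rewrite !mxE; ring. Qed.

Lemma imC_conj : conjc (imC : C) = - imC.
Proof. by apply/eqP; rewrite eq_complex /= oppr0 !eqxx. Qed.

Lemma imC2 : (imC : C) * imC = -1.
Proof. by apply/eqP; rewrite eq_complex /=; apply/andP; split; apply/eqP; ring. Qed.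

Lemma coefv_conj V p : conjc (coefv V p) = coefv (cconj V) p.
Proof.
have h2 : conjc (2^-1 : C) = 2^-1 by rewrite conjc_inv (conjc_nat R 2).
rewrite /coefv; case: p => -[] j /=; rewrite !conjcM conjcD h2 !mxE.
  by rewrite addrC.
by rewrite imC_conj conjcN; ring.
Qed.

Lemma cderL x c V W f : cder x (c *: V + W) f = c * cder x V f + cder x W f.
Proof.
rewrite !cderE mulr_sumr -big_split /=; apply: eq_bigr => p _.
by rewrite coefvL mulrDl mulrA.
Qed.

Lemma cder_eq U f g V x : open U -> U x -> (forall y, U y -> f y = g y) ->
  cder x V f = cder x V g.
Proof.
by move=> oU Ux fg; rewrite !cderE; apply: eq_bigr => p _; rewrite (dirder_eq _ oU Ux fg).
Qed.

Lemma cder_cst x V (c : C) : cder x V (fun=> c) = 0.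
Proof. by rewrite cderE big1 // => p _; rewrite dirder_cst mulr0. Qed.

Lemma cderD U f g V x : U x -> csmooth U f -> csmooth U g ->
  cder x V (fun y => f y + g y) = cder x V f + cder x V g.
Proof.
move=> Ux sf sg; rewrite !cderE -big_split /=; apply: eq_bigr => p _.
by rewrite (dirderD _ Ux sf sg) mulrDr.
Qed.

Lemma cderM U f g V x : U x -> csmooth U f -> csmooth U g ->
  cder x V (fun y => f y * g y) = cder x V f * g x + f x * cder x V g.
Proof.
move=> Ux sf sg; rewrite !cderE mulr_suml mulr_sumr -big_split /=; apply: eq_bigr => p _.
by rewrite (dirderM _ Ux sf sg); ring.
Qed.

Lemma cder_conj U f V x : U x -> csmooth U f ->
  cder x V (fun y => conjc (f y)) = conjc (cder x (cconj V) f).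
Proof.
move=> Ux sf; rewrite !cderE conjc_sum; apply: eq_bigr => p _.
rewrite conjcM (dirder_conj _ Ux sf) coefv_conj; congr (coefv _ _ * _).
by apply/eqP; rewrite -pair_eqE /=; apply/andP; split; apply/eqP/rowP => j; rewrite !mxE conjcK.
Qed.

Lemma cderZ U f V x c : U x -> csmooth U f -> cder x V (fun y => c * f y) = c * cder x V f.
Proof.
by move=> Ux sf; rewrite (cderM _ Ux (csmooth_cst U c) sf) cder_cst mul0r add0r.
Qed.

Lemma cderN U f V x : U x -> csmooth U f -> cder x V (fun y => - f y) = - cder x V f.
Proof.
move=> Ux sf; rewrite -mulN1r -(cderZ _ _ Ux sf); congr cder.
by apply/funext => y; rewrite mulN1r.
Qed.

Lemma cder_sum (I : Type) (r : seq I) (P : pred I) U (F : I -> E -> C) V x : open U -> U x ->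
  (forall i, csmooth U (F i)) ->
  cder x V (fun y => \sum_(i <- r | P i) F i y) = \sum_(i <- r | P i) cder x V (F i).
Proof.
move=> oU Ux sF; elim: r => [|i r IH].
  by rewrite big_nil -[RHS](cder_cst x V 0); congr cder; apply/funext => y; rewrite big_nil.
rewrite big_cons -IH; case: ifP => Pi; last first.
  by congr cder; apply/funext => y; rewrite big_cons Pi.
rewrite -(cderD _ Ux (sF i) (csmooth_sum r P oU sF)); congr cder.
by apply/funext => y; rewrite big_cons Pi.
Qed.

Lemma vsmooth_cst U V : vsmooth U (fun=> V).
Proof. by split=> j; exact: csmooth_cst. Qed.

Lemma csmooth_coefv U (X : E -> CV) p : open U -> vsmooth U X -> csmooth U (fun y => coefv (X y) p).
Proof.
move=> oU [s1 s2]; rewrite /coefv; case: p => -[] j /=.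
  exact: (csmoothM oU (csmooth_cst _ _) (csmoothD oU (s1 j) (s2 j))).
exact: (csmoothM oU (csmooth_cst _ _) (csmoothD oU (s2 j) (csmoothN oU (s1 j)))).
Qed.

Lemma csmooth_cder U f (V : E -> CV) : open U -> csmooth U f -> vsmooth U V ->
  csmooth U (fun y => cder y (V y) f).
Proof.
move=> oU sf sV.
apply: (csmooth_eq (f := fun y => \sum_p coefv (V y) p * dirder (basisv p) f y)) => //.
  by move=> y _; rewrite cderE.
apply: csmooth_sum => // p.
exact: (csmoothM oU (csmooth_coefv p oU sV) (csmooth_dirder _ sf)).
Qed.

Lemma coefv_cderv U (X : E -> CV) p V x : open U -> U x -> vsmooth U X ->
  coefv (cderv x V X) p = cder x V (fun y => coefv (X y) p).
Proof.
move=> oU Ux [s1 s2]; rewrite /coefv; case: p => -[] j /=.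
  by rewrite (cderZ _ _ Ux (csmoothD oU (s1 j) (s2 j))) (cderD _ Ux (s1 j) (s2 j)) !mxE.
have sN := csmoothN oU (s1 j).
rewrite (cderZ _ _ Ux (csmoothD oU (s2 j) sN)) (cderD _ Ux (s2 j) sN) (cderN _ Ux (s1 j)).
by rewrite !mxE.
Qed.

Lemma coefv0 p : coefv (0 : CV) p = 0.
Proof. by rewrite /coefv; case: p => -[] j /=; rewrite !mxE ?subr0 ?addr0 mulr0. Qed.

Lemma cderv_cst x V W : cderv x V (fun=> W) = 0.
Proof. by congr pair; apply/rowP => j; rewrite mxE cder_cst mxE. Qed.

Lemma cder0 x f : cder x (0 : CV) f = 0.
Proof. by rewrite cderE big1 // => p _; rewrite coefv0 mul0r. Qed.

(** Both fields have constant coefficients, so the symmetry of second derivatives in the real basis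
    directions is enough. *)
Lemma cderC U f V W x : open U -> U x -> csmooth U f ->
  cder x V (fun y => cder y W f) = cder x W (fun y => cder y V f).
Proof.
move=> oU Ux sf.
have cE V' W' : cder x V' (fun y => cder y W' f) =
    \sum_p \sum_q coefv V' p * coefv W' q * dirder (basisv p) (dirder (basisv q) f) x.
  rewrite (_ : (fun y => cder y W' f) = fun y => \sum_q coefv W' q * dirder (basisv q) f y);
    last by apply/funext => y; rewrite cderE.
  have sd q : csmooth U (fun y => coefv W' q * dirder (basisv q) f y).
    by apply: csmoothM => //; [exact: csmooth_cst|exact: csmooth_dirder].
  rewrite (cder_sum _ _ _ oU Ux sd) [RHS]exchange_big; apply: eq_bigr => q _.
  rewrite (cderZ _ _ Ux (csmooth_dirder _ sf)) cderE mulr_sumr.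
  by apply: eq_bigr => p _; ring.
rewrite !cE [RHS]exchange_big; apply: eq_bigr => q _; apply: eq_bigr => p _.
by rewrite (dirderC _ _ oU Ux sf); ring.
Qed.

End ComplexCalculus.

(** * Derivatives of matrix-valued maps along tangent vectors *)

Definition ctr (R : realType) p q (A : 'M[R[i]]_(p, q)) : 'M[R[i]]_(q, p) := (map_mx conjc A)^T.

Section ConjugateTranspose.
Context {R : realType}.
Local Notation C := R[i].

Lemma ctrK p q (A : 'M[C]_(p, q)) : ctr (ctr A) = A.
Proof. by apply/matrixP => i j; rewrite !mxE conjcK. Qed.

Lemma ctrM p q r (A : 'M[C]_(p, q)) (B : 'M[C]_(q, r)) : ctr (A *m B) = ctr B *m ctr A.
Proof. by rewrite /ctr map_mxM trmx_mul. Qed.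

Lemma ctrD p q (A B : 'M[C]_(p, q)) : ctr (A + B) = ctr A + ctr B.
Proof. by rewrite /ctr map_mxD linearD. Qed.

Lemma ctrN p q (A : 'M[C]_(p, q)) : ctr (- A) = - ctr A.
Proof. by rewrite /ctr map_mxN linearN. Qed.

Lemma ctrZ p q c (A : 'M[C]_(p, q)) : ctr (c *: A) = conjc c *: ctr A.
Proof. by rewrite /ctr map_mxZ linearZ. Qed.

Lemma ctr0 p q : ctr (0 : 'M[C]_(p, q)) = 0.
Proof. by apply/matrixP => i j; rewrite !mxE conjc0. Qed.

Lemma ctr1 n : ctr (1%:M : 'M[C]_n) = 1%:M.
Proof. by rewrite /ctr map_mx1 trmx1. Qed.

End ConjugateTranspose.

Local Opaque cder coefv dirder.

Section MatrixCalculus.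
Context {R : realType} {m : nat}.
Local Notation E := (cspace R m).
Local Notation C := R[i].
Local Notation CV := (cvec R m).
Implicit Types (U : set E) (x : E) (V W : CV).

Definition msmooth p q U (A : E -> 'M[C]_(p, q)) := forall i j, csmooth U (fun y => A y i j).

Definition mder p q x V (A : E -> 'M[C]_(p, q)) : 'M[C]_(p, q) :=
  \matrix_(i, j) cder x V (fun y => A y i j).

Lemma msmooth_eq p q U (A B : E -> 'M[C]_(p, q)) : open U -> (forall y, U y -> A y = B y) ->
  msmooth U A -> msmooth U B.
Proof. by move=> oU AB sA i j; apply: csmooth_eq (sA i j) => // y /AB ->. Qed.

Lemma msmooth_sub p q U U' (A : E -> 'M[C]_(p, q)) : U' `<=` U -> msmooth U A -> msmooth U' A.
Proof. by move=> sU sA i j; exact: csmooth_sub (sA i j). Qed.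

Lemma msmooth_cst p q U (A : 'M[C]_(p, q)) : msmooth U (fun=> A).
Proof. by move=> i j; exact: csmooth_cst. Qed.

Lemma msmoothD p q U (A B : E -> 'M[C]_(p, q)) : open U -> msmooth U A -> msmooth U B ->
  msmooth U (fun y => A y + B y).
Proof.
move=> oU sA sB i j; apply: (csmooth_eq _ _ (csmoothD oU (sA i j) (sB i j))) => //.
by move=> y _; rewrite mxE.
Qed.

Lemma msmoothN p q U (A : E -> 'M[C]_(p, q)) : open U -> msmooth U A ->
  msmooth U (fun y => - A y).
Proof.
move=> oU sA i j; apply: (csmooth_eq _ _ (csmoothN oU (sA i j))) => //.
by move=> y _; rewrite mxE.
Qed.

Lemma msmoothZ p q U f (A : E -> 'M[C]_(p, q)) : open U -> csmooth U f -> msmooth U A ->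
  msmooth U (fun y => f y *: A y).
Proof.
move=> oU sf sA i j; apply: (csmooth_eq _ _ (csmoothM oU sf (sA i j))) => //.
by move=> y _; rewrite mxE.
Qed.

Lemma msmoothM p q r U (A : E -> 'M[C]_(p, q)) (B : E -> 'M[C]_(q, r)) : open U ->
  msmooth U A -> msmooth U B -> msmooth U (fun y => A y *m B y).
Proof.
move=> oU sA sB i j; apply: (csmooth_eq (f := fun y => \sum_k A y i k * B y k j)) => //.
  by move=> y _; rewrite mxE.
by apply: csmooth_sum => // k; exact: csmoothM.
Qed.

Lemma msmooth_sum p q (I : Type) (r : seq I) U (F : I -> E -> 'M[C]_(p, q)) : open U ->
  (forall i, msmooth U (F i)) -> msmooth U (fun y => \sum_(i <- r) F i y).
Proof.
move=> oU sF i j; apply: (csmooth_eq (f := fun y => \sum_(k <- r) F k y i j)) => //.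
  by move=> y _; rewrite summxE.
by apply: csmooth_sum => // k; exact: sF.
Qed.

Lemma msmooth_ctr p q U (A : E -> 'M[C]_(p, q)) : open U -> msmooth U A ->
  msmooth U (fun y => ctr (A y)).
Proof.
move=> oU sA i j; apply: (csmooth_eq _ _ (csmooth_conj oU (sA j i))) => //.
by move=> y _; rewrite !mxE.
Qed.

Lemma msmooth_mder p q U (A : E -> 'M[C]_(p, q)) (X : E -> CV) : open U ->
  msmooth U A -> vsmooth U X -> msmooth U (fun y => mder y (X y) A).
Proof.
move=> oU sA sX i j; apply: (csmooth_eq _ _ (csmooth_cder oU (sA i j) sX)) => //.
by move=> y _; rewrite mxE.
Qed.

Lemma rowsmoothP U (a : E -> 'rV[C]_m) : rowsmooth U a <-> msmooth U a.
Proof. by split => [sa i j|sa j]; [rewrite (ord1 i)|]; apply: sa. Qed.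

Lemma mder_eq p q U (A B : E -> 'M[C]_(p, q)) V x : open U -> U x ->
  (forall y, U y -> A y = B y) -> mder x V A = mder x V B.
Proof.
move=> oU Ux AB; apply/matrixP => i j; rewrite !mxE.
by apply: (cder_eq _ oU Ux) => y /AB ->.
Qed.

Lemma mderL p q (A : E -> 'M[C]_(p, q)) x c V W :
  mder x (c *: V + W) A = c *: mder x V A + mder x W A.
Proof. by apply/matrixP => i j; rewrite !mxE cderL. Qed.

Lemma mder_cst p q x V (A : 'M[C]_(p, q)) : mder x V (fun=> A) = 0.
Proof. by apply/matrixP => i j; rewrite !mxE cder_cst. Qed.

Lemma mderD p q U (A B : E -> 'M[C]_(p, q)) V x : U x -> msmooth U A -> msmooth U B ->
  mder x V (fun y => A y + B y) = mder x V A + mder x V B.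
Proof.
move=> Ux sA sB; apply/matrixP => i j; rewrite !mxE -(cderD _ Ux (sA i j) (sB i j)).
by congr cder; apply/funext => y; rewrite mxE.
Qed.

Lemma mderZ p q U f (A : E -> 'M[C]_(p, q)) V x : U x -> csmooth U f -> msmooth U A ->
  mder x V (fun y => f y *: A y) = cder x V f *: A x + f x *: mder x V A.
Proof.
move=> Ux sf sA; apply/matrixP => i j; rewrite !mxE -(cderM _ Ux sf (sA i j)).
by congr cder; apply/funext => y; rewrite mxE.
Qed.

Lemma mderM p q r U (A : E -> 'M[C]_(p, q)) (B : E -> 'M[C]_(q, r)) V x : open U -> U x ->
  msmooth U A -> msmooth U B ->
  mder x V (fun y => A y *m B y) = mder x V A *m B x + A x *m mder x V B.
Proof.
move=> oU Ux sA sB; apply/matrixP => i j; rewrite !mxE -big_split /=.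
rewrite (_ : (fun y => (A y *m B y) i j) = fun y => \sum_k A y i k * B y k j); last first.
  by apply/funext => y; rewrite mxE.
rewrite (cder_sum _ _ _ oU Ux) => [|k]; last exact: csmoothM.
by apply: eq_bigr => k _; rewrite !mxE (cderM _ Ux (sA i k) (sB k j)).
Qed.

Lemma mder_sum p q (I : Type) (r : seq I) U (F : I -> E -> 'M[C]_(p, q)) V x : open U -> U x ->
  (forall i, msmooth U (F i)) ->
  mder x V (fun y => \sum_(i <- r) F i y) = \sum_(i <- r) mder x V (F i).
Proof.
move=> oU Ux sF; apply/matrixP => i j; rewrite summxE mxE.
rewrite (_ : (fun y => _ i j) = fun y => \sum_(k <- r) F k y i j); last first.
  by apply/funext => y; rewrite summxE.
rewrite (cder_sum _ _ _ oU Ux) => [|k]; last exact: sF.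
by apply: eq_bigr => k _; rewrite mxE.
Qed.

Lemma mder_ctr p q U (A : E -> 'M[C]_(p, q)) V x : U x -> msmooth U A ->
  mder x V (fun y => ctr (A y)) = ctr (mder x (cconj V) A).
Proof.
move=> Ux sA; apply/matrixP => i j; rewrite !mxE -(cder_conj _ Ux (sA j i)).
by congr cder; apply/funext => y; rewrite !mxE.
Qed.

Lemma cderv1 x V (W : E -> CV) : (cderv x V W).1 = mder x V (fun y => (W y).1).
Proof. by apply/rowP => j; rewrite !mxE. Qed.

Lemma cderv2 x V (W : E -> CV) : (cderv x V W).2 = mder x V (fun y => (W y).2).
Proof. by apply/rowP => j; rewrite !mxE. Qed.

Lemma cconjK V : cconj (cconj V) = V.
Proof.
apply/eqP; rewrite -pair_eqE /=; apply/andP; split; apply/eqP/rowP => j;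
by rewrite !mxE conjcK.
Qed.

Lemma cconjL c V W : cconj (c *: V + W) = conjc c *: cconj V + cconj W.
Proof.
apply/eqP; rewrite -pair_eqE /=; apply/andP; split; apply/eqP/rowP => j;
by rewrite !mxE rmorphD rmorphM.
Qed.

Lemma cconjD V W : cconj (V + W) = cconj V + cconj W.
Proof. by rewrite -[V]scale1r cconjL conjc1 !scale1r. Qed.

Lemma vsmooth_conj U (X : E -> CV) : open U -> vsmooth U X -> vsmooth U (fun y => cconj (X y)).
Proof.
by move=> oU [s1 s2]; split=> j /=; [apply: (csmooth_eq _ _ (csmooth_conj oU (s2 j)))|
  apply: (csmooth_eq _ _ (csmooth_conj oU (s1 j)))] => // y _; rewrite mxE.
Qed.

Lemma vsmooth_holo U (a : E -> 'rV[C]_m) : rowsmooth U a -> vsmooth U (fun y => holo (a y)).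
Proof.
move=> sa; split=> // j /=.
by rewrite (_ : (fun=> _) = fun=> 0); [exact: csmooth_cst|apply/funext => y; rewrite mxE].
Qed.

Lemma vsmooth_sub U U' (X : E -> CV) : U' `<=` U -> vsmooth U X -> vsmooth U' X.
Proof. by move=> sU [s1 s2]; split=> j; [apply: csmooth_sub (s1 j)|apply: csmooth_sub (s2 j)]. Qed.

Lemma vsmoothD U (X Y : E -> CV) : open U -> vsmooth U X -> vsmooth U Y ->
  vsmooth U (fun y => X y + Y y).
Proof.
move=> oU [s1 s2] [t1 t2]; split=> j /=.
  by apply: (csmooth_eq _ _ (csmoothD oU (s1 j) (t1 j))) => // y _; rewrite mxE.
by apply: (csmooth_eq _ _ (csmoothD oU (s2 j) (t2 j))) => // y _; rewrite mxE.
Qed.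

(** Product rule for X as a sum of coefficients times basis fields: one term differentiates the
    coefficients, the other freezes X at x. *)
Lemma cder_field U (X : E -> CV) f V x : open U -> U x -> vsmooth U X -> csmooth U f ->
  cder x V (fun y => cder y (X y) f) =
  cder x (cderv x V X) f + cder x V (fun y => cder y (X x) f).
Proof.
move=> oU Ux sX sf.
have cE (Y : E -> CV) : vsmooth U Y -> cder x V (fun y => cder y (Y y) f) =
    \sum_p (coefv (cderv x V Y) p * dirder (basisv p) f x
            + coefv (Y x) p * cder x V (dirder (basisv p) f)).
  move=> sY.
  rewrite (_ : (fun y => cder y _ f) = fun y => \sum_p coefv (Y y) p * dirder (basisv p) f y);
    last by apply/funext => y; rewrite cderE.
  rewrite (cder_sum _ _ _ oU Ux) => [|p].
    apply: eq_bigr => p _.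
    by rewrite (cderM _ Ux (csmooth_coefv p oU sY) (csmooth_dirder _ sf)) (coefv_cderv _ _ oU).
  by apply: csmoothM => //; [exact: csmooth_coefv|exact: csmooth_dirder].
rewrite (cE _ sX) (cE _ (vsmooth_cst U (X x))) cderE -big_split /=.
by apply: eq_bigr => p _; rewrite cderv_cst coefv0 mul0r add0r.
Qed.

(** By [cder_field] each iterated derivative has a second-order part with frozen fields. These parts
    agree by [cderC] and cancel, leaving the coefficient derivatives that make up the bracket. *)
Lemma cder_bracket U (X Y : E -> CV) f x : open U -> U x -> vsmooth U X -> vsmooth U Y ->
  csmooth U f ->
  cder x (bracket X Y x) f =
  cder x (X x) (fun y => cder y (Y y) f) - cder x (Y x) (fun y => cder y (X y) f).
Proof.
move=> oU Ux sX sY sf.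
rewrite (cder_field _ oU Ux sX sf) (cder_field _ oU Ux sY sf) (cderC (X x) (Y x) oU Ux sf).
have -> : bracket X Y x = (-1) *: cderv x (Y x) X + cderv x (X x) Y.
  by rewrite /bracket scaleN1r addrC.
rewrite cderL; move: (cder x _ _) (cder x _ _) (cder x _ _) => a b c; ring.
Qed.

(** * Vectors tangent to a subset and differentiation along them *)

Section Tangent.
Variable S : set E.

Lemma tangentL x c V W : tangent S x V -> tangent S x W -> tangent S x (c *: V + W).
Proof.
move=> tV tW U f oU Ux sf f0.
by rewrite cderL (tV U f oU Ux sf f0) (tW U f oU Ux sf f0) mulr0 addr0.
Qed.

Lemma tangent0 x : tangent S x 0.
Proof. by move=> U f _ _ _ _; rewrite cder0. Qed.

Lemma tangentZ x c V : tangent S x V -> tangent S x (c *: V).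
Proof. by move=> tV; rewrite -[c *: V]addr0; apply: tangentL => //; exact: tangent0. Qed.

Lemma tangentD x V W : tangent S x V -> tangent S x W -> tangent S x (V + W).
Proof. by move=> tV tW; rewrite -[V]scale1r; exact: tangentL. Qed.

Lemma tangent_sum x (I : Type) (r : seq I) (F : I -> CV) :
  (forall i, tangent S x (F i)) -> tangent S x (\sum_(i <- r) F i).
Proof.
move=> tF; elim: r => [|i r IH]; first by rewrite big_nil; exact: tangent0.
by rewrite big_cons; exact: tangentD.
Qed.

Lemma tangent_conj x V : tangent S x V -> tangent S x (cconj V).
Proof.
move=> tV U f oU Ux sf f0; have := tV U f oU Ux sf f0.
rewrite -{1}[V]cconjK => /(congr1 conjc); rewrite conjc0.
rewrite -(cder_conj _ Ux (csmooth_real sf)) => e; rewrite -[RHS]e; congr cder.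
by apply/funext => y; rewrite conjc_real.
Qed.

(** [tangent] is tested on real functions; a complex function is split into its real and imaginary
    parts. *)
Lemma tangent_cder U f x V : open U -> U x -> csmooth U f -> tangent S x V ->
  (forall y, U y -> S y -> f y = 0) -> cder x V f = 0.
Proof.
move=> oU Ux [fr fi] tV f0.
have fE : f = fun y => (complex.Re (f y))%:C%C + imC * (complex.Im (f y))%:C%C.
  by apply/funext => y; rewrite /imC; case: (f y) => a b; apply/eqP;
    rewrite eq_complex /=; apply/andP; split; apply/eqP; ring.
have si := csmooth_real fi.
rewrite fE (cderD _ Ux (csmooth_real fr) (csmoothM oU (csmooth_cst U imC) si)).
rewrite (cderZ _ _ Ux si) (tV U _ oU Ux fr) ?(tV U _ oU Ux fi) ?mulr0 ?addr0 //.
  by move=> y Uy Sy; rewrite f0.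
by move=> y Uy Sy; rewrite f0.
Qed.

(** This lemma and its matrix form are the means by which identities that hold on the hypersurface
    alone get differentiated. *)
Lemma tangent_cder_eq U f g x V : open U -> U x -> csmooth U f -> csmooth U g ->
  tangent S x V -> (forall y, U y -> S y -> f y = g y) -> cder x V f = cder x V g.
Proof.
move=> oU Ux sf sg tV fg; apply/eqP; rewrite -subr_eq0 -(cderN _ Ux sg).
rewrite -(cderD _ Ux sf (csmoothN oU sg)); apply/eqP.
apply: (tangent_cder oU Ux _ tV); first by apply: csmoothD => //; exact: csmoothN.
by move=> y Uy Sy; rewrite fg // subrr.
Qed.

Lemma tangent_mder_eq p q U (A B : E -> 'M[C]_(p, q)) x V : open U -> U x ->
  msmooth U A -> msmooth U B -> tangent S x V ->
  (forall y, U y -> S y -> A y = B y) -> mder x V A = mder x V B.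
Proof.
move=> oU Ux sA sB tV AB; apply/matrixP => i j; rewrite !mxE.
by apply: (tangent_cder_eq oU Ux) => // y Uy Sy; rewrite AB.
Qed.

(** If f vanishes on S then so does Yf, because Y is tangent along S, and hence X(Yf) = 0 at x.
    Exchanging X and Y gives [X, Y]f = 0. *)
Lemma tangent_bracket U (X Y : E -> CV) x : open U -> U x -> S x -> vsmooth U X -> vsmooth U Y ->
  (forall y, U y -> S y -> tangent S y (X y)) -> (forall y, U y -> S y -> tangent S y (Y y)) ->
  tangent S x (bracket X Y x).
Proof.
move=> oU Ux Sx sX sY tX tY U' f oU' U'x sf f0.
pose W := U `&` U'.
have oW : open W by exact: openI.
have [WU WU'] : W `<=` U /\ W `<=` U' by split => y [].
have Wx : W x by [].
have {}sf := csmooth_sub WU' (csmooth_real sf).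
have {}sX := vsmooth_sub WU sX; have {}sY := vsmooth_sub WU sY.
rewrite (cder_bracket oW Wx sX sY sf).
rewrite (tangent_cder oW Wx (csmooth_cder oW sf sY) (tX _ Ux Sx)).
  rewrite (tangent_cder oW Wx (csmooth_cder oW sf sX) (tY _ Ux Sx)) ?subr0 //.
  by move=> y Wy Sy; apply: (tangent_cder oW Wy sf (tX _ _ Sy)) => [|z /WU' U'z Sz];
    [exact: WU|rewrite f0].
by move=> y Wy Sy; apply: (tangent_cder oW Wy sf (tY _ _ Sy)) => [|z /WU' U'z Sz];
  [exact: WU|rewrite f0].
Qed.

End Tangent.

Lemma appL (p : CV) c V W : app p (c *: V + W) = c * app p V + app p W.
Proof.
rewrite /app mulr_sumr -big_split /=; apply: eq_bigr => j _.
by rewrite !mxE; ring.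
Qed.

Lemma app_conj (p : CV) V : app (cconj p) V = conjc (app p (cconj V)).
Proof.
rewrite /app rmorph_sum; apply: eq_bigr => j _ /=.
by rewrite !mxE rmorphD !rmorphM /= !conjcK addrC.
Qed.

Lemma csmooth_app U (p X : E -> CV) : open U -> vsmooth U p -> vsmooth U X ->
  csmooth U (fun y => app (p y) (X y)).
Proof.
move=> oU [p1 p2] [X1 X2]; apply: csmooth_sum => // j.
by apply: csmoothD => //; apply: csmoothM.
Qed.

Lemma cder_app U (p X : E -> CV) V x : open U -> U x -> vsmooth U p -> vsmooth U X ->
  cder x V (fun y => app (p y) (X y)) =
  cder x V (fun y => app (p y) (X x)) + app (p x) (cderv x V X).
Proof.
move=> oU Ux [p1 p2] [X1 X2].
have sM (Y : E -> CV) j : vsmooth U Y ->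
    csmooth U (fun y => (p y).1 0 j * (Y y).1 0 j) /\ csmooth U (fun y => (p y).2 0 j * (Y y).2 0 j).
  by move=> [Y1 Y2]; split; exact: csmoothM.
have cE (Y : E -> CV) : vsmooth U Y -> cder x V (fun y => app (p y) (Y y)) =
    \sum_j (cder x V (fun y => (p y).1 0 j) * (Y x).1 0 j
       + (p x).1 0 j * cder x V (fun y => (Y y).1 0 j)
       + (cder x V (fun y => (p y).2 0 j) * (Y x).2 0 j
       + (p x).2 0 j * cder x V (fun y => (Y y).2 0 j))).
  move=> sY; rewrite (cder_sum _ _ _ oU Ux) => [|j]; last first.
    by have [? ?] := sM Y j sY; exact: csmoothD.
  apply: eq_bigr => j _; have [? ?] := sM Y j sY; have [Y1 Y2] := sY.
  by rewrite (cderD (U := U)) // !(cderM (U := U)).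
rewrite cE // cE; last exact: vsmooth_cst.
rewrite /app -big_split /=; apply: eq_bigr => j _.
rewrite !mxE !cder_cst !mulr0.
by move: (cder _ _ _) (cder _ _ _) (cder _ _ _) (cder _ _ _) ((X x).1 _ _) ((X x).2 _ _)
  ((p x).1 _ _) ((p x).2 _ _) => *; ring.
Qed.

Local Opaque app.

(** Cartan's formula. [dform] extends its two vectors with constant coefficients; for fields the
    correction is exactly the term in [X, Y]. *)
Lemma dform_fields U (p X Y : E -> CV) x : open U -> U x -> vsmooth U p -> vsmooth U X ->
  vsmooth U Y ->
  dform p x (X x) (Y x) = cder x (X x) (fun y => app (p y) (Y y))
    - cder x (Y x) (fun y => app (p y) (X y)) - app (p x) (bracket X Y x).
Proof.
move=> oU Ux sp sX sY; rewrite /dform (cder_app _ oU Ux sp sY) (cder_app _ oU Ux sp sX).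
have -> : bracket X Y x = (-1) *: cderv x (Y x) X + cderv x (X x) Y.
  by rewrite /bracket scaleN1r addrC.
rewrite appL; move: (app _ _) (app _ _) (cder x _ _) (cder x _ _) => a b c d; ring.
Qed.

End MatrixCalculus.

(** * The Chern connection *)

Section KahlerChart.
Context {R : realType} {m : nat}.
Local Notation E := (cspace R m).
Local Notation C := R[i].
Local Notation CV := (cvec R m).
Implicit Types (U : set E) (x : E) (V W : CV) (G : 'M[C]_m).

(* The rows of [A] and [B] are (1,0)-vectors; the entries are their Hermitian products. *)
Definition hprod p q G (A : 'M[C]_(p, m)) (B : 'M[C]_(q, m)) : 'M[C]_(p, q) :=
  A *m G *m ctr B.

Lemma bilinearE G (a b : 'rV[C]_m) :
  \sum_j \sum_k G j k * (a 0 j * conjc (b 0 k)) = hprod G a b 0 0.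
Proof.
rewrite /hprod mxE exchange_big; apply: eq_bigr => k _.
rewrite !mxE mulr_suml; apply: eq_bigr => j _; ring.
Qed.

Lemma metricE G V W : metric G V W =
  hprod G V.1 (cconj W).1 0 0 + hprod G W.1 (cconj V).1 0 0.
Proof.
rewrite -!bilinearE /metric -big_split; apply: eq_bigr => j _ /=.
rewrite -big_split; apply: eq_bigr => k _ /=.
by rewrite !mxE !conjcK mulrDr.
Qed.

Lemma kformE G V W : kform G V W =
  imC * (hprod G V.1 (cconj W).1 0 0 - hprod G W.1 (cconj V).1 0 0).
Proof.
rewrite -!bilinearE /kform; congr (_ * _).
rewrite -sumrB; apply: eq_bigr => j _ /=; rewrite -sumrB; apply: eq_bigr => k _ /=.
by rewrite !mxE !conjcK mulrBr.
Qed.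

Lemma cconj_holo1 (a : 'rV[C]_m) : (cconj (holo a)).1 = 0.
Proof. by apply/rowP => j; rewrite !mxE conjc0. Qed.

Lemma hprod0r p q G (A : 'M[C]_(p, m)) : hprod G A (0 : 'M[C]_(q, m)) = 0.
Proof. by rewrite /hprod ctr0 mulmx0. Qed.

Lemma hprod0l p q G (A : 'M[C]_(p, m)) : hprod G (0 : 'M[C]_(q, m)) A = 0.
Proof. by rewrite /hprod !mul0mx. Qed.

Lemma sqnorm_holo G (a : 'rV[C]_m) : sqnorm G (holo a) = hprod G a a 0 0.
Proof. by rewrite /sqnorm metricE cconjK cconj_holo1 hprod0l [X in _ + X]mxE addr0. Qed.

Definition ez j : CV := holo (delta_mx 0 j).

Lemma dz_cder j f x : dz j f x = cder x (ez j) f.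
Proof.
Transparent cder.
rewrite /cder /ez (bigD1 j) //= !mxE !eqxx mul1r mul0r addr0 big1 ?addr0 // => k kj.
by rewrite !mxE eqxx (negbTE kj) !mul0r addr0.
Qed.
Opaque cder.

Lemma holo_sum (a : 'rV[C]_m) : holo a = \sum_j a 0 j *: ez j.
Proof.
have e1 : (\sum_j a 0 j *: ez j).1 = \sum_j (a 0 j *: ez j).1.
  by apply: (big_morph (fun V : CV => V.1)).
have e2 : (\sum_j a 0 j *: ez j).2 = \sum_j (a 0 j *: ez j).2.
  by apply: (big_morph (fun V : CV => V.2)).
rewrite [RHS]surjective_pairing e1 e2; congr pair; first exact: row_sum_delta.
by rewrite big1 // => j _; rewrite /= scaler0.
Qed.

Lemma mder_sumL p q (A : E -> 'M[C]_(p, q)) x (I : Type) (r : seq I) (F : I -> C) (V : I -> CV) :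
  mder x (\sum_(i <- r) F i *: V i) A = \sum_(i <- r) F i *: mder x (V i) A.
Proof.
elim: r => [|i r IH]; last by rewrite !big_cons mderL IH.
by rewrite !big_nil; apply/matrixP => i j; rewrite !mxE cder0.
Qed.

Lemma cvec_split V : V = holo V.1 + cconj (holo (cconj V).1).
Proof.
rewrite [LHS]surjective_pairing; congr pair; apply/rowP => j; rewrite !mxE.
  by rewrite conjc0 addr0.
by rewrite conjcK add0r.
Qed.

Variables (g : E -> 'M[C]_m) (D : set E).
Hypotheses (oD : open D) (kg : kahler_metric D g).

(** The connection matrix at V, acting on row vectors from the right. Only the (1,0)-part of V
    enters, as the Chern connection form has type (1,0). *)
Definition chern_form x V : 'M[C]_m := \sum_j V.1 0 j *: christoffel g x j.

(* The Chern connection acting on the rows of [A] as sections of [T^(1,0)(X)]. *)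
Definition cov p x V (A : E -> 'M[C]_(p, m)) : 'M[C]_(p, m) :=
  mder x V A + A x *m chern_form x V.

Lemma chern1 x V (W : E -> CV) : (chern g x V W).1 = cov x V (fun y => (W y).1).
Proof.
rewrite -[LHS]/((cderv x V W).1 + _) cderv1 /cov /chern_form mulmx_sumr; congr (_ + _).
by apply: eq_bigr => j _; rewrite scalemxAr.
Qed.

Lemma chern_holo2 x V (a : E -> 'rV[C]_m) : (chern g x V (fun y => holo (a y))).2 = 0.
Proof.
rewrite -[LHS]/((cderv x V (fun y => holo (a y))).2 + _) cderv2 mder_cst add0r /= big1 // => j _.
by rewrite mul0mx scaler0.
Qed.

Local Opaque chern bracket.

Lemma smooth_g : msmooth D g. Proof. by case: kg. Qed.

Lemma g_herm x : D x -> ctr (g x) = g x.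
Proof.
by case: kg => _ + _ _ => /(_ x) h /h {}h; apply/matrixP => j k; rewrite !mxE [RHS]h.
Qed.

Lemma hprod_gt0 x (a : 'rV[C]_m) : D x -> a != 0 -> 0 < hprod (g x) a a 0 0.
Proof. by move=> Dx a0; rewrite -sqnorm_holo; case: kg => _ _ /(_ x Dx a a0). Qed.

Lemma hprod_ctr p q x (A : 'M[C]_(p, m)) (B : 'M[C]_(q, m)) : D x ->
  ctr (hprod (g x) A B) = hprod (g x) B A.
Proof. by move=> Dx; rewrite /hprod !ctrM ctrK g_herm // mulmxA. Qed.

Lemma g_unit x : D x -> g x \in unitmx.
Proof.
move=> Dx; rewrite unitmxE unitfE; apply/negP => /det0P[a a0 ag].
by have := hprod_gt0 Dx a0; rewrite /hprod ag mul0mx mxE ltxx.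
Qed.

Lemma christoffelE x j : christoffel g x j = mder x (ez j) g *m invmx (g x).
Proof. by congr (_ *m _); apply/matrixP => l k; rewrite !mxE dz_cder. Qed.

Lemma smooth_det p U (A : E -> 'M[C]_p) : open U -> msmooth U A -> csmooth U (fun y => \det (A y)).
Proof.
move=> oU sA; apply: csmooth_sum => // s.
apply: csmoothM => //; first exact: csmooth_cst.
by apply: csmooth_prod => // i; exact: sA.
Qed.

(** By Cramer's formula, since determinants and cofactors are polynomial in the entries. *)
Lemma smooth_inv U (A : E -> 'M[C]_m) : open U -> (forall y, U y -> A y \in unitmx) ->
  msmooth U A -> msmooth U (fun y => invmx (A y)).
Proof.
move=> oU uA sA.
apply: (msmooth_eq (A := fun y => (\det (A y))^-1 *: \adj (A y))) => //.
  by move=> y Uy; rewrite /invmx uA.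
have sd : csmooth U (fun y => (\det (A y))^-1).
  apply: (csmoothV oU _ (smooth_det oU sA)) => y Uy.
  by have := uA y Uy; rewrite unitmxE unitfE.
apply: (msmoothZ oU sd).
move=> i j; apply: (csmooth_eq (f := fun y => cofactor (A y) j i)) => //.
  by move=> y _; rewrite mxE.
apply: csmoothM => //; first exact: csmooth_cst.
apply: smooth_det => // i' j'; apply: (csmooth_eq _ _ (sA (lift j i') (lift i j'))) => //.
by move=> y _; rewrite !mxE.
Qed.

Lemma smooth_christoffel j : msmooth D (fun y => christoffel g y j).
Proof.
apply: (msmooth_eq (A := fun y => mder y (ez j) g *m invmx (g y))) => //.
  by move=> y _; rewrite christoffelE.
apply: msmoothM => //; last by apply: smooth_inv => //; [exact: g_unit|exact: smooth_g].
by apply: msmooth_mder => //; [exact: smooth_g|exact: vsmooth_cst].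
Qed.

Lemma smooth_chern_form U (X : E -> CV) : open U -> U `<=` D -> vsmooth U X ->
  msmooth U (fun y => chern_form y (X y)).
Proof.
move=> oU UD [X1 _]; apply: msmooth_sum => // j.
by apply: msmoothZ => //; apply: msmooth_sub (smooth_christoffel j).
Qed.

Lemma smooth_cov p U (X : E -> CV) (A : E -> 'M[C]_(p, m)) : open U -> U `<=` D ->
  vsmooth U X -> msmooth U A -> msmooth U (fun y => cov y (X y) A).
Proof.
move=> oU UD sX sA; apply: msmoothD => //; first exact: msmooth_mder.
by apply: msmoothM => //; exact: smooth_chern_form.
Qed.

Lemma chern_formL x c V W : chern_form x (c *: V + W) = c *: chern_form x V + chern_form x W.
Proof.
rewrite /chern_form scaler_sumr -big_split; apply: eq_bigr => j _ /=.
by rewrite !mxE scalerDl scalerA.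
Qed.

Lemma covL p x c V W (A : E -> 'M[C]_(p, m)) :
  cov x (c *: V + W) A = c *: cov x V A + cov x W A.
Proof.
rewrite /cov mderL chern_formL mulmxDr -scalemxAr scalerDr.
by rewrite addrACA.
Qed.

Lemma covZ p y c V (A : E -> 'M[C]_(p, m)) : cov y (c *: V) A = c *: cov y V A.
Proof.
have -> : c *: V = (c - 1) *: V + V by rewrite -{3}[V]scale1r -scalerDl subrK.
by rewrite covL scalerBl scale1r subrK.
Qed.

Lemma cov0 p y V : cov y V (fun=> 0 : 'M[C]_(p, m)) = 0.
Proof. by rewrite /cov mder_cst mul0mx addr0. Qed.

Lemma covM p q U x V (A : E -> 'M[C]_(p, q)) (B : E -> 'M[C]_(q, m)) : open U -> U x ->
  msmooth U A -> msmooth U B ->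
  cov x V (fun y => A y *m B y) = mder x V A *m B x + A x *m cov x V B.
Proof. by move=> oU Ux sA sB; rewrite /cov (mderM _ oU Ux sA sB) mulmxDr mulmxA addrA. Qed.

Lemma chern_form_g x V : D x -> chern_form x V *m g x = mder x (holo V.1) g.
Proof.
move=> Dx; rewrite holo_sum mder_sumL mulmx_suml; apply: eq_bigr => j _.
by rewrite christoffelE -scalemxAl mulmxKV // g_unit.
Qed.

(** The (1,0)-derivative of g is given by the definition of the Christoffel symbols; the
    (0,1)-derivative follows by conjugate transposition, as g is Hermitian. *)
Lemma mder_g x V : D x ->
  mder x V g = chern_form x V *m g x + g x *m ctr (chern_form x (cconj V)).
Proof.
move=> Dx; rewrite {1}[V]cvec_split -[holo V.1]scale1r mderL scale1r chern_form_g //.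
congr (_ + _).
rewrite (mder_eq _ oD Dx (B := fun y => ctr (g y))) => [|y Dy]; last by rewrite g_herm.
rewrite (mder_ctr _ Dx smooth_g) cconjK -chern_form_g // ctrM g_herm //.
Qed.

(** Metric compatibility of the Chern connection. The product is conjugate-linear in its second
    slot, where the direction is therefore conjugated. *)
Lemma mder_hprod p q U x V (A : E -> 'M[C]_(p, m)) (B : E -> 'M[C]_(q, m)) : open U -> U x ->
  U `<=` D -> msmooth U A -> msmooth U B ->
  mder x V (fun y => hprod (g y) (A y) (B y)) =
  hprod (g x) (cov x V A) (B x) + hprod (g x) (A x) (cov x (cconj V) B).
Proof.
move=> oU Ux UD sA sB; have Dx := UD x Ux; have sg := msmooth_sub UD smooth_g.
rewrite /hprod (mderM _ oU Ux (msmoothM oU sA sg) (msmooth_ctr oU sB)).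
rewrite (mderM _ oU Ux sA sg) (mder_ctr _ Ux sB) mder_g // /cov.
rewrite !mulmxDl ctrD ctrM !mulmxDr !mulmxDl !mulmxA.
by rewrite -!addrA; congr (_ + (_ + _)); rewrite addrC.
Qed.

(** Closedness of omega on d/dz_j, d/dz_l, d/dzbar_k says that d_j g_{l kbar} = d_l g_{j kbar}, the
    third term vanishing by type. Torsion-freeness rests on this symmetry. *)
Lemma christoffel_sym x j l : D x -> row l (christoffel g x j) = row j (christoffel g x l).
Proof.
move=> Dx; rewrite !christoffelE !row_mul; congr (_ *m _); apply/rowP => k; rewrite !mxE.
case: kg => sg _ _ /(_ x Dx (ez j) (ez l) (cconj (ez k))).
have kfE a k' y : kform (g y) (ez a) (cconj (ez k')) = imC * g y a k'.
  rewrite kformE cconjK cconj_holo1 hprod0l [X in _ - X]mxE subr0 /hprod.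
  rewrite -rowE mxE (bigD1 k') //= big1 ?addr0 => [|i ik]; rewrite !mxE !eqxx.
    by rewrite conjc1 mulr1.
  by rewrite (negbTE ik) andbF conjc0 mulr0.
have kf0 y : kform (g y) (ez j) (ez l) = 0.
  by rewrite kformE !cconj_holo1 !hprod0r mxE subrr mulr0.
under [X in cder _ _ X - _ + _]eq_fun do rewrite kfE.
under [X in _ - cder _ _ X + _]eq_fun do rewrite kfE.
under [X in _ + cder _ _ X]eq_fun do rewrite kf0.
rewrite cder_cst addr0 (cderZ _ _ Dx (sg l k)) (cderZ _ _ Dx (sg j k)) => /eqP.
have i0 : (imC : C) != 0 by rewrite eq_complex /= negb_and oner_eq0 orbT.
by rewrite subr_eq0 => /eqP /(mulfI i0).
Qed.

Lemma chern_form_sym x V W : D x -> V.1 *m chern_form x W = W.1 *m chern_form x V.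
Proof.
move=> Dx.
have e V' W' : V'.1 *m chern_form x W' =
    \sum_j \sum_l (W'.1 0 j * V'.1 0 l) *: row l (christoffel g x j).
  rewrite mulmx_sumr; apply: eq_bigr => j _; rewrite -scalemxAr mulmx_sum_row scaler_sumr.
  by apply: eq_bigr => l _; rewrite scalerA.
rewrite !e exchange_big; apply: eq_bigr => l _; apply: eq_bigr => j _.
by rewrite christoffel_sym // mulrC.
Qed.

(** Stated for (1,0)-parts of arbitrary complexified fields. When one field has type (0,1), one of
    the two covariant derivatives vanishes and the other is read off from the bracket alone. *)
Lemma cov_torsion_free U (X Y : E -> CV) x : U x -> U `<=` D ->
  cov x (X x) (fun y => (Y y).1) - cov x (Y x) (fun y => (X y).1) = (bracket X Y x).1.
Proof.
move=> Ux UD; rewrite /cov (chern_form_sym (Y x) (X x) (UD _ Ux)).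
by rewrite opprD addrACA subrr addr0 -!cderv1.
Qed.

(** The curvature matrix dGamma - Gamma /\ Gamma, with V and W extended constantly. Matrices act on
    rows from the right, which fixes the order in the commutator; [tw_curv_form] follows the same
    convention. *)
Definition chern_curv x V W : 'M[C]_m :=
  mder x V (fun y => chern_form y W) - mder x W (fun y => chern_form y V)
  + (chern_form x W *m chern_form x V - chern_form x V *m chern_form x W).

Lemma mder_chern_form U x V (X : E -> CV) : open U -> U x -> U `<=` D -> vsmooth U X ->
  mder x V (fun y => chern_form y (X y)) =
  mder x V (fun y => chern_form y (X x)) + chern_form x (cderv x V X).
Proof.
move=> oU Ux UD [X1 X2].
have sc j := msmooth_sub UD (smooth_christoffel j).
have e (Y : E -> CV) : vsmooth U Y -> mder x V (fun y => chern_form y (Y y)) =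
    \sum_j (cder x V (fun y => (Y y).1 0 j) *: christoffel g x j
            + (Y x).1 0 j *: mder x V (fun y => christoffel g y j)).
  move=> [Y1 Y2]; rewrite (mder_sum _ _ oU Ux) => [|j].
    by apply: eq_bigr => j _; rewrite (mderZ _ Ux (Y1 j) (sc j)).
  exact: (msmoothZ oU (Y1 j) (sc j)).
rewrite (e _ (conj X1 X2)) (e _ (vsmooth_cst U (X x))) /chern_form -big_split.
apply: eq_bigr => j _ /=.
by rewrite cder_cst scale0r add0r addrC mxE.
Qed.

Lemma mder_mder_bracket p q U x (X Y : E -> CV) (A : E -> 'M[C]_(p, q)) : open U -> U x ->
  vsmooth U X -> vsmooth U Y -> msmooth U A ->
  mder x (X x) (fun y => mder y (Y y) A) - mder x (Y x) (fun y => mder y (X y) A)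
  = mder x (bracket X Y x) A.
Proof.
move=> oU Ux sX sY sA; apply/matrixP => i j.
have e V (Z : E -> CV) : cder x V (fun y => mder y (Z y) A i j) =
    cder x V (fun y => cder y (Z y) (fun z => A z i j)).
  by congr cder; apply/funext => y; rewrite mxE.
by rewrite !mxE (cder_bracket oU Ux sX sY (sA i j)) !e.
Qed.

(** Terms pairing a first derivative of A with a connection matrix are symmetric in X and Y and
    cancel; the second derivatives of A and the derivatives of the fields are absorbed by the
    bracket term. What remains is tensorial. *)
Lemma cov_curvature p U x (X Y : E -> CV) (A : E -> 'M[C]_(p, m)) : open U -> U x ->
  U `<=` D -> vsmooth U X -> vsmooth U Y -> msmooth U A ->
  cov x (X x) (fun y => cov y (Y y) A) - cov x (Y x) (fun y => cov y (X y) A)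
    - cov x (bracket X Y x) A = A x *m chern_curv x (X x) (Y x).
Proof.
move=> oU Ux UD sX sY sA.
have e (V W : E -> CV) : vsmooth U V -> vsmooth U W ->
    cov x (V x) (fun y => cov y (W y) A) = mder x (V x) (fun y => mder y (W y) A)
      + (mder x (V x) A *m chern_form x (W x) + mder x (W x) A *m chern_form x (V x))
      + A x *m (mder x (V x) (fun y => chern_form y (W x)) + chern_form x (cderv x (V x) W)
         + chern_form x (W x) *m chern_form x (V x)).
  move=> sV sW; have sc := smooth_chern_form oU UD sW.
  rewrite /cov (mderD _ Ux (msmooth_mder oU sA sW) (msmoothM oU sA sc)).
  rewrite (mderM _ oU Ux sA sc) (mder_chern_form _ oU Ux UD sW).
  rewrite mulmxDl !mulmxDr !mulmxA.
  move: (mder x (V x) (fun y => mder y (W y) A)) (mder x (V x) A *m chern_form x (W x))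
    (mder x (W x) A *m chern_form x (V x)) (A x *m mder _ _ _)
    (A x *m chern_form x (cderv _ _ _)) (A x *m _ *m _) => a b c d h k.
  by apply/matrixP => i j; rewrite !mxE; ring.
rewrite (e _ _ sX sY) (e _ _ sY sX) /cov -(mder_mder_bracket oU Ux sX sY sA).
have -> : chern_form x (bracket X Y x) =
    chern_form x (cderv x (X x) Y) - chern_form x (cderv x (Y x) X).
  have -> : bracket X Y x = (-1) *: cderv x (Y x) X + cderv x (X x) Y.
    by rewrite scaleN1r addrC.
  by rewrite chern_formL scaleN1r addrC.
rewrite /chern_curv.
move: (chern_form x (cderv _ _ Y)) (chern_form x (cderv _ _ X)).
move: (mder x (X x) (fun y => mder _ _ _)) (mder x (Y x) (fun y => mder _ _ _)).
move: (mder x (X x) (fun y => chern_form _ _)) (mder x (Y x) (fun y => chern_form _ _)).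
move: (chern_form _ _) (chern_form _ _) (mder _ _ A) (mder _ _ A) (A x) => a b c d e' f h k l o q.
rewrite !mulmxDr !mulmxN.
move: (e' *m o) (e' *m q) (e' *m (a *m b)) (e' *m (b *m a)) (e' *m f) (e' *m h) => {f h}*.
by apply/matrixP => i j; rewrite !mxE; ring.
Qed.

Lemma chern_curvature_holo x (a : 'rV[C]_m) : D x ->
  (chern_curvature g (fun=> holo a) (fun=> cconj (holo a)) (fun=> holo a) x).1 =
  a *m chern_curv x (holo a) (cconj (holo a)).
Proof.
move=> Dx.
have sub : D `<=` D by [].
rewrite -(cov_curvature oD Dx sub (vsmooth_cst D (holo a)) (vsmooth_cst D (cconj (holo a)))
  (msmooth_cst D a)).
have e V W : (chern g x V (fun y => chern g y W (fun=> holo a))).1 =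
    cov x V (fun y => cov y W (fun=> a)).
  by rewrite chern1; congr cov; apply/funext => y; rewrite chern1.
have -> : (chern_curvature g (fun=> holo a) (fun=> cconj (holo a)) (fun=> holo a) x).1 =
    (chern g x (holo a) (fun y => chern g y (cconj (holo a)) (fun=> holo a))).1
    - (chern g x (cconj (holo a)) (fun y => chern g y (holo a) (fun=> holo a))).1
    - (chern g x (bracket (fun=> holo a) (fun=> cconj (holo a)) x) (fun=> holo a)).1.
  reflexivity.
by congr (_ - _ - _); [exact: e|exact: e|exact: chern1].
Qed.

Lemma KtildeE x (a : 'rV[C]_m) : D x -> Ktilde g x a =
  hprod (g x) (a *m chern_curv x (holo a) (cconj (holo a))) a 0 0 / hprod (g x) a a 0 0 ^+ 2.
Proof.
move=> Dx; rewrite /Ktilde sqnorm_holo metricE cconjK chern_curvature_holo //.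
by rewrite cconj_holo1 hprod0l [X in (_ + X) / _]mxE addr0.
Qed.

End KahlerChart.

(** * Adapted frames along a pseudohermitian hypersurface *)

Local Opaque cov chern_form.
Local Notation eta := Defs.eta.

Section HprodAlgebra.
Context {R : realType} {m : nat}.
Local Notation C := R[i].
Implicit Types (G : 'M[C]_m).

Lemma hprodE p q G (A : 'M[C]_(p, m)) (B : 'M[C]_(q, m)) : hprod G A B = A *m G *m ctr B.
Proof. by []. Qed.

Lemma hprodDl p q G (A B : 'M[C]_(p, m)) (D : 'M[C]_(q, m)) :
  hprod G (A + B) D = hprod G A D + hprod G B D.
Proof. by rewrite /hprod !mulmxDl. Qed.

Lemma hprodDr p q G (A B : 'M[C]_(p, m)) (D : 'M[C]_(q, m)) :
  hprod G D (A + B) = hprod G D A + hprod G D B.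
Proof. by rewrite /hprod ctrD mulmxDr. Qed.

Lemma hprodZl p q G c (A : 'M[C]_(p, m)) (D : 'M[C]_(q, m)) :
  hprod G (c *: A) D = c *: hprod G A D.
Proof. by rewrite /hprod -!scalemxAl. Qed.

Lemma hprodZr p q G c (A : 'M[C]_(p, m)) (D : 'M[C]_(q, m)) :
  hprod G D (c *: A) = conjc c *: hprod G D A.
Proof. by rewrite /hprod ctrZ -scalemxAr. Qed.

Lemma hprodNl p q G (A : 'M[C]_(p, m)) (D : 'M[C]_(q, m)) : hprod G (- A) D = - hprod G A D.
Proof. by rewrite /hprod !mulNmx. Qed.

Lemma hprodBl p q G (A B : 'M[C]_(p, m)) (D : 'M[C]_(q, m)) :
  hprod G (A - B) D = hprod G A D - hprod G B D.
Proof. by rewrite hprodDl hprodNl. Qed.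

Lemma hprodMl p q r G (B : 'M[C]_(r, p)) (A : 'M[C]_(p, m)) (D : 'M[C]_(q, m)) :
  hprod G (B *m A) D = B *m hprod G A D.
Proof. by rewrite /hprod !mulmxA. Qed.

Lemma hprodMr p q r G (B : 'M[C]_(r, p)) (A : 'M[C]_(p, m)) (D : 'M[C]_(q, m)) :
  hprod G D (B *m A) = hprod G D A *m ctr B.
Proof. by rewrite /hprod ctrM !mulmxA. Qed.

Lemma kform_holo G (a b : 'rV[C]_m) :
  kform G (holo a) (cconj (holo b)) = imC * hprod G a b 0 0.
Proof. by rewrite kformE cconjK cconj_holo1 hprod0l [X in _ - X]mxE subr0. Qed.

End HprodAlgebra.

Local Opaque hprod.

Section PseudohermitianFrame.
Context {R : realType} {m n : nat}.
Local Notation E := (cspace R m).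
Local Notation C := R[i].
Local Notation CV := (cvec R m).
Variables (g : E -> 'M[C]_m) (D S : set E) (theta : E -> CV) (U W : set E) (F : frame R m n).
Hypotheses (oD : open D) (kg : kahler_metric D g) (SD : S `<=` D).
Hypothesis theta_real : forall y, S y -> cconj (theta y) = theta y.
Hypothesis theta_kernel : forall y, S y -> forall V, cconj V = V -> tangent S y V ->
  (app (theta y) V = 0 <-> tangent S y (holo V.1)).
Hypothesis theta_kform : forall y, S y -> forall V V', tangent S y V -> tangent S y V' ->
  dform theta y V V' = kform (g y) V V'.
Hypotheses (oW : open W) (WD : W `<=` D) (WU : W `<=` U) (sth : vsmooth W theta).
Hypothesis twF : tw_frame S theta U F.
Implicit Types (y : E) (V : CV) (zt : 'rV[C]_n).

Definition Zm y : 'M[C]_(n, m) := \matrix_i Z F i y.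
Definition xi y : 'rV[C]_m := (reeb F y).1.
Definition omx y V : 'M[C]_n := \matrix_(i, j) app (om F i j y) V.
Definition et y V : 'rV[C]_n := \row_b app (eta F b y) V.
Definition tormx y : 'M[C]_n := \matrix_(b, a) tor F b a y.
(** The section of T^(1,0)(M) with constant components [zt]. The coframe and theta take constant
    values on it along M, so brackets of such sections are given by the structure equations. *)
Definition Lf zt y : CV := holo (zt *m Zm y).

Lemma cconjZ c V : cconj (c *: V) = conjc c *: cconj V.
Proof.
rewrite -[c *: V]addr0 cconjL (_ : cconj 0 = 0) ?addr0 //.
by congr pair; apply/rowP => j; rewrite !mxE conjc0.
Qed.

Lemma appZ (p : CV) c V : app p (c *: V) = c * app p V.
Proof.
have -> : c *: V = (c - 1) *: V + V by rewrite -{3}[V]scale1r -scalerDl subrK.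
rewrite appL; ring.
Qed.

Lemma appD (p V V' : CV) : app p (V + V') = app p V + app p V'.
Proof. by rewrite -[V]scale1r appL mul1r scale1r. Qed.

Lemma app0 (p : CV) : app p 0 = 0.
Proof. by rewrite -(scale0r (0 : CV)) appZ mul0r. Qed.

Lemma etL y c V V' : et y (c *: V + V') = c *: et y V + et y V'.
Proof. by apply/rowP => b; rewrite !mxE appL. Qed.

Lemma omxL y c V V' : omx y (c *: V + V') = c *: omx y V + omx y V'.
Proof. by apply/matrixP => i j; rewrite !mxE appL. Qed.

Lemma omxZ y c V : omx y (c *: V) = c *: omx y V.
Proof. by apply/matrixP => i j; rewrite !mxE appZ. Qed.

Lemma smooth_Zm : msmooth W Zm.
Proof.
move=> i j; apply: (csmooth_eq (f := fun y => Z F i y 0 j)) => //.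
  by move=> y _; rewrite mxE.
by case: (tw_smooth twF) => sZ _ _ _ _; exact: csmooth_sub WU (sZ i j).
Qed.

Lemma smooth_reeb : vsmooth W (reeb F).
Proof. by case: (tw_smooth twF) => _ sT _ _ _; exact: vsmooth_sub WU sT. Qed.

Lemma smooth_xi : msmooth W xi.
Proof. by apply/rowsmoothP; case: smooth_reeb. Qed.

Lemma smooth_eta b : vsmooth W (eta F b).
Proof. by case: (tw_smooth twF) => _ _ /(_ b) s _ _; exact: vsmooth_sub WU s. Qed.

Lemma smooth_hmx : msmooth W (hmx F).
Proof. by case: (tw_smooth twF) => _ _ _ sh _ i j; exact: csmooth_sub WU (sh i j). Qed.

Lemma smooth_om i j : vsmooth W (om F i j).
Proof. by case: (tw_smooth twF) => _ _ _ _ [/(_ i j) s _]; exact: vsmooth_sub WU s. Qed.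

Lemma smooth_omx (X : E -> CV) : vsmooth W X -> msmooth W (fun y => omx y (X y)).
Proof.
move=> sX i j; apply: (csmooth_eq (f := fun y => app (om F i j y) (X y))) => //.
  by move=> y _; rewrite mxE.
exact: (csmooth_app oW (smooth_om i j) sX).
Qed.

Lemma smooth_Lf zt : vsmooth W (Lf zt).
Proof.
apply: vsmooth_holo; apply/rowsmoothP.
exact: (msmoothM oW (msmooth_cst W zt) smooth_Zm).
Qed.

Section AtPoint.
Variables (y : E).
Hypotheses (Wy : W y) (Sy : S y).
Let Uy : U y. Proof. exact: WU. Qed.
Let Dy : D y. Proof. exact: WD. Qed.

Lemma Lf_sum zt : Lf zt y = \sum_a zt 0 a *: ZV F a y.
Proof.
have e1 : (\sum_a zt 0 a *: ZV F a y).1 = \sum_a (zt 0 a *: ZV F a y).1.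
  by apply: (big_morph (fun V : CV => V.1)).
have e2 : (\sum_a zt 0 a *: ZV F a y).2 = \sum_a (zt 0 a *: ZV F a y).2.
  by apply: (big_morph (fun V : CV => V.2)).
rewrite [RHS]surjective_pairing e1 e2 /Lf; congr pair.
  by rewrite mulmx_sum_row; apply: eq_bigr => a _; rewrite rowK.
by rewrite big1 // => a _; rewrite /= scaler0.
Qed.

Lemma tangent_Lf zt : tangent S y (Lf zt y).
Proof. by rewrite Lf_sum; apply: tangent_sum => a; apply: tangentZ; exact: (tw_tangent twF). Qed.

Lemma tangent_Lfc zt : tangent S y (cconj (Lf zt y)).
Proof. by apply: tangent_conj; exact: tangent_Lf. Qed.

Lemma app_sum (p : CV) (I : Type) (r : seq I) (f : I -> C) (V : I -> CV) :
  app p (\sum_(i <- r) f i *: V i) = \sum_(i <- r) f i * app p (V i).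
Proof.
by elim: r => [|i r IH]; [rewrite !big_nil app0|rewrite !big_cons appL IH].
Qed.

Lemma et_Lf zt : et y (Lf zt y) = zt.
Proof.
apply/rowP => b; rewrite mxE Lf_sum app_sum (bigD1 b) //=.
have [-> _ _] := tw_dual twF Uy Sy b; rewrite eqxx mulr1 big1 ?addr0 // => a ab.
by have [-> _ _] := tw_dual twF Uy Sy b; rewrite eq_sym (negbTE ab) mulr0.
Qed.

Lemma et_Lfc zt : et y (cconj (Lf zt y)) = 0.
Proof.
apply/rowP => b; rewrite !mxE; suff h : conjc (app (eta F b y) (cconj (Lf zt y))) = 0.
  by rewrite -[LHS]conjcK h conjc0.
rewrite -app_conj Lf_sum app_sum big1 // => a _.
by rewrite app_conj; have [_ -> _] := tw_dual twF Uy Sy b; rewrite conjc0 mulr0.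
Qed.

Lemma et_reeb : et y (reeb F y) = 0.
Proof. by apply/rowP => b; rewrite !mxE; have [_ _ ->] := tw_dual twF Uy Sy b. Qed.

Lemma theta_conj V : app (theta y) (cconj V) = conjc (app (theta y) V).
Proof. by rewrite -{1}(theta_real Sy) app_conj cconjK. Qed.

Lemma holo_cconj_pm c (a : 'rV[C]_m) :
  (c *: holo a + cconj (c *: holo a)).1 = c *: a.
Proof. by rewrite cconjZ /=; apply/rowP => j; rewrite !mxE conjc0 mulr0 addr0. Qed.

(** The kernel of theta is prescribed for real vectors. Applied to Z + Zbar and to iZ - i Zbar it
    gives theta(Z) + theta(Zbar) = 0 and theta(Z) - theta(Zbar) = 0. *)
Lemma theta_holo (a : 'rV[C]_m) : tangent S y (holo a) -> app (theta y) (holo a) = 0.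
Proof.
move=> ta.
have h (c : C) : app (theta y) (c *: holo a + cconj (c *: holo a)) = 0.
  have tc : tangent S y (c *: holo a + cconj (c *: holo a)).
    by apply: tangentD; [|apply: tangent_conj]; exact: tangentZ.
  apply/(theta_kernel Sy) => //; first by rewrite cconjD cconjK addrC.
  rewrite holo_cconj_pm (_ : holo (c *: a) = c *: holo a); first exact: tangentZ.
  by congr pair; rewrite scaler0.
have h1 := h 1; have h2 := h imC; move: h1 h2.
rewrite 2!cconjZ 2!appD 4!appZ conjc1 imC_conj 2!mul1r mulNr -mulrBr => e1 e2.
have i0 : (imC : C) != 0 by rewrite eq_complex /= negb_and oner_eq0 orbT.
have {}e2 : app (theta y) (holo a) - app (theta y) (cconj (holo a)) = 0.
  by apply: (mulfI i0); rewrite e2 mulr0.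
have two0 : (2%:R : C) != 0 by rewrite pnatr_eq0.
apply: (mulfI two0); rewrite mulr0 mulr_natl mulr2n.
have := congr2 +%R e1 e2; rewrite addr0; move: (app _ _) (app _ _) => u v <-; ring.
Qed.

Lemma theta_Lf zt : app (theta y) (Lf zt y) = 0.
Proof. by apply: theta_holo; exact: tangent_Lf. Qed.

Lemma theta_Lfc zt : app (theta y) (cconj (Lf zt y)) = 0.
Proof. by rewrite theta_conj theta_Lf conjc0. Qed.

Lemma theta_reeb : app (theta y) (reeb F y) = 1.
Proof. by have [] := tw_reeb twF Uy Sy. Qed.

Lemma tangent_reeb : tangent S y (reeb F y).
Proof. by have [] := tw_reeb twF Uy Sy. Qed.

Lemma reeb_real : cconj (reeb F y) = reeb F y.
Proof. by have [] := tw_reeb twF Uy Sy. Qed.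

Lemma dtheta_reeb V : tangent S y V -> dform theta y (reeb F y) V = 0.
Proof. by have [_ _ _] := tw_reeb twF Uy Sy; exact. Qed.

Lemma dform_sym (p : E -> CV) V V' : dform p y V' V = - dform p y V V'.
Proof. by rewrite /dform opprB. Qed.

Lemma holo_frame (a : 'rV[C]_m) : tangent S y (holo a) -> a = et y (holo a) *m Zm y.
Proof.
move=> ta; rewrite {1}(tw_frameP twF Uy Sy ta) mulmx_sum_row.
by apply: eq_bigr => b _; rewrite rowK mxE.
Qed.

(** V.1 is a complex combination of the (1,0)-parts of the real vectors cV + conj(cV) for c = 1 and
    c = i, and the kernel condition applies to each of these. *)
Lemma tangent_holo V : tangent S y V -> app (theta y) V = 0 -> tangent S y (holo V.1).
Proof.
move=> tV V0.
have h (c : C) : tangent S y (holo (c *: V + cconj (c *: V)).1).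
  have tc : tangent S y (c *: V + cconj (c *: V)).
    by apply: tangentD; [|apply: tangent_conj]; exact: tangentZ.
  apply/(theta_kernel Sy) => //; first by rewrite cconjD cconjK addrC.
  by rewrite appD theta_conj appZ V0 mulr0 conjc0 addr0.
have -> : holo V.1 = 2^-1 *: (holo (1 *: V + cconj (1 *: V)).1
    + (- imC) *: holo (imC *: V + cconj (imC *: V)).1); last first.
  by apply: tangentZ; apply: tangentD => //; exact: tangentZ.
congr pair; last by rewrite /= scaler0 addr0 scaler0.
have i2 := @imC2 R.
have e (v w : 'rV[C]_m) : v = 2^-1 *: ((1 *: v + w) + (- imC) *: (imC *: v - imC *: w)).
  rewrite scale1r [(- imC) *: _]scalerBr [(- imC) *: (imC *: v)]scalerA
    [(- imC) *: (imC *: w)]scalerA mulNr i2 opprK !scale1r.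
  apply/rowP => j; rewrite !mxE; move: (v 0 j) (w 0 j) => r s.
  by rewrite (_ : r + s + (r - s) = 2 * r) ?mulKf ?pnatr_eq0 //; ring.
rewrite {1}(e V.1 (cconj V).1) !cconjZ conjc1 imC_conj !scale1r.
by rewrite -scaleNr.
Qed.

(** After subtraction of theta(V) T the vector lies in the complexification of H(M), where the
    (1,0)-part is tangent and expands in the frame. *)
Lemma decomposition V : tangent S y V ->
  V.1 = et y V *m Zm y + app (theta y) V *: xi y.
Proof.
move=> tV; pose V' := (- app (theta y) V) *: reeb F y + V.
have tV' : tangent S y V' by apply: tangentL => //; exact: tangent_reeb.
have V'0 : app (theta y) V' = 0 by rewrite appL theta_reeb mulr1 addNr.
have tc := tangent_conj tV'.
have c0 : app (theta y) (cconj V') = 0 by rewrite theta_conj V'0 conjc0.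
have e1 : V'.1 = et y V' *m Zm y.
  rewrite {1}(holo_frame (tangent_holo tV' V'0)); congr (_ *m _).
  rewrite [in RHS](cvec_split V') -[holo V'.1]scale1r etL !scale1r.
  rewrite (_ : et y (cconj _) = 0) ?addr0 //.
  have -> : holo (cconj V').1 = Lf (et y (holo (cconj V').1)) y.
    by rewrite /Lf -(holo_frame (tangent_holo tc c0)).
  exact: et_Lfc.
move: e1; rewrite {2}/V' etL et_reeb scaler0 add0r => <-.
have -> : V'.1 = - (app (theta y) V *: xi y) + V.1 by rewrite -scaleNr.
by rewrite addrAC addNr add0r.
Qed.

Lemma dtheta_matrix V V' : tangent S y V -> tangent S y V' -> dform theta y V V' =
  imC * ((et y V *m hmx F y *m ctr (et y (cconj V'))) 0 0
       - (et y V' *m hmx F y *m ctr (et y (cconj V))) 0 0).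
Proof.
move=> tV tV'; rewrite (tw_h twF Uy Sy tV tV'); congr (_ * _).
have e (v w : 'rV[C]_n) : (v *m hmx F y *m ctr w) 0 0 =
    \sum_a \sum_b hmx F y a b * (v 0 a * conjc (w 0 b)).
  rewrite mxE exchange_big; apply: eq_bigr => b _.
  rewrite !mxE mulr_suml; apply: eq_bigr => a _; ring.
rewrite !e -sumrB; apply: eq_bigr => a _; rewrite -sumrB; apply: eq_bigr => b _.
by rewrite /wedge !app_conj !mxE mulrBr.
Qed.

Lemma mx_forms_eq (A B : 'M[C]_n) :
  (forall v w : 'rV[C]_n, (v *m A *m ctr w) 0 0 = (v *m B *m ctr w) 0 0) -> A = B.
Proof.
move=> AB; apply/matrixP => i j; have := AB (delta_mx 0 i) (delta_mx 0 j).
have e (M : 'M[C]_n) :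
    ((delta_mx 0 i : 'rV_n) *m M *m ctr (delta_mx 0 j : 'rV_n)) 0 0 = M i j.
  rewrite -rowE mxE (bigD1 j) //= big1 ?addr0 => [|k kj]; rewrite !mxE !eqxx.
    by rewrite conjc1 mulr1.
  by rewrite (negbTE kj) conjc0 mulr0.
by rewrite !e.
Qed.

Lemma imC_neq0 : (imC : C) != 0.
Proof. by rewrite eq_complex /= negb_and oner_eq0 orbT. Qed.

(** Since dtheta is the pullback of omega, the Levi matrix is the Gram matrix of the frame for the
    ambient metric. *)
Lemma hmxE : hmx F y = hprod (g y) (Zm y) (Zm y).
Proof.
apply: mx_forms_eq => v w.
have tv := tangent_Lf v; have tw := tangent_Lfc w.
have := dtheta_matrix tv tw; rewrite (theta_kform Sy tv tw) kform_holo cconjK !et_Lf et_Lfc.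
rewrite !mul0mx [X in _ = _ * (_ - X)]mxE subr0.
by move/(mulfI imC_neq0) => <-; rewrite hprodMl hprodMr mulmxA.
Qed.

Lemma hmx_herm : ctr (hmx F y) = hmx F y.
Proof. by rewrite hmxE (hprod_ctr kg). Qed.

Lemma xi_orth : hprod (g y) (xi y) (Zm y) = 0.
Proof.
apply/rowP => j; pose w : 'rV[C]_n := delta_mx 0 j.
have tw := tangent_Lfc w; have := dtheta_reeb tw.
rewrite (theta_kform Sy tangent_reeb tw) kformE cconjK cconj_holo1 hprod0l.
rewrite [X in _ - X]mxE subr0 => /eqP; rewrite mulf_eq0 (negbTE imC_neq0) => /eqP.
rewrite hprodMr mxE (bigD1 j) //= big1 ?addr0 => [|k kj]; rewrite !mxE !eqxx.
  by rewrite conjc1 mulr1.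
by rewrite (negbTE kj) conjc0 mulr0.
Qed.

Lemma orth_xi : hprod (g y) (Zm y) (xi y) = 0.
Proof. by rewrite -(hprod_ctr kg) // xi_orth ctr0. Qed.

Lemma structure_matrix V V' : tangent S y V -> tangent S y V' ->
  \row_b dform (eta F b) y V V' =
  et y V *m omx y V' - et y V' *m omx y V
  + (app (theta y) V *: map_mx conjc (et y (cconj V'))
     - app (theta y) V' *: map_mx conjc (et y (cconj V))) *m (tormx y)^T.
Proof.
move=> tV tV'; apply/rowP => b; rewrite !mxE (tw_structure twF Uy Sy b tV tV').
congr (_ + _).
  by rewrite -sumrB; apply: eq_bigr => a _; rewrite /wedge !mxE.
by apply: eq_bigr => a _; rewrite /wedge !app_conj !mxE mulrC.
Qed.

End AtPoint.

(** With p constant on both fields along M, the two derivative terms of Cartan's formula vanish and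
    dp determines p([X, Y]). *)
Lemma bracket_form (p X Y : E -> CV) (cX cY : C) y : W y -> S y -> vsmooth W p ->
  vsmooth W X -> vsmooth W Y -> tangent S y (X y) -> tangent S y (Y y) ->
  (forall z, W z -> S z -> app (p z) (X z) = cX) ->
  (forall z, W z -> S z -> app (p z) (Y z) = cY) ->
  app (p y) (bracket X Y y) = - dform p y (X y) (Y y).
Proof.
move=> Wy Sy sp sX sY tX tY pX pY; rewrite (dform_fields oW Wy sp sX sY).
rewrite (tangent_cder_eq oW Wy (csmooth_app oW sp sY) (csmooth_cst W cY) tX pY).
rewrite (tangent_cder_eq oW Wy (csmooth_app oW sp sX) (csmooth_cst W cX) tY pX).
by rewrite !cder_cst subr0 sub0r opprK.
Qed.

Lemma bracket_decomposition (X Y : E -> CV) (cX cY : 'rV[C]_n) (tX tY : C) y : W y -> S y ->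
  vsmooth W X -> vsmooth W Y ->
  (forall z, W z -> S z -> [/\ tangent S z (X z), et z (X z) = cX & app (theta z) (X z) = tX]) ->
  (forall z, W z -> S z -> [/\ tangent S z (Y z), et z (Y z) = cY & app (theta z) (Y z) = tY]) ->
  [/\ et y (bracket X Y y) = - \row_b dform (eta F b) y (X y) (Y y),
      app (theta y) (bracket X Y y) = - dform theta y (X y) (Y y)
    & (bracket X Y y).1 = et y (bracket X Y y) *m Zm y
        + app (theta y) (bracket X Y y) *: xi y].
Proof.
move=> Wy Sy sX sY hX hY.
have [tXy _ _] := hX y Wy Sy; have [tYy _ _] := hY y Wy Sy; split.
- apply/rowP => b; rewrite !mxE.
  apply: (@bracket_form (eta F b) X Y (cX 0 b) (cY 0 b)) => //; first exact: smooth_eta.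
    by move=> z Wz Sz; have [_ <- _] := hX z Wz Sz; rewrite mxE.
  by move=> z Wz Sz; have [_ <- _] := hY z Wz Sz; rewrite mxE.
- apply: (@bracket_form theta X Y tX tY) => // z Wz Sz.
    by have [] := hX z Wz Sz.
  by have [] := hY z Wz Sz.
- apply: decomposition => //; apply: (tangent_bracket oW) => // z Wz Sz.
    by have [] := hX z Wz Sz.
  by have [] := hY z Wz Sz.
Qed.

Definition adapted (X : E -> CV) (cX : 'rV[C]_n) (tX : C) := forall z, W z -> S z ->
  [/\ tangent S z (X z), et z (X z) = cX & app (theta z) (X z) = tX].

Lemma adapted_Lf zt : adapted (Lf zt) zt 0.
Proof.
by move=> z Wz Sz; split; [exact: tangent_Lf|exact: et_Lf|exact: theta_Lf].
Qed.

Lemma adapted_Lfc zt : adapted (fun z => cconj (Lf zt z)) 0 0.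
Proof.
by move=> z Wz Sz; split; [exact: tangent_Lfc|exact: et_Lfc|exact: theta_Lfc].
Qed.

Lemma adapted_reeb : adapted (reeb F) 0 1.
Proof.
by move=> z Wz Sz; split; [exact: tangent_reeb|exact: et_reeb|exact: theta_reeb].
Qed.

Lemma smooth_Lfc zt : vsmooth W (fun z => cconj (Lf zt z)).
Proof. exact: vsmooth_conj oW (smooth_Lf zt). Qed.

Lemma cov_Zm_row zt y V : W y ->
  zt *m cov g y V Zm = cov g y V (fun z => (Lf zt z).1).
Proof.
move=> Wy; rewrite /= (covM g V oW Wy (msmooth_cst W zt) smooth_Zm).
by rewrite mder_cst mul0mx add0r.
Qed.

Lemma cov_Lfc1 zt y V : cov g y V (fun z => (cconj (Lf zt z)).1) = 0.
Proof.
rewrite -[RHS](cov0 g 1 y V); congr cov; apply/funext => z; exact: cconj_holo1.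
Qed.

Lemma mul_mx11 p (A : 'M[C]_1) (B : 'M[C]_(1, p)) : A *m B = A 0 0 *: B.
Proof. by rewrite {1}[A]mx11_scalar mul_scalar_mx. Qed.

Lemma rows_eq p q (A B : 'M[C]_(p, q)) : (forall v : 'rV[C]_p, v *m A = v *m B) -> A = B.
Proof. by move=> AB; apply/row_matrixP => i; rewrite !rowE. Qed.

(** For Z = [Lf v] and W = [Lf zt], torsion-freeness makes the derivative of Z along Wbar minus the
    (1,0)-part of [Z, Wbar]. The coframe components of the bracket give the connection form; its
    Reeb component - dtheta(Z, Wbar) = - i <Z, W> gives the normal term i <Z, W> xi, the source of H
    = i xi. *)
Lemma cov_Lfc zt y : W y -> S y ->
  cov g y (cconj (Lf zt y)) Zm =
  omx y (cconj (Lf zt y)) *m Zm y + (imC *: (hmx F y *m ctr zt)) *m xi y.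
Proof.
move=> Wy Sy; apply: rows_eq => v.
have [e1 e2 e3] := bracket_decomposition Wy Sy (smooth_Lf v) (smooth_Lfc zt)
  (@adapted_Lf v) (@adapted_Lfc zt).
have tv := tangent_Lf Wy Sy v; have tw := tangent_Lfc Wy Sy zt.
have := cov_torsion_free kg (Lf v) (fun z => cconj (Lf zt z)) Wy WD.
rewrite cov_Lfc1 sub0r -(cov_Zm_row _ _ Wy) e3 e1 e2 (structure_matrix Wy Sy tv tw).
rewrite (theta_kform Sy tv tw) kform_holo cconjK.
rewrite (et_Lf Wy Sy) (et_Lfc Wy Sy) (theta_Lf Wy Sy) (theta_Lfc Wy Sy).
rewrite !(mul0mx, scale0r, subr0, addr0) mulNmx scaleNr -opprD => /oppr_inj ->.
rewrite mulmxDr !mulmxA; congr (_ + _).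
rewrite hprodMl hprodMr -(hmxE Wy Sy) -scalemxAr -scalemxAl mul_mx11 scalerA.
by rewrite mulmxA.
Qed.

Definition xi2 y : C := hprod (g y) (xi y) (xi y) 0 0.

Lemma hprod_xi y : hprod (g y) (xi y) (xi y) = (xi2 y)%:M.
Proof. exact: mx11_scalar. Qed.

(** As xi is the (1,0)-part of T, the derivative is the (1,0)-part of [Zbar, T]. Its coframe
    components are the torsion terms of the structure equations, and its Reeb component vanishes
    because T _| dtheta = 0. *)
Lemma cov_Lfc_xi zt y : W y -> S y ->
  cov g y (cconj (Lf zt y)) xi = (map_mx conjc zt *m (tormx y)^T) *m Zm y.
Proof.
move=> Wy Sy.
have [e1 e2 e3] := bracket_decomposition Wy Sy (smooth_Lfc zt) smooth_reeb
  (@adapted_Lfc zt) adapted_reeb.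
have tv := tangent_reeb Wy Sy; have tw := tangent_Lfc Wy Sy zt.
have := cov_torsion_free kg (fun z => cconj (Lf zt z)) (reeb F) Wy WD.
rewrite cov_Lfc1 subr0 e3 e1 e2 (structure_matrix Wy Sy tw tv).
rewrite dform_sym (dtheta_reeb Wy Sy tw) !oppr0 scale0r addr0.
rewrite (reeb_real Wy Sy) (et_reeb Wy Sy) (et_Lfc Wy Sy) (theta_Lfc Wy Sy) (theta_reeb Wy Sy).
rewrite cconjK (et_Lf Wy Sy) !(mul0mx, scale0r, subr0, add0r, oppr0, sub0r, scale1r, mulNmx, opprK).
by move=> ->.
Qed.

(** Differentiating <xi, Z_b> = 0 along Z moves the derivative onto Z_b, in the conjugate direction
    Zbar covered by [cov_Lfc]. *)
Lemma cov_Lf_xi_Zm zt y : W y -> S y ->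
  hprod (g y) (cov g y (Lf zt y) xi) (Zm y) = (imC * xi2 y) *: (zt *m hmx F y).
Proof.
move=> Wy Sy.
have := mder_hprod oD kg (Lf zt y) oW Wy WD smooth_xi smooth_Zm.
rewrite (tangent_mder_eq oW Wy (B := fun=> 0) _ _ (tangent_Lf Wy Sy zt)); last first.
- by move=> z Wz Sz; rewrite xi_orth.
- exact: msmooth_cst.
- exact: (msmoothM oW (msmoothM oW smooth_xi (msmooth_sub WD (smooth_g kg)))
    (msmooth_ctr oW smooth_Zm)).
rewrite mder_cst => /esym/eqP; rewrite addr_eq0 => /eqP ->.
rewrite (cov_Lfc _ Wy Sy) hprodDr !hprodMr (xi_orth Wy Sy) mul0mx add0r hprod_xi.
rewrite mul_scalar_mx ctrZ imC_conj ctrM ctrK (hmx_herm Wy Sy) scalerA -scaleNr mulrN opprK.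
by rewrite mulrC.
Qed.

Lemma mder_hmx y V : W y -> S y -> tangent S y V ->
  mder y V (hmx F) = omx y V *m hmx F y + hmx F y *m ctr (omx y (cconj V)).
Proof.
move=> Wy Sy tV; apply/matrixP => i j; rewrite !mxE (tw_metric twF (WU Wy) Sy i j tV).
by congr (_ + _); apply: eq_bigr => k _; rewrite ?app_conj !mxE.
Qed.

(** Both connections are metric, so dh has two expressions. Agreement of the tangential parts in the
    direction conj V, which governs the second slot, forces agreement in the direction V. *)
Lemma cov_Zm_pairing y V : W y -> S y -> tangent S y V ->
  hprod (g y) (Zm y) (cov g y (cconj V) Zm) = hmx F y *m ctr (omx y (cconj V)) ->
  hprod (g y) (cov g y V Zm) (Zm y) = omx y V *m hmx F y.
Proof.
move=> Wy Sy tV e.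
have := mder_hprod oD kg V oW Wy WD smooth_Zm smooth_Zm.
rewrite e -(tangent_mder_eq oW Wy smooth_hmx _ tV); last first.
- by move=> z Wz Sz; rewrite hmxE.
- exact: (msmoothM oW (msmoothM oW smooth_Zm (msmooth_sub WD (smooth_g kg)))
    (msmooth_ctr oW smooth_Zm)).
by rewrite (mder_hmx Wy Sy tV) => /addIr.
Qed.

Lemma cov_Lfc_Zm zt y : W y -> S y ->
  hprod (g y) (cov g y (cconj (Lf zt y)) Zm) (Zm y) = omx y (cconj (Lf zt y)) *m hmx F y.
Proof.
move=> Wy Sy; rewrite (cov_Lfc _ Wy Sy) hprodDl !hprodMl (xi_orth Wy Sy) mulmx0 addr0.
by rewrite -hmxE.
Qed.

Lemma cov_Lf_Zm zt y : W y -> S y ->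
  hprod (g y) (cov g y (Lf zt y) Zm) (Zm y) = omx y (Lf zt y) *m hmx F y.
Proof.
move=> Wy Sy; apply: cov_Zm_pairing => //; first exact: tangent_Lf.
rewrite -(hprod_ctr kg) ?(cov_Lfc_Zm _ Wy Sy) ?ctrM ?(hmx_herm Wy Sy) //; exact: WD.
Qed.

(** Differentiating <Z_b, xi> = 0 along Z leaves the derivative of xi along Zbar, which is the
    torsion. This is the normal part of II on pairs of (1,0)-vectors. *)
Lemma cov_Lf_Zm_xi zt y : W y -> S y ->
  hprod (g y) (cov g y (Lf zt y) Zm) (xi y) =
  - (hmx F y *m map_mx conjc (tormx y) *m zt^T).
Proof.
move=> Wy Sy.
have := mder_hprod oD kg (Lf zt y) oW Wy WD smooth_Zm smooth_xi.
rewrite (tangent_mder_eq oW Wy (B := fun=> 0) _ _ (tangent_Lf Wy Sy zt)); last first.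
- by move=> z Wz Sz; rewrite orth_xi.
- exact: msmooth_cst.
- exact: (msmoothM oW (msmoothM oW smooth_Zm (msmooth_sub WD (smooth_g kg)))
    (msmooth_ctr oW smooth_xi)).
rewrite mder_cst => /esym/eqP; rewrite addr_eq0 => /eqP ->; congr (- _).
rewrite (cov_Lfc_xi _ Wy Sy) hprodMr -(hmxE Wy Sy) ctrM -mulmxA; congr (_ *m (_ *m _)).
  by apply/matrixP => i j; rewrite !mxE.
by apply/matrixP => i j; rewrite !mxE conjcK.
Qed.

(** In the (1,0)-part of [T, Z], torsion-freeness leaves, besides the connection form, the
    derivative of xi along Z, whose tangential part is i |xi|^2 Z by [cov_Lf_xi_Zm]. *)
Lemma cov_reeb_Zm y : W y -> S y ->
  hprod (g y) (cov g y (reeb F y) Zm) (Zm y) =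
  omx y (reeb F y) *m hmx F y + (imC * xi2 y) *: hmx F y.
Proof.
move=> Wy Sy; apply: rows_eq => v.
have [e1 e2 e3] := bracket_decomposition Wy Sy smooth_reeb (smooth_Lf v)
  adapted_reeb (@adapted_Lf v).
have tv := tangent_reeb Wy Sy; have tw := tangent_Lf Wy Sy v.
have := cov_torsion_free kg (reeb F) (Lf v) Wy WD.
rewrite -(cov_Zm_row _ _ Wy) e3 e1 e2 (structure_matrix Wy Sy tv tw).
rewrite (dtheta_reeb Wy Sy tw) !oppr0 scale0r addr0.
rewrite (reeb_real Wy Sy) (et_reeb Wy Sy) (et_Lf Wy Sy) (et_Lfc Wy Sy).
rewrite (theta_Lf Wy Sy) (theta_reeb Wy Sy) map_mx0 !(mul0mx, scale0r, scaler0, subr0, addr0, oppr0, sub0r, opprK).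
move => /eqP; rewrite subr_eq => /eqP e.
rewrite -hprodMl e hprodDl (cov_Lf_xi_Zm _ Wy Sy) hprodMl -(hmxE Wy Sy).
by rewrite mulmxDr -scalemxAr mulmxA.
Qed.

(** V splits into a (1,0)-vector, a (0,1)-vector and theta(V) T. On the first two the tangential
    part of the Chern connection is the Tanaka-Webster connection; the Reeb direction adds i |xi|^2
    theta. *)
Lemma cov_tangent_Zm y V : W y -> S y -> tangent S y V ->
  hprod (g y) (cov g y V Zm) (Zm y) =
  omx y V *m hmx F y + (imC * xi2 y * app (theta y) V) *: hmx F y.
Proof.
move=> Wy Sy tV.
have tc := tangent_conj tV.
have reeb_split : reeb F y = holo (xi y) + cconj (holo (xi y)).
  by rewrite {1}[reeb F y]cvec_split (reeb_real Wy Sy).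
have VE : V = 1 *: Lf (et y V) y + (1 *: cconj (Lf (et y (cconj V)) y)
    + app (theta y) V *: reeb F y).
  rewrite {1}[V]cvec_split (decomposition Wy Sy tV) (decomposition Wy Sy tc).
  rewrite (theta_conj Sy) !scale1r reeb_split /Lf.
  congr pair; apply/rowP => j; rewrite !mxE ?conjc0 ?conjcK.
    by rewrite !add0r !addr0.
  by rewrite conjcD conjcM conjcK !add0r.
have oE : omx y V = omx y (Lf (et y V) y) + (omx y (cconj (Lf (et y (cconj V)) y))
    + app (theta y) V *: omx y (reeb F y)).
  by rewrite {1}VE !omxL omxZ !scale1r.
rewrite oE {1}VE covL covL covZ !scale1r hprodDl [X in _ + X]hprodDl hprodZl.
rewrite (cov_Lf_Zm _ Wy Sy) (cov_Lfc_Zm _ Wy Sy) (cov_reeb_Zm Wy Sy).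
rewrite !mulmxDl -!scalemxAl scalerDr !addrA scalerA.
by congr (_ + _ *: _); rewrite mulrC.
Qed.

Lemma xi_neq0 y : W y -> S y -> xi y != 0.
Proof.
move=> Wy Sy; apply/negP => /eqP x0; have := theta_reeb Wy Sy.
rewrite [reeb F y]cvec_split (reeb_real Wy Sy) -/(xi y) x0.
have -> : holo 0 + cconj (holo 0) = 0 :> CV.
  by congr pair; apply/rowP => j; rewrite !mxE conjc0 addr0.
by rewrite app0 => /esym/eqP; rewrite oner_eq0.
Qed.

Lemma xi2_gt0 y : W y -> S y -> 0 < xi2 y.
Proof. by move=> Wy Sy; apply: (hprod_gt0 kg (WD Wy)); exact: xi_neq0. Qed.

(* [T^(1,0)(M)] has codimension one in [T^(1,0)(X)]. *)
Lemma normal_line p y (B : 'M[C]_(p, m)) : m = n.+1 -> W y -> S y ->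
  hprod (g y) B (Zm y) = 0 -> B = ((xi2 y)^-1 *: hprod (g y) B (xi y)) *m xi y.
Proof.
move=> mn Wy Sy B0; have x0 := lt0r_neq0 (xi2_gt0 Wy Sy).
(* Its rows are independent by orthogonality. There are n + 1 = m of them, so they span, and a
   vector orthogonal to all of them is zero. *)
pose P : 'M[C]_(1 + n, m) := col_mx (xi y) (Zm y).
have kP : kermx P == 0.
  apply/eqP/row_matrixP => i; rewrite row0; set v := row i _.
  have vP : v *m P = 0 by rewrite /v -row_mul mulmx_ker row0.
  rewrite -[v]hsubmxK mul_row_col in vP *.
  have l0 : lsubmx v = 0.
    have := congr1 (fun A => hprod (g y) A (xi y)) vP.
    rewrite hprodDl !hprodMl (orth_xi Wy Sy) mulmx0 addr0 hprod0l hprod_xi mul_mx_scalar.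
    by move/eqP; rewrite scaler_eq0 (negbTE x0) => /eqP.
  rewrite l0 mul0mx add0r in vP *.
  have := et_Lf Wy Sy (rsubmx v); rewrite /Lf vP => <-.
  rewrite (_ : et y (holo 0) = 0) ?row_mx0 //.
  by apply/rowP => b; rewrite !mxE -[holo 0]/(0 : CV) app0.
have /row_fullP[Q QP] : row_full P.
  by move: kP; rewrite kermx_eq0 /row_free /row_full => /eqP ->; rewrite mn.
apply/eqP; rewrite -subr_eq0; apply/eqP.
set w := B - _.
have wP : w *m g y *m ctr P = 0.
  rewrite /P (_ : ctr (col_mx _ _) = row_mx (ctr (xi y)) (ctr (Zm y))); last first.
    by rewrite /ctr map_col_mx tr_col_mx.
  rewrite mul_mx_row -!hprodE.
  rewrite /w !hprodBl !hprodMl B0 (xi_orth Wy Sy) hprod_xi mul_mx_scalar scalerA.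
  by rewrite mulfV // scale1r subrr mulmx0 subr0 row_mx0.
have : w *m g y = 0.
  by rewrite -[LHS]mulmx1 -[1%:M]ctr1 -QP ctrM mulmxA wP mul0mx.
by move/(congr1 (mulmx^~ (invmx (g y)))); rewrite mulmxK ?mul0mx // (g_unit kg) //; exact: WD.
Qed.

Definition tw_curv_form y V V' : 'M[C]_n :=
  \matrix_(a, k) (dform (om F a k) y V V' - \sum_l wedge (om F a l y) (om F l k y) V V').

Lemma tw_curv_fields (X Y : E -> CV) y : W y -> vsmooth W X -> vsmooth W Y ->
  tw_curv_form y (X y) (Y y) =
  mder y (X y) (fun z => omx z (Y z)) - mder y (Y y) (fun z => omx z (X z))
  - omx y (bracket X Y y)
  - (omx y (X y) *m omx y (Y y) - omx y (Y y) *m omx y (X y)).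
Proof.
move=> Wy sX sY; apply/matrixP => a k; rewrite !mxE (dform_fields oW Wy (smooth_om a k) sX sY).
have e (V : CV) (V' : E -> CV) : cder y V (fun z => omx z (V' z) a k) =
    cder y V (fun z => app (om F a k z) (V' z)).
  by congr cder; apply/funext => z; rewrite mxE.
have es : \sum_l wedge (om F a l y) (om F l k y) (X y) (Y y) =
    \sum_l omx y (X y) a l * omx y (Y y) l k - \sum_l omx y (Y y) a l * omx y (X y) l k.
  by rewrite -sumrB; apply: eq_bigr => l _; rewrite /wedge !mxE.
by rewrite !e es.
Qed.

Lemma hprod_cov_Lfc zt y : W y -> S y ->
  hprod (g y) (cov g y (cconj (Lf zt y)) Zm) (cov g y (cconj (Lf zt y)) Zm) =
  omx y (cconj (Lf zt y)) *m hmx F y *m ctr (omx y (cconj (Lf zt y)))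
  + xi2 y *: (hmx F y *m ctr zt *m (zt *m hmx F y)).
Proof.
move=> Wy Sy; rewrite {1}(cov_Lfc _ Wy Sy) hprodDl !hprodMl.
rewrite -[in X in X + _](hprod_ctr kg _ _ (WD Wy)) (cov_Lfc_Zm _ Wy Sy) ctrM (hmx_herm Wy Sy).
rewrite mulmxA; congr (_ + _).
rewrite (cov_Lfc _ Wy Sy) hprodDr !hprodMr (xi_orth Wy Sy) mul0mx add0r hprod_xi.
rewrite ctrZ ctrM ctrK (hmx_herm Wy Sy) imC_conj -scalemxAl mul_scalar_mx -!scalemxAr !scalerA.
by congr (_ *: _); rewrite mulrCA mulrN imC2 opprK mulr1.
Qed.

(** For this direction only the pairings of the derivative with the frame and with xi are known;
    codimension one, through [normal_line], recovers the derivative from them. *)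
Lemma hprod_cov_Lf zt y : m = n.+1 -> W y -> S y ->
  let t := hmx F y *m map_mx conjc (tormx y) *m zt^T in
  hprod (g y) (cov g y (Lf zt y) Zm) (cov g y (Lf zt y) Zm) =
  omx y (Lf zt y) *m hmx F y *m ctr (omx y (Lf zt y)) + (xi2 y)^-1 *: (t *m ctr t).
Proof.
move=> mn Wy Sy t; set A := cov g y (Lf zt y) Zm; set o := omx y _.
have AZ : hprod (g y) A (Zm y) = o *m hmx F y by exact: cov_Lf_Zm.
have Axi : hprod (g y) A (xi y) = - t by exact: cov_Lf_Zm_xi.
have e q (B : 'M[C]_(q, m)) :
    hprod (g y) (A - o *m Zm y) B = hprod (g y) A B - o *m hprod (g y) (Zm y) B.
  by rewrite hprodBl hprodMl.
have := @normal_line _ y (A - o *m Zm y) mn Wy Sy.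
rewrite !e AZ Axi (orth_xi Wy Sy) -(hmxE Wy Sy) subrr mulmx0 subr0.
move=> /(_ erefl) /eqP; rewrite subr_eq => /eqP AE.
rewrite {2}AE hprodDr !hprodMr AZ Axi addrC; congr (_ + _).
have xr : conjc (xi2 y) = xi2 y.
  by have := gtr0_real (xi2_gt0 Wy Sy) => /complex_realP[r ->]; rewrite conjc_real.
by rewrite ctrZ conjc_inv xr -scalemxAr ctrN mulmxN mulNmx opprK.
Qed.

Lemma smooth_hprod p q (A : E -> 'M[C]_(p, m)) (B : E -> 'M[C]_(q, m)) :
  msmooth W A -> msmooth W B -> msmooth W (fun z => hprod (g z) (A z) (B z)).
Proof.
move=> sA sB; have sg := msmooth_sub WD (smooth_g kg).
exact: (msmoothM oW (msmoothM oW sA sg) (msmooth_ctr oW sB)).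
Qed.

(** Differentiate <nabla_Y Z, Z> = omega(Y) h along X. Since Y = conj X, the other term is the Gram
    matrix of nabla_Y Z, whose excess over its tangential part is the square of the second
    fundamental form. *)
Lemma cov_cov_Zm (X Y : E -> CV) y : W y -> S y -> vsmooth W X -> vsmooth W Y ->
  tangent S y (X y) -> cconj (X y) = Y y ->
  (forall z, W z -> S z -> hprod (g z) (cov g z (Y z) Zm) (Zm z) = omx z (Y z) *m hmx F z) ->
  hprod (g y) (cov g y (X y) (fun z => cov g z (Y z) Zm)) (Zm y) =
  mder y (X y) (fun z => omx z (Y z)) *m hmx F y + omx y (Y y) *m omx y (X y) *m hmx F y
  + (omx y (Y y) *m hmx F y *m ctr (omx y (Y y))
     - hprod (g y) (cov g y (Y y) Zm) (cov g y (Y y) Zm)).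
Proof.
move=> Wy Sy sX sY tX XY hY.
have sc := smooth_cov oD kg oW WD sY smooth_Zm.
have := mder_hprod oD kg (X y) oW Wy WD sc smooth_Zm.
have so := smooth_omx sY.
rewrite (tangent_mder_eq oW Wy (smooth_hprod sc smooth_Zm) (msmoothM oW so smooth_hmx) tX hY).
rewrite (mderM _ oW Wy so smooth_hmx) (mder_hmx Wy Sy tX) XY => /esym/eqP.
rewrite eq_sym -subr_eq => /eqP <-.
by rewrite mulmxDr !mulmxA !addrA.
Qed.

(** The three corrections are the squares of II(Zbar, .) and II(Z, .) and the contribution of the
    Reeb component of [Z, Zbar] through [cov_tangent_Zm]. *)
Lemma gauss_matrix zt y : m = n.+1 -> W y -> S y ->
  let t := hmx F y *m map_mx conjc (tormx y) *m zt^T in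
  let X := Lf zt y in
  hprod (g y) (Zm y *m chern_curv g y X (cconj X)) (Zm y) =
  tw_curv_form y X (cconj X) *m hmx F y
  - xi2 y *: (hmx F y *m ctr zt *m (zt *m hmx F y)) + (xi2 y)^-1 *: (t *m ctr t)
  - (xi2 y * (zt *m hmx F y *m ctr zt) 0 0) *: hmx F y.
Proof.
move=> mn Wy Sy t X.
have sX := smooth_Lf zt; have sY := smooth_Lfc zt.
rewrite -(cov_curvature oD kg oW Wy WD sX sY smooth_Zm) 2!hprodBl.
have tX := tangent_Lf Wy Sy zt; have tY := tangent_Lfc Wy Sy zt.
rewrite (cov_cov_Zm Wy Sy sX sY tX erefl); last by move=> z Wz Sz; exact: cov_Lfc_Zm.
rewrite (cov_cov_Zm Wy Sy sY sX tY (cconjK _)); last by move=> z Wz Sz; exact: cov_Lf_Zm.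
rewrite (hprod_cov_Lfc _ Wy Sy) (hprod_cov_Lf _ mn Wy Sy) -/t.
have [e1 e2 e3] := bracket_decomposition Wy Sy sX sY (@adapted_Lf zt) (@adapted_Lfc zt).
have tB : tangent S y (bracket (Lf zt) (fun z => cconj (Lf zt z)) y).
  by apply: (tangent_bracket oW) => // z Wz Sz; [exact: tangent_Lf|exact: tangent_Lfc].
rewrite (cov_tangent_Zm Wy Sy tB) e2 (theta_kform Sy tX tY) kform_holo.
rewrite hprodMl hprodMr -(hmxE Wy Sy) [zt *m (_ *m ctr zt)]mulmxA.
rewrite /X (tw_curv_fields Wy sX sY).
rewrite !mulmxBl.
have -> (c d : C) : imC * c * - (imC * d) = c * d.
  by rewrite mulrN mulrACA imC2 mulN1r opprK.
move: (mder _ _ _ *m hmx F y) (mder _ _ _ *m hmx F y) (omx y (bracket _ _ _) *m hmx F y).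
move: (omx y _ *m omx y _ *m hmx F y) (omx y _ *m omx y _ *m hmx F y).
move: (omx y _ *m hmx F y *m _) (omx y _ *m hmx F y *m _).
move: (xi2 y *: _) (_^-1 *: _) (_ *: hmx F y) => a b c d e f h k l o.
by apply/matrixP => i j; rewrite !mxE; ring.
Qed.

End PseudohermitianFrame.

(** * Torsion, curvature and second fundamental form *)

Section PseudohermitianCurvature.
Context {R : realType} {m n : nat}.
Local Notation E := (cspace R m).
Local Notation C := R[i].
Local Notation CV := (cvec R m).
Variables (g : E -> 'M[C]_m) (D S : set E) (theta : E -> CV) (U W : set E) (F : frame R m n).
Hypotheses (oD : open D) (kg : kahler_metric D g).
Hypothesis theta_real : forall y, S y -> cconj (theta y) = theta y.
Hypothesis theta_kernel : forall y, S y -> forall V, cconj V = V -> tangent S y V ->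
  (app (theta y) V = 0 <-> tangent S y (holo V.1)).
Hypothesis theta_kform : forall y, S y -> forall V V', tangent S y V -> tangent S y V' ->
  dform theta y V V' = kform (g y) V V'.
Hypotheses (oW : open W) (WD : W `<=` D) (WU : W `<=` U) (sth : vsmooth W theta).
Hypothesis twF : tw_frame S theta U F.
Implicit Types (y : E) (V : CV) (zt : 'rV[C]_n) (a : 'rV[C]_m).

(* [conj (A_(alpha beta)) = sum_gamma h_(gamma beta) A^gamma_(alphabar)], so this is
   [A_(alpha beta) zeta^alpha zeta^beta]. *)
Definition torsion_quad y zt : C :=
  (zt *m (hmx F y *m map_mx conjc (tormx F y) *m zt^T)) 0 0.

Lemma mx11M (A B : 'M[C]_1) : (A *m B) 0 0 = A 0 0 * B 0 0.
Proof. by rewrite mxE big_ord1. Qed.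

Lemma mx11D (A B : 'M[C]_1) : (A + B) 0 0 = A 0 0 + B 0 0.
Proof. by rewrite mxE. Qed.

Lemma mx11N (A : 'M[C]_1) : (- A) 0 0 = - A 0 0.
Proof. by rewrite mxE. Qed.

Lemma mx11Z c (A : 'M[C]_1) : (c *: A) 0 0 = c * A 0 0.
Proof. by rewrite mxE. Qed.

Lemma sesquilinearE (A : 'M[C]_n) (v w : 'rV[C]_n) : (v *m A *m ctr w) 0 0 =
  \sum_a \sum_b A a b * v 0 a * conjc (w 0 b).
Proof.
rewrite mxE exchange_big; apply: eq_bigr => b _.
rewrite !mxE mulr_suml; apply: eq_bigr => a _; ring.
Qed.

Section AtPoint.
Variables (y : E) (a : 'rV[C]_m).
Hypotheses (Wy : W y) (Sy : S y) (ta : tangent S y (holo a)).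
Let zt := et F y (holo a).

Lemma frame_coord : a = zt *m Zm F y.
Proof. exact: (holo_frame WU twF Wy Sy ta). Qed.

Lemma holo_Lf : holo a = Lf F zt y.
Proof. by rewrite /Lf -frame_coord. Qed.

Lemma zeta_et b : zeta F y a b = zt 0 b.
Proof. by rewrite mxE. Qed.

Lemma levi_norm : (zt *m hmx F y *m ctr zt) 0 0 = hprod (g y) a a 0 0.
Proof. by rewrite {1 2}frame_coord hprodMl hprodMr mulmxA -(hmxE theta_kform WU twF Wy Sy). Qed.

Lemma levi_sqnormE : levi_sqnorm F y a = hprod (g y) a a 0 0.
Proof.
rewrite -levi_norm sesquilinearE; apply: eq_bigr => b _; apply: eq_bigr => c _.
by rewrite !zeta_et.
Qed.

Lemma AsecE : Asec F y a = imC * torsion_quad y zt / hprod (g y) a a 0 0.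
Proof.
rewrite /Asec levi_sqnormE; congr (_ * _ / _).
rewrite /torsion_quad mxE exchange_big; apply: eq_bigr => b _.
rewrite [X in _ = _ * X]mxE mulr_sumr; apply: eq_bigr => c _.
rewrite !zeta_et [zt^T _ _]mxE mulrC; congr (_ * (_ * _)).
rewrite /torsion_low conjc_sum mxE; apply: eq_bigr => k _.
have := hmx_herm kg theta_kform WD WU twF Wy Sy => /matrixP /(_ b k).
by rewrite conjcM !mxE => ->.
Qed.

(** Expresses the torsion without connection forms, which makes it computable on an explicit
    hypersurface in an arbitrary frame. *)
Lemma torsion_cov : hprod (g y) a (cov g y (cconj (holo a)) (xi F)) 0 0 = torsion_quad y zt.
Proof.
rewrite {1}frame_coord holo_Lf.
rewrite (cov_Lfc_xi kg theta_real theta_kernel oW WD WU sth twF zt Wy Sy) hprodMr hprodMl.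
rewrite -(hmxE theta_kform WU twF Wy Sy) ctrM /torsion_quad.
have -> : ctr (tormx F y)^T = map_mx conjc (tormx F y) by apply/matrixP => i j; rewrite !mxE.
have -> : ctr (map_mx conjc zt) = zt^T by apply/matrixP => i j; rewrite !mxE conjcK.
by rewrite !mulmxA.
Qed.

Lemma dform_suml (p : E -> CV) (f : 'I_n -> C) (V : 'I_n -> CV) V' : vsmooth W p ->
  dform p y (\sum_i f i *: V i) V' = \sum_i f i * dform p y (V i) V'.
Proof.
move=> sp; rewrite /dform.
have -> : cder y (\sum_i f i *: V i) (fun z => app (p z) V') =
    \sum_i f i * cder y (V i) (fun z => app (p z) V').
  elim: (index_enum _) => [|i r IH]; first by rewrite !big_nil cder0.
  by rewrite !big_cons cderL IH.
rewrite (_ : (fun z => app (p z) (\sum_i _)) = fun z => \sum_i f i * app (p z) (V i)); last first.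
  by apply/funext => z; rewrite app_sum.
have sa i : csmooth W (fun z => app (p z) (V i)).
  exact: (csmooth_app oW sp (vsmooth_cst W (V i))).
rewrite (cder_sum _ _ _ oW Wy) => [|i]; last first.
  exact: (csmoothM oW (csmooth_cst W (f i)) (sa i)).
rewrite -sumrB; apply: eq_bigr => i _.
by rewrite (cderZ _ _ Wy (sa i)) mulrBr.
Qed.

Lemma dform_sumr (p : E -> CV) (f : 'I_n -> C) (V : 'I_n -> CV) V' : vsmooth W p ->
  dform p y V' (\sum_i f i *: V i) = \sum_i f i * dform p y V' (V i).
Proof.
move=> sp; rewrite dform_sym dform_suml // -sumrN; apply: eq_bigr => i _.
by rewrite -mulrN -dform_sym.
Qed.

Lemma cconj_sum (f : 'I_n -> C) (V : 'I_n -> CV) :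
  cconj (\sum_i f i *: V i) = \sum_i conjc (f i) *: cconj (V i).
Proof.
elim: (index_enum _) => [|i r IH].
  by rewrite !big_nil; congr pair; apply/rowP => j; rewrite !mxE conjc0.
by rewrite !big_cons cconjL IH.
Qed.

Lemma wedge_sum (p q : CV) (f h : 'I_n -> C) (V V' : 'I_n -> CV) :
  wedge p q (\sum_i f i *: V i) (\sum_j h j *: V' j) =
  \sum_i \sum_j f i * (h j * wedge p q (V i) (V' j)).
Proof.
have e (P Q P' Q' : 'I_n -> C) :
    (\sum_i f i * P i) * (\sum_j h j * Q' j) - (\sum_j h j * P' j) * (\sum_i f i * Q i) =
    \sum_i \sum_j f i * (h j * (P i * Q' j - P' j * Q i)).
  rewrite [X in _ - X]mulrC !mulr_suml -sumrB; apply: eq_bigr => i _.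
  by rewrite !mulr_sumr -sumrB; apply: eq_bigr => j _; ring.
by rewrite /wedge !app_sum e.
Qed.

(** The curvature coefficients are values on frame vectors; bilinearity turns their contraction with
    v into one value of the curvature form. *)
Lemma tw_curv_sum (v : 'rV[C]_n) al ka :
  \sum_ga \sum_si tw_curvature F y al ka ga si * v 0 ga * conjc (v 0 si) =
  tw_curv_form F y (Lf F v y) (cconj (Lf F v y)) al ka.
Proof.
have so i j := smooth_om WU twF i j.
rewrite mxE Lf_sum cconj_sum dform_suml //.
have -> : \sum_l wedge (om F al l y) (om F l ka y) (\sum_i v 0 i *: ZV F i y)
      (\sum_i conjc (v 0 i) *: cconj (ZV F i y)) =
    \sum_ga \sum_si v 0 ga * (conjc (v 0 si) * \sum_l wedge (om F al l y) (om F l ka y)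
      (ZV F ga y) (cconj (ZV F si y))).
  under eq_bigr do rewrite wedge_sum.
  rewrite exchange_big; apply: eq_bigr => i _; rewrite exchange_big; apply: eq_bigr => j _.
  by rewrite !mulr_sumr.
rewrite -sumrB; apply: eq_bigr => ga _.
rewrite dform_sumr // mulr_sumr -sumrB; apply: eq_bigr => si _.
by rewrite /tw_curvature; move: (dform _ _ _ _) (\sum_l _) => c d; ring.
Qed.

Lemma KsecE : Ksec F y a = 2^-1 *
  (zt *m tw_curv_form F y (holo a) (cconj (holo a)) *m hmx F y *m ctr zt) 0 0
  / hprod (g y) a a 0 0 ^+ 2.
Proof.
rewrite /Ksec levi_sqnormE; congr (_ * _ / _).
rewrite -(mulmxA zt) sesquilinearE; apply: eq_bigr => al _; apply: eq_bigr => be _.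
rewrite mxE !mulr_suml holo_Lf.
rewrite (eq_bigr _ (fun ka _ => congr1 (fun u => u * _ * _ * _) (esym (tw_curv_sum zt al ka)))).
transitivity (\sum_ka \sum_ga \sum_si tw_curvature F y al ka ga si * zt 0 ga * conjc (zt 0 si)
  * hmx F y ka be * zt 0 al * conjc (zt 0 be)); last first.
  apply: eq_bigr => ka _; rewrite !mulr_suml; apply: eq_bigr => ga _.
  by rewrite !mulr_suml.
rewrite [RHS]exchange_big; apply: eq_bigr => ga _.
rewrite [RHS]exchange_big; apply: eq_bigr => si _.
rewrite /tw_curvature_low !mulr_suml; apply: eq_bigr => ka _.
by rewrite !zeta_et; move: (tw_curvature _ _ _ _ _ _) (hmx _ _ _ _) => c d; ring.
Qed.

Lemma xi2_real : conjc (xi2 g F y) = xi2 g F y.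
Proof.
have := gtr0_real (xi2_gt0 kg WD WU twF Wy Sy) => /complex_realP[r ->].
exact: conjc_real.
Qed.

Lemma norm_real : conjc (hprod (g y) a a 0 0) = hprod (g y) a a 0 0.
Proof.
have := hprod_ctr kg a a (WD Wy) => /(congr1 (fun A : 'M[C]_1 => A 0 0)).
by rewrite !mxE.
Qed.

(** Paired with [zt] on both sides, the square of II(Zbar, .) and the Reeb term of [gauss_matrix]
    become the same quantity |xi|^2 |Z|^4, hence the factor 2. *)
Lemma Ktilde_gauss : m = n.+1 ->
  hprod (g y) (a *m chern_curv g y (holo a) (cconj (holo a))) a 0 0 =
  (zt *m tw_curv_form F y (holo a) (cconj (holo a)) *m hmx F y *m ctr zt) 0 0
  - 2 * xi2 g F y * hprod (g y) a a 0 0 ^+ 2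
  + (xi2 g F y)^-1 * (torsion_quad y zt * conjc (torsion_quad y zt)).
Proof.
move=> mn.
have := gauss_matrix oD kg theta_real theta_kernel theta_kform oW WD WU sth twF zt mn Wy Sy.
pose f (A : 'M[C]_n) := (zt *m A *m ctr zt) 0 0.
have fD A B : f (A + B) = f A + f B by rewrite /f mulmxDr mulmxDl mxE.
have fB A B : f (A - B) = f A - f B by rewrite fD /f mulmxN mulNmx [X in _ + X]mxE.
have fZ c A : f (c *: A) = c * f A by rewrite /f -scalemxAr -scalemxAl mxE.
have fM (u : 'cV[C]_n) (v : 'rV[C]_n) : f (u *m v) = (zt *m u) 0 0 * (v *m ctr zt) 0 0.
  by rewrite -mx11M /f !mulmxA.
move/(congr1 f); rewrite {1}/f -hprodMl -hprodMr mulmxA -frame_coord -holo_Lf => ->.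
rewrite fB fD fB !fZ !fM /f levi_norm [zt *m (_ *m ctr zt)]mulmxA levi_norm.
set t := _ *m zt^T.
have tE : (zt *m t) 0 0 = torsion_quad y zt by [].
have -> : (ctr t *m ctr zt) 0 0 = conjc ((zt *m t) 0 0) by rewrite -ctrM !mxE.
rewrite tE [zt *m (_ *m hmx F y)]mulmxA.
move: ((_ *m _ *m _ *m ctr zt) 0 0) (torsion_quad y zt) (hprod _ _ _ 0 0) (xi2 g F y) => q t' N x.
ring.
Qed.

Lemma Ksec_gauss : m = n.+1 -> a != 0 -> Ksec F y a =
  Ktilde g y a / 2 + xi2 g F y - `|Asec F y a| ^+ 2 / (2 * xi2 g F y).
Proof.
move=> mn a0.
have N0 := lt0r_neq0 (hprod_gt0 kg (WD Wy) a0).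
have x0 := lt0r_neq0 (xi2_gt0 kg WD WU twF Wy Sy).
rewrite KsecE (KtildeE oD kg a (WD Wy)) (Ktilde_gauss mn) sqr_normc AsecE.
rewrite !conjcM conjc_inv norm_real imC_conj.
have i2 := @imC2 R.
move: (torsion_quad y zt) (conjc _) (hprod _ _ _ 0 0) (xi2 g F y) N0 x0 => t t' N x N0 x0.
rewrite (_ : imC * t / N * (- imC * t' / N) = - (imC * imC) * (t * t') / N ^+ 2); last first.
  by field.
rewrite i2 opprK mul1r; move: ((_ *m _ *m _ *m _) 0 0) => q; field.
by rewrite x0 N0.
Qed.

End AtPoint.

(** * Second fundamental form and mean curvature *)

Section SecondFundamentalForm.
Variables (y : E).
Hypotheses (Wy : W y) (Sy : S y).

Lemma ZV_Lf al : ZV F al = Lf F (delta_mx 0 al).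
Proof. by apply/funext => z; rewrite /ZV /Lf -rowE rowK. Qed.

Lemma tw_nabla_Lf v V : tangent S y V ->
  tw_nabla theta F y V (Lf F v) = holo (v *m omx F y V *m Zm F y).
Proof.
move=> tV; have sL := smooth_Lf oW WU twF v.
have cst (p : E -> CV) (c : C) : vsmooth W p ->
    (forall z, W z -> S z -> app (p z) (Lf F v z) = c) ->
    cder y V (fun z => app (p z) (Lf F v z)) = 0.
  move=> sp pc; rewrite (tangent_cder_eq oW Wy (csmooth_app oW sp sL) (csmooth_cst W c) tV pc).
  exact: cder_cst.
rewrite /tw_nabla (cst theta 0) //; last by move=> z Wz Sz; exact: (theta_Lf theta_kernel WU twF).
rewrite scale0r addr0 [X in _ + X]big1 ?addr0 => [|be _]; last first.
  rewrite (cst (fun z => cconj (eta F be z)) 0) ?add0r.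
  - rewrite big1 ?scale0r // => al _.
    have := et_Lfc WU twF Wy Sy v => /rowP /(_ al); rewrite !mxE => e.
    by rewrite app_conj e conjc0 mul0r.
  - exact: (vsmooth_conj oW (smooth_eta WU twF be)).
  - move=> z Wz Sz; have := et_Lfc WU twF Wz Sz v => /rowP /(_ be); rewrite !mxE => e.
    by rewrite app_conj e conjc0.
have eE al z : W z -> S z -> app (eta F al z) (Lf F v z) = v 0 al.
  by move=> Wz Sz; have := et_Lf WU twF Wz Sz v => /rowP /(_ al); rewrite mxE.
rewrite -[RHS]/(Lf F (v *m omx F y V) y) [RHS]Lf_sum; apply: eq_bigr => be _; congr (_ *: _).
rewrite (cst (eta F be) (v 0 be)) ?add0r; last 2 first.
- exact: (smooth_eta WU twF be).
- exact: eE.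
by rewrite mxE; apply: eq_bigr => al _; rewrite eE // mxE.
Qed.

(** In a unitary frame each of the n summands is already i xi by [cov_Lfc], so their average is
    too. *)
Lemma mean_curvatureE : hmx F y = 1%:M -> (0 < n)%N ->
  mean_curvature g theta F y = holo (imC *: xi F y).
Proof.
move=> h1 n0.
have e al : second_ff g theta F y (cconj (ZV F al y)) (ZV F al) = holo (imC *: xi F y).
  rewrite /second_ff ZV_Lf.
  have tL := tangent_Lfc WU twF Wy Sy (delta_mx 0 al).
  rewrite tw_nabla_Lf // [chern _ _ _ _]surjective_pairing chern1 (chern_holo2 g).
  rewrite -(cov_Zm_row _ oW WU twF) //.
  rewrite (cov_Lfc kg theta_real theta_kernel theta_kform oW WD WU sth twF) //.
  rewrite mulmxDr !mulmxA.
  have -> (u v : 'rV[C]_m) : (u + v, 0) - holo u = holo v :> CV.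
    by congr pair; [rewrite addrAC subrr add0r|rewrite subrr].
  rewrite h1 mul1mx -scalemxAr -scalemxAl; congr (holo (_ *: _)).
  rewrite mul_mx11 -rowE !mxE eqxx /= conjc_nat.
  by rewrite eqxx scale1r.
rewrite /mean_curvature (eq_bigr _ (fun al _ => e al)) sumr_const card_ord -[holo _ *+ n]scaler_nat scalerA.
by rewrite mulVf ?scale1r // pnatr_eq0 -lt0n.
Qed.

Lemma fst_sum (I : Type) (r : seq I) (f : I -> C) (V : I -> CV) :
  (\sum_(i <- r) f i *: V i).1 = \sum_(i <- r) f i *: (V i).1.
Proof. by elim: r => [|i r IH]; rewrite ?big_nil // !big_cons -IH. Qed.

Lemma frame_orth (f : 'I_n -> C) : hprod (g y) (\sum_i f i *: Z F i y) (xi F y) = 0.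
Proof.
have -> : \sum_i f i *: Z F i y = (\row_i f i) *m Zm F y.
  by rewrite mulmx_sum_row; apply: eq_bigr => i _; rewrite rowK mxE.
by rewrite hprodMl (orth_xi kg theta_kform WD WU twF) // mulmx0.
Qed.

(** As theta(X) = 0 along M, the derivative has no Reeb component, and its parts are combinations of
    frame vectors. Against a normal vector, II therefore reduces to the Chern derivative. *)
Lemma tw_nabla_orth (X : E -> CV) V : vsmooth W X -> tangent S y V ->
  (forall z, W z -> S z -> app (theta z) (X z) = 0) ->
  hprod (g y) (tw_nabla theta F y V X).1 (xi F y) = 0 /\
  hprod (g y) (cconj (tw_nabla theta F y V X)).1 (xi F y) = 0.
Proof.
move=> sX tV X0; rewrite /tw_nabla.
rewrite (tangent_cder_eq oW Wy (csmooth_app oW sth sX) (csmooth_cst W 0) tV X0) cder_cst.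
rewrite scale0r addr0.
have z1 (h : 'I_n -> C) : (\sum_i h i *: cconj (ZV F i y)).1 = 0.
  by rewrite fst_sum big1 // => i _; rewrite cconj_holo1 scaler0.
have z2 (h : 'I_n -> C) : (\sum_i h i *: ZV F i y).1 = \sum_i h i *: Z F i y.
  by rewrite fst_sum.
split.
  rewrite -[(_ + _).1]/(_.1 + _.1) z1 addr0 z2; exact: frame_orth.
rewrite cconjD !cconj_sum -[(_ + _).1]/(_.1 + _.1) z1 add0r.
rewrite (eq_bigr _ (fun i _ => congr1 (fun V => _ *: V) (cconjK (ZV F i y)))) z2.
exact: frame_orth.
Qed.

Lemma chern_conj (X : E -> CV) V : vsmooth W X ->
  (cconj (chern g y V X)).1 = cov g y (cconj V) (fun z => (cconj (X z)).1).
Proof.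
Transparent chern.
move=> [_ sX2].
rewrite -[LHS]/(map_mx conjc ((cderv y V X).2 + _)) map_mxD cderv2 -[RHS]chern1.
rewrite -[RHS]/((cderv y (cconj V) (fun z => cconj (X z))).1 + _) cderv1; congr (_ + _).
  apply/rowP => j; rewrite !mxE.
  transitivity (cder y (cconj V) (fun z => conjc ((X z).2 0 j))).
    by rewrite (cder_conj _ Wy (sX2 j)) cconjK.
  by congr cder; apply/funext => z; rewrite mxE.
rewrite raddf_sum; apply: eq_bigr => j _ /=.
rewrite map_mxZ map_mxM mxE; congr (_ *: (_ *m _)).
by rewrite -map_mx_comp; apply/matrixP => k l; rewrite mxE; exact: conjcK.
Qed.
Opaque chern.

Section RealField.
Variable Y : E -> 'rV[C]_m.
Hypotheses (sY : rowsmooth W Y) (tY : forall z, W z -> S z -> tangent S z (holo (Y z))).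
Let V z : CV := holo (Y z) + cconj (holo (Y z)).
Let zt := et F y (holo (Y y)).

(** The derivative is moved from Y to xi. Along V = Y + Ybar, the direction Y gives the Levi term
    and the direction Ybar the torsion. *)
Lemma cov_realfield_xi : hprod (g y) (cov g y (V y) Y) (xi F y) 0 0 =
  imC * xi2 g F y * hprod (g y) (Y y) (Y y) 0 0 - torsion_quad y zt.
Proof.
have sY' : msmooth W Y by apply/rowsmoothP.
have tYy := tY Wy Sy.
have Vreal : cconj (V y) = V y by rewrite /V cconjD cconjK addrC.
have tV : tangent S y (V y) by apply: tangentD => //; exact: tangent_conj.
have sx := smooth_xi WU twF.
have := mder_hprod oD kg (V y) oW Wy WD sY' sx.
rewrite (tangent_mder_eq oW Wy (smooth_hprod kg oW WD sY' sx) (msmooth_cst W 0) tV); last first.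
  move=> z Wz Sz; rewrite (frame_coord Wz Sz (tY Wz Sz)) hprodMl.
  by rewrite (orth_xi kg theta_kform WD WU twF Wz Sz) mulmx0.
rewrite mder_cst Vreal => /esym/eqP; rewrite addr_eq0 => /eqP ->.
have -> : V y = 1 *: Lf F zt y + cconj (holo (Y y)) by rewrite scale1r -(holo_Lf Wy Sy tYy).
rewrite covL scale1r hprodDr mx11N mx11D (torsion_cov Wy Sy tYy).
rewrite -[hprod _ _ (cov _ _ (Lf _ _ _) _)](hprod_ctr kg _ _ (WD Wy)).
rewrite {1}(frame_coord Wy Sy tYy) hprodMr.
rewrite (cov_Lf_xi_Zm oD kg theta_real theta_kernel theta_kform oW WD WU sth twF zt Wy Sy).
rewrite -scalemxAl; have -> (A : 'M[C]_1) : ctr A 0 0 = conjc (A 0 0) by rewrite !mxE.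
rewrite mx11Z (levi_norm Wy Sy tYy) !conjcM imC_conj (xi2_real Wy Sy) (norm_real (Y y) Wy).
by move: (torsion_quad y zt) (xi2 g F y) (hprod _ _ _ 0 0) => t x N; ring.
Qed.

(** The value is Re w / |mu|, and w = |Y|^2 (|H|^2 + A(Y)) wherever Y is nonzero. The two conjugate
    terms come from pairing the (1,0)- and (0,1)-parts of II with the real vector mu. *)
Lemma normalized_second_ffE : let w := xi2 g F y * hprod (g y) (Y y) (Y y) 0 0
    + imC * torsion_quad y zt in
  normalized_second_ff g theta F (holo (imC *: xi F y)) y (V y) V
  = (w + conjc w) / 2 / sqrtC (xi2 g F y / 2).
Proof.
move=> w.
have tYy := tY Wy Sy.
have Vreal z : cconj (V z) = V z by rewrite /V cconjD cconjK addrC.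
have V1 z : (V z).1 = Y z by rewrite -[LHS]/(_.1 + _.1) cconj_holo1 addr0.
have tV : tangent S y (V y) by apply: tangentD => //; exact: tangent_conj.
have sV : vsmooth W V.
  by apply: vsmoothD => //; [|apply: vsmooth_conj => //]; exact: vsmooth_holo.
have V0 z : W z -> S z -> app (theta z) (V z) = 0.
  move=> Wz Sz; rewrite appD (theta_conj theta_real Sz).
  by rewrite (theta_holo theta_kernel Sz (tY Wz Sz)) conjc0 addr0.
have [n1 n2] := tw_nabla_orth sV tV V0.
have half : conjc (2^-1 : C) = 2^-1 by rewrite conjc_inv (conjc_nat R 2).
rewrite /normalized_second_ff; set H := holo _; set mu := 2^-1 *: _.
have muE : mu = 2^-1 *: H + cconj (2^-1 *: H) by rewrite /mu scalerDr cconjZ half.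
have mur : cconj mu = mu by rewrite muE cconjD cconjK addrC.
have mu1 : mu.1 = (2^-1 * imC) *: xi F y.
  by rewrite /mu -[LHS]/(2^-1 *: (H.1 + (cconj H).1)) cconj_holo1 addr0 scalerA.
(* The (1,0)- and (0,1)-parts of mu both contribute, each with |xi|^2 / 4. *)
have -> : sqnorm (g y) mu = xi2 g F y / 2.
  rewrite /sqnorm mur metricE mur mu1 hprodZl hprodZr scalerA hprod_xi.
  rewrite conjcM half imC_conj !mxE eqxx mulr1n.
  have i2 := @imC2 R.
  rewrite (_ : 2^-1 * imC * (2^-1 * - imC) = - (imC * imC) / 4); last by field.
  by rewrite i2; move: (xi2 _ _ _) => x; field.
congr (_ / _).
rewrite metricE mur mu1 hprodZr hprodZl.
have -> : second_ff g theta F y (V y) V = chern g y (V y) V - tw_nabla theta F y (V y) V by [].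
have cconjB (A B : CV) : cconj (A - B) = cconj A - cconj B.
  by rewrite -scaleN1r addrC cconjL conjcN conjc1 scaleN1r addrC.
have sub1 (A B : CV) : (A - B).1 = A.1 - B.1 by [].
rewrite cconjB 2!sub1 chern1 (chern_conj _ sV) Vreal.
have -> : (fun z => (cconj (V z)).1) = Y by apply/funext => z; rewrite Vreal V1.
have -> : (fun z => (V z).1) = Y by apply/funext => z; rewrite V1.
rewrite -[hprod _ (xi F y) _](hprod_ctr kg _ _ (WD Wy)) 2!hprodBl n1 n2 !subr0.
have -> (A : 'M[C]_1) c : (c *: ctr A) 0 0 = c * conjc (A 0 0) by rewrite !mxE.
rewrite mx11Z cov_realfield_xi conjcM half imC_conj.
have -> : imC * xi2 g F y * hprod (g y) (Y y) (Y y) 0 0 - torsion_quad y zt = imC * w.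
  rewrite /w; have i2 := @imC2 R.
  by move: (torsion_quad y zt) (xi2 _ _ _) (hprod _ _ _ 0 0) => t x N; rewrite mulrDr !mulrA i2; ring.
rewrite conjcM imC_conj; move: (conjc w) (@imC2 R) => w' i2; clearbody w.
rewrite (_ : _ + _ = - (imC * imC) * (w + w') / 2); last by field.
by rewrite i2 opprK mul1r.
Qed.

End RealField.

End SecondFundamentalForm.

End PseudohermitianCurvature.

(** * C-convexity, the torsion bound and the curvature bound *)

Lemma half_plane (R : realType) (P q : R[i]) : `|q| <= P -> 0 <= (P + q) + conjc (P + q).
Proof.
move=> qP.
have P0 : 0 <= P by exact: le_trans qP.
have Pr : conjc P = P by have /complex_realP[r ->] := ger0_real P0; exact: conjc_real.
rewrite conjcD Pr addrACA addcJ -mulr2n -[P *+ 2]mulr_natl -mulrDr mulr_ge0 ?ler0n //.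
have := le_trans (normc_ge_Re q) qP; have /complex_realP[r ->] := ger0_real P0.
rewrite lecR -rmorphD ler0c => h.
rewrite -[complex.Re q]opprK subr_ge0.
by apply: le_trans h; rewrite -normrN ler_norm.
Qed.

(** For q nonzero, l is a square root of - |q| / q. The target - |q| makes |H|^2 + Re A as small as
    a rotation of Z can. *)
Lemma unit_rotation (R : realType) (q : R[i]) : exists2 l : R[i], l * conjc l = 1 & l ^+ 2 * q = - `|q|.
Proof.
have [->|q0] := eqVneq q 0; first by exists 1; rewrite ?conjc1 ?mulr1 // normr0 mulr0 oppr0.
pose l := sqrtC (- (`|q| / q)).
have l2 : l ^+ 2 = - (`|q| / q) by rewrite sqrtCK.
exists l; last by rewrite l2 mulNr divfK.
have nq : `|q| != 0 by rewrite normr_eq0.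
rewrite -sqr_normc -normrX l2 normrN normrM normr_id normfV mulfV //.
Qed.

Section ReebUniqueness.
Context {R : realType} {m : nat}.
Local Notation E := (cspace R m).
Local Notation C := R[i].
Local Notation CV := (cvec R m).
Variables (g : E -> 'M[C]_m) (D S : set E) (theta : E -> CV) (y : E).
Hypotheses (kg : kahler_metric D g) (Dy : D y).
Hypothesis theta_kernel : forall V, cconj V = V -> tangent S y V ->
  (app (theta y) V = 0 <-> tangent S y (holo V.1)).
Hypothesis theta_kform : forall V V', tangent S y V -> tangent S y V' ->
  dform theta y V V' = kform (g y) V V'.

(** The difference d is real and in the kernel of theta, so its (1,0)-part is tangent; pairing d
    with the conjugate of that part under dtheta, the pullback of omega, shows that its norm is
    zero. Hence xi does not depend on the frame. *)
Lemma reeb_unique (T T' : CV) :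
  [/\ cconj T = T, tangent S y T, app (theta y) T = 1
    & forall V, tangent S y V -> dform theta y T V = 0] ->
  [/\ cconj T' = T', tangent S y T', app (theta y) T' = 1
    & forall V, tangent S y V -> dform theta y T' V = 0] -> T.1 = T'.1.
Proof.
move=> [rT tT T1 dT] [rT' tT' T1' dT'].
pose d := -1 *: T' + T.
have rd : cconj d = d by rewrite cconjL conjcN conjc1 rT rT'.
have td : tangent S y d by exact: tangentL.
have th : tangent S y (holo d.1) by apply/theta_kernel => //; rewrite appL T1 T1' mulr1 addNr.
have tc := tangent_conj th.
have orth T0 : tangent S y T0 -> dform theta y T0 (cconj (holo d.1)) = 0 ->
    hprod (g y) T0.1 d.1 0 0 = 0.
  move=> tT0; rewrite theta_kform // kformE cconjK cconj_holo1 hprod0l [X in _ - X]mxE subr0.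
  by move/eqP; rewrite mulf_eq0 (negbTE (imC_neq0 (R := R))) => /eqP.
have d1 : d.1 = T.1 - T'.1 by rewrite /d -[LHS]/(-1 *: T'.1 + T.1) scaleN1r addrC.
apply/eqP; rewrite -subr_eq0 -d1; apply/negP => /negP d0.
have := hprod_gt0 kg Dy d0.
rewrite {1}d1 hprodBl mxE (orth T tT (dT _ tc)) [X in _ + X]mxE (orth T' tT' (dT' _ tc)).
by rewrite subrr ltxx.
Qed.

End ReebUniqueness.

Section MainEquivalence.
Context {R : realType} {n : nat} (n0 : (0 < n)%N).
Variables (X : kahlerManifold R n.+1) (M : set X).
Variable theta : chart X -> cspace R n.+1 -> cvec R n.+1.
Hypotheses (ph : pseudohermitian M theta) (ind : induces M theta).
Local Notation E := (cspace R n.+1).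
Local Notation C := R[i].
Implicit Types (c : chart X) (x : E) (F : frame R n.+1 n).

Let g c := kmetric c.
Let S c := trace_in M c.
Let oD c : open (cimg c) := @km_open_img R n.+1 X c.
Let kg c : kahler_metric (cimg c) (g c) := @km_kahler R n.+1 X c.

Let theta_real c y : S c y -> cconj (theta c y) = theta c y.
Proof. by case=> Dy _; exact: (ph_real ph Dy). Qed.

Let theta_kernel c y : S c y -> forall V, cconj V = V -> tangent (S c) y V ->
  (app (theta c y) V = 0 <-> tangent (S c) y (holo V.1)).
Proof. by move=> Sy V rV tV; exact: (ph_kernel ph Sy rV tV). Qed.

Let theta_kform c y : S c y -> forall V V', tangent (S c) y V -> tangent (S c) y V' ->
  dform (theta c) y V V' = kform (g c y) V V'.
Proof. by move=> Sy V V' tV tV'; exact: (ind Sy tV tV'). Qed.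

Lemma frame_nbhd c x F (O : set E) : S c x -> tw_frame_at (S c) (theta c) x F ->
  open O -> O x -> exists U W, [/\ open W, W x, W `<=` cimg c, W `<=` U & W `<=` O] /\
    (vsmooth W (theta c) /\ tw_frame (S c) (theta c) U F).
Proof.
move=> Sx [U [oU Ux] twF] oO Ox.
have [U' [oU' U'x] sth] := ph_smooth ph Sx.
exists U, (U `&` U' `&` cimg c `&` O); split.
  split.
  - by apply: openI => //; apply: openI => //; exact: openI.
  - by case: Sx => Dx _.
  - by move=> z [[_ ?] _].
  - by move=> z [[[? _] _] _].
  - by move=> z [].
by split => //; apply: vsmooth_sub sth => z [[[_ ?] _] _].
Qed.

Lemma mean_curvature_frame c x F H : S c x -> tw_frame_at (S c) (theta c) x F ->
  is_mean_curvature n M theta c x H ->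
  H = holo (imC *: xi F x) /\ sqnorm (g c x) H = xi2 (g c) F x.
Proof.
move=> Sx tF [F' uF' ->].
have Dx : cimg c x by case: Sx.
have tF' : tw_frame_at (S c) (theta c) x F'.
  by case: uF' => U [oU Ux] [twF _]; exists U.
have h1 : hmx F' x = 1%:M by case: uF' => U [oU Ux] [_ h]; exact: h.
have [U [W [[oW Wx WD WU _] [sth twF]]]] := frame_nbhd Sx tF openT Logic.I.
have [U' [W' [[oW' Wx' WD' WU' _] [sth' twF']]]] := frame_nbhd Sx tF' openT Logic.I.
have -> : mean_curvature (g c) (theta c) F' x = holo (imC *: xi F' x).
  exact: (mean_curvatureE (kg c) (@theta_real c) (@theta_kernel c) (@theta_kform c)
    oW' WD' WU' sth' twF' Wx' Sx h1 n0).
(* H is computed in the unitary frame [F'], while [F] is the frame used for A and K; they share the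
   Reeb field. *)
have -> : xi F' x = xi F x.
  apply: (reeb_unique (kg c) Dx (theta_kernel Sx) (theta_kform Sx)).
    exact: (tw_reeb twF' (WU' _ Wx') Sx).
  exact: (tw_reeb twF (WU _ Wx) Sx).
split => //; rewrite sqnorm_holo hprodZl hprodZr scalerA imC_conj mxE.
by rewrite mulrN imC2 opprK mul1r.
Qed.

Lemma Cconvex_torsion_bound : Cconvex n M theta ->
  forall c x, S c x -> forall a, a != 0 -> tangent (S c) x (holo a) ->
  forall F, tw_frame_at (S c) (theta c) x F ->
  forall H, is_mean_curvature n M theta c x H -> `|Asec F x a| <= xi2 (g c) F x.
Proof.
move=> cvx c x Sx a a0 ta F tF H mH.
have [U [W [[oW Wx WD WU _] [sth twF]]]] := frame_nbhd Sx tF openT Logic.I.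
have [HE _] := mean_curvature_frame Sx tF mH.
have N0 := hprod_gt0 (kg c) (WD _ Wx) a0.
pose zt := et F x (holo a); pose q := imC * torsion_quad F x zt.
(* Convexity is tested on l Z, whose torsion term is minus its modulus; constant components in the
   frame extend this vector to a section. *)
have [l l1 lq] := unit_rotation q.
pose Y z := (l *: zt) *m Zm F z.
have sY : rowsmooth W Y.
  have sm : msmooth W Y := msmoothM oW (msmooth_cst W (l *: zt)) (smooth_Zm oW WU twF).
  by move=> j; exact: sm.
have tY z : W z -> S c z -> tangent (S c) z (holo (Y z)).
  by move=> Wz Sz; exact: (tangent_Lf WU twF Wz Sz).
have := cvx c x Sx F H W Y tF mH oW Wx sY tY; rewrite HE => nn.
have := eq_ind _ (fun u => is_true (0 <= u)) nn _ (normalized_second_ffE (@oD c) (kg c)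
  (@theta_real c) (@theta_kernel c) (@theta_kform c) oW WD WU sth twF Wx Sx sY tY).
have aE : a = zt *m Zm F x by exact: (frame_coord WU twF Wx Sx ta).
have -> : hprod (kmetric c x) (Y x) (Y x) 0 0 = hprod (g c x) a a 0 0.
  by rewrite /Y -scalemxAl -aE hprodZl hprodZr scalerA l1 scale1r.
have -> : et F x (holo (Y x)) = l *: zt by exact: (et_Lf WU twF Wx Sx).
have -> : torsion_quad F x (l *: zt) = l ^+ 2 * torsion_quad F x zt.
  rewrite /torsion_quad linearZ /= -!scalemxAr -!scalemxAl scalerA -expr2.
  by rewrite mxE.
have x0 := xi2_gt0 (kg c) WD WU twF Wx Sx.
have xr := xi2_real (kg c) WD WU twF Wx Sx.
have Nr := norm_real (kg c) WD a Wx.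
rewrite mulrCA -/q lq; set w := _ - _.
have wr : conjc w = w.
  rewrite /w conjcD conjcN conjcM xr Nr; congr (_ - _).
  by have /complex_realP[r ->] := normr_real q; exact: conjc_real.
rewrite wr -mulrA pmulr_lge0; last first.
  by rewrite mulr_gt0 ?invr_gt0 ?ltr0n // sqrtC_gt0 divr_gt0 // ltr0n.
rewrite -mulr2n pmulrn_lge0 // /w subr_ge0 => qle.
rewrite (AsecE (kg c) (@theta_kform c) WD WU twF Wx Sx ta) -/zt -/q normrM normfV.
by rewrite (gtr0_norm N0) ler_pdivrMr.
Qed.

Lemma torsion_bound_Cconvex :
  (forall c x, S c x -> forall a, a != 0 -> tangent (S c) x (holo a) ->
   forall F, tw_frame_at (S c) (theta c) x F ->
   forall H, is_mean_curvature n M theta c x H -> `|Asec F x a| <= xi2 (g c) F x) ->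
  Cconvex n M theta.
Proof.
move=> bnd c x Sx F H O Y tF mH oO Ox sY0 tY0.
have [U [W [[oW Wx WD WU WO] [sth twF]]]] := frame_nbhd Sx tF oO Ox.
have [HE _] := mean_curvature_frame Sx tF mH.
have sY : rowsmooth W Y by move=> j; apply: csmooth_sub (sY0 j).
have tY z : W z -> S c z -> tangent (S c) z (holo (Y z)) by move=> /WO Oz; exact: tY0.
rewrite HE; apply: (eq_ind_r (fun u => is_true (0 <= u)) _ (normalized_second_ffE (@oD c)
  (kg c) (@theta_real c) (@theta_kernel c) (@theta_kform c) oW WD WU sth twF Wx Sx sY tY)).
have x0 := xi2_gt0 (kg c) WD WU twF Wx Sx.
have ta := tY x Wx Sx; move: (Y x) ta => a ta.
rewrite -mulrA mulr_ge0 //; last first.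
  by rewrite ltW // mulr_gt0 ?invr_gt0 ?ltr0n // sqrtC_gt0 divr_gt0 // ltr0n.
(* The section may vanish at x, where the bound on A says nothing; both terms are then 0. *)
apply: half_plane; have [a0|a0] := eqVneq a 0.
  rewrite a0 -[holo 0]/(0 : cvec R n.+1) hprod0l mxE mulr0.
  have -> : et F x 0 = 0 by apply/rowP => b; rewrite !mxE app0.
  by rewrite /torsion_quad mul0mx mxE mulr0 normr0.
have N0 := hprod_gt0 (kg c) (WD _ Wx) a0.
have := bnd c x Sx a a0 ta F tF H mH.
rewrite (AsecE (kg c) (@theta_kform c) WD WU twF Wx Sx ta) normrM normfV.
by rewrite (gtr0_norm N0) ler_pdivrMr.
Qed.

Lemma Ksec_frame c x a F : S c x -> a != 0 -> tangent (S c) x (holo a) ->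
  tw_frame_at (S c) (theta c) x F ->
  Ksec F x a = Ktilde (g c) x a / 2 + xi2 (g c) F x - `|Asec F x a| ^+ 2 / (2 * xi2 (g c) F x)
  /\ 0 < xi2 (g c) F x.
Proof.
move=> Sx a0 ta tF.
have [U [W [[oW Wx WD WU _] [sth twF]]]] := frame_nbhd Sx tF openT Logic.I.
split; last exact: (xi2_gt0 (kg c) WD WU twF Wx Sx).
exact: (Ksec_gauss (@oD c) (kg c) (@theta_real c) (@theta_kernel c)
  (@theta_kform c) oW WD WU sth twF Wx Sx ta).
Qed.

Lemma Cconvex_iff_torsion : Cconvex n M theta <->
  (forall c x, trace_in M c x -> forall a, a != 0 -> tangent (trace_in M c) x (holo a) ->
   forall H t, is_mean_curvature n M theta c x H -> is_Asec n M theta c x a t ->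
   `|t| <= sqnorm (kmetric c x) H).
Proof.
split=> [cvx c x Sx a a0 ta H t mH [F tF ->]|bnd].
  have [_ ->] := mean_curvature_frame Sx tF mH.
  exact: (Cconvex_torsion_bound cvx Sx a0 ta tF mH).
apply: torsion_bound_Cconvex => c x Sx a a0 ta F tF H mH.
have [_ <-] := mean_curvature_frame Sx tF mH.
by apply: (bnd c x Sx a a0 ta H _ mH); exists F.
Qed.

Lemma Cconvex_Ksec : Cconvex n M theta ->
  forall c x, trace_in M c x -> forall a, a != 0 -> tangent (trace_in M c) x (holo a) ->
  forall H k, is_mean_curvature n M theta c x H -> is_Ksec n M theta c x a k ->
  (Ktilde (kmetric c) x a + sqnorm (kmetric c x) H) / 2 <= k.
Proof.
move=> cvx c x Sx a a0 ta H k mH [F tF ->].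
have [_ ->] := mean_curvature_frame Sx tF mH.
have := Cconvex_torsion_bound cvx Sx a0 ta tF mH.
have [-> x0] := Ksec_frame Sx a0 ta tF.
move: (xi2 _ _ _) (Asec _ _ _) (Ktilde _ _ _) x0 => r A K r0 Ar.
(* By the Gauss equation the gap is (|H|^4 - |A|^2) / (2 |H|^2), which the torsion bound makes
   nonnegative. *)
rewrite -subr_ge0 (_ : _ - _ = (r ^+ 2 - `|A| ^+ 2) / (2 * r)).
  rewrite divr_ge0 ?mulr_ge0 ?ler0n ?(ltW r0) // subr_ge0.
  by rewrite ler_pXn2r // ?nnegrE // ltW.
by move: (`|A|) => B; field; rewrite lt0r_neq0.
Qed.

End MainEquivalence.

(** * The tube over the unit sphere *)

Section Coordinates.
Context {R : realType} {m : nat}.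
Local Notation E := (cspace R m).
Local Notation C := R[i].
Local Notation CV := (cvec R m).
Implicit Types (U : set E) (x v : E) (V : CV).

Lemma linear_smooth U (L : E -> R) : open U -> (forall t u y, L (t *: u + y) = t * L u + L y) ->
  continuous L -> smooth U L.
Proof.
move=> oU linL cL; case=> [|k]; first by split => // x _; exact: cL.
split; first by move=> x _; exact: cL.
have dL x v := is_derive_linear x v linL.
move=> v; split; first by move=> x _; case: (dL x v).
apply: (Ck_eq (f := fun=> L v)) => //; last exact: Ck_cst.
by move=> x _; case: (dL x v).
Qed.

Definition re_coord (j : 'I_m) (x : E) : R := x.1 0 j.
Definition im_coord (j : 'I_m) (x : E) : R := x.2 0 j.

Lemma re_coord_linear j t u y : re_coord j (t *: u + y) = t * re_coord j u + re_coord j y.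
Proof. by rewrite /re_coord !mxE. Qed.

Lemma im_coord_linear j t u y : im_coord j (t *: u + y) = t * im_coord j u + im_coord j y.
Proof. by rewrite /im_coord !mxE. Qed.

Lemma re_coord_continuous j : continuous (re_coord j).
Proof.
move=> x; apply: (@continuous_comp _ _ _ fst (fun M : 'rV[R]_m => M 0 j)).
  exact: cvg_fst.
exact: coord_continuous.
Qed.

Lemma im_coord_continuous j : continuous (im_coord j).
Proof.
move=> x; apply: (@continuous_comp _ _ _ snd (fun M : 'rV[R]_m => M 0 j)).
  exact: cvg_snd.
exact: coord_continuous.
Qed.

Lemma re_coord_smooth U j : open U -> smooth U (re_coord j).
Proof.
by move=> oU; apply: linear_smooth => //; [exact: re_coord_linear|exact: re_coord_continuous].
Qed.

Lemma im_coord_smooth U j : open U -> smooth U (im_coord j).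
Proof.
by move=> oU; apply: linear_smooth => //; [exact: im_coord_linear|exact: im_coord_continuous].
Qed.

Lemma dirder_real v (L : E -> R) x : dirder v (fun y => (L y)%:C%C) x = ('D_v L x)%:C%C.
Proof.
Transparent dirder.
by rewrite /dirder /= derive_cst.
Qed.
Opaque dirder.

Lemma cder_re_coord x V j :
  cder x V (fun y => (re_coord j y)%:C%C) = 2^-1 * (V.1 0 j + V.2 0 j).
Proof.
rewrite cderE.
have e p : dirder (basisv p) (fun y => (re_coord j y)%:C%C) x = (p == (true, j))%:R.
  rewrite dirder_real; have [_ ->] := is_derive_linear x (basisv p) (re_coord_linear j).
  rewrite /re_coord /basisv; case: p => -[] k /=; rewrite !mxE ?eqxx ?xpair_eqE /= ?[j == k]eq_sym.
    by case: (k == j).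
  by [].
rewrite (bigD1 (true, j)) //= e eqxx mulr1 big1 ?addr0 // => p /negbTE pj.
by rewrite e pj mulr0.
Qed.

Lemma cder_im_coord x V j :
  cder x V (fun y => (im_coord j y)%:C%C) = 2^-1 * imC * (V.2 0 j - V.1 0 j).
Proof.
rewrite cderE.
have e p : dirder (basisv p) (fun y => (im_coord j y)%:C%C) x = (p == (false, j))%:R.
  rewrite dirder_real; have [_ ->] := is_derive_linear x (basisv p) (im_coord_linear j).
  rewrite /im_coord /basisv; case: p => -[] k /=; rewrite !mxE ?eqxx ?xpair_eqE /= ?[j == k]eq_sym.
    by [].
  by case: (k == j).
rewrite (bigD1 (false, j)) //= e eqxx mulr1 big1 ?addr0 // => p /negbTE pj.
by rewrite e pj mulr0.
Qed.

Lemma zcoordE j x : zcoord j x = (re_coord j x)%:C%C + imC * (im_coord j x)%:C%C.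
Proof.
by apply/eqP; rewrite eq_complex /=; apply/andP; split; apply/eqP;
  rewrite /re_coord /im_coord; ring.
Qed.

Lemma zcoord_smooth U j : open U -> csmooth U (zcoord j).
Proof.
by move=> oU; split; [exact: (re_coord_smooth j oU)|exact: (im_coord_smooth j oU)].
Qed.

Lemma cder_zcoord x V j : cder x V (zcoord j) = V.1 0 j.
Proof.
have oT : open (@setT E) by exact: openT.
have sr := csmooth_real (re_coord_smooth j oT).
have si := csmooth_real (im_coord_smooth j oT).
rewrite (_ : zcoord j = fun y => (re_coord j y)%:C%C + imC * (im_coord j y)%:C%C); last first.
  by apply/funext => y; exact: zcoordE.
rewrite (cderD _ Logic.I sr (csmoothM oT (csmooth_cst _ imC) si)) (cderZ _ _ Logic.I si).
rewrite cder_re_coord cder_im_coord; have i2 := @imC2 R.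
rewrite (_ : imC * (_ * imC * _) = imC * imC * (2^-1 * (V.2 0 j - V.1 0 j))); last by ring.
by rewrite i2; field.
Qed.

Lemma dzbar_cder j f x : dzbar j f x = cder x (cconj (ez j)) f.
Proof.
Transparent cder.
rewrite /cder /ez (bigD1 j) //= !mxE !eqxx conjc0 conjc1 mul1r mul0r add0r.
rewrite big1 ?addr0 // => k kj.
by rewrite !mxE eqxx (negbTE kj) conjc0 !mul0r addr0.
Qed.
Opaque cder.

Lemma dz_zcoord j k x : dz j (zcoord k) x = (k == j)%:R.
Proof. by rewrite dz_cder cder_zcoord !mxE eqxx. Qed.

Lemma dzbar_zcoord j k x : dzbar j (zcoord k) x = 0.
Proof. by rewrite dzbar_cder cder_zcoord !mxE conjc0. Qed.

Lemma cspace_second_countable : @second_countable E.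
Proof.
pose rv (p : 'rV[rat]_m * 'rV[rat]_m) : E := (map_mx ratr p.1, map_mx ratr p.2).
pose b (q : nat * ('rV[rat]_m * 'rV[rat]_m)) : set E := ball (rv q.2) (q.1.+1%:R^-1).
exists (range b); first exact: (card_le_trans (card_image_le b setT) (countableP _)).
split; first by move=> _ [q _ <-]; apply: ball_open; rewrite invr_gt0 ltr0n.
move=> x A /nbhs_ballP[e /= e0 eA].
(* This gives 2 / (k + 1) < e, so a ball of radius 1 / (k + 1) that contains x lies in the e-ball
   around x. *)
pose k := Num.truncn (2 / e).
have ke : 2 * k.+1%:R^-1 < e :> R.
  rewrite ltr_pdivrMr ?ltr0n // mulrC -ltr_pdivrMr //.
  by rewrite /k truncnS_gt.
have [r rx] : exists r, forall j, `|(rv r).1 0 j - x.1 0 j| < k.+1%:R^-1 /\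
    `|(rv r).2 0 j - x.2 0 j| < k.+1%:R^-1.
  have d0 : 0 < k.+1%:R^-1 :> R by rewrite invr_gt0 ltr0n.
  have ap (t d : R) : 0 < d -> exists r : rat, `|ratr r - t| < d.
    move=> dp; have : t - d < t + d by lra.
    move=> /rat_in_itvoo[r]; rewrite in_itv /= => /andP[h1 h2].
    by exists r; rewrite ltr_norml; apply/andP; split; lra.
  have [r1 h1] := choice (fun j => ap (x.1 0 j) _ d0).
  have [r2 h2] := choice (fun j => ap (x.2 0 j) _ d0).
  by exists (\row_j r1 j, \row_j r2 j) => j; rewrite !mxE.
have d0 : 0 < k.+1%:R^-1 :> R by rewrite invr_gt0 ltr0n.
have bx : ball (rv r) (k.+1%:R^-1) x.
  by split; split => // i j; rewrite (ord1 i) -ball_normE /ball_ /=; have [] := rx j.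
exists (b (k, r)).
  by split => //; exists (k, r).
move=> y /= ry; apply: eA.
apply: (@le_ball _ _ x (k.+1%:R^-1 + k.+1%:R^-1)); first by have := ke; rewrite mulr_natl mulr2n => /ltW.
exact: (ball_triangle (ball_sym bx)).
Qed.

Lemma cst_kahler : kahler_metric setT (fun _ : E => 1%:M : 'M[C]_m).
Proof.
split=> [j k|x _ j k|x _ a a0|x _ V1 V2 V3]; first exact: csmooth_cst.
- by rewrite !mxE eq_sym conjc_nat.
- rewrite sqnorm_holo hprodE mulmx1 mxE.
  under eq_bigr do rewrite !mxE.
  have [j aj] : exists j, a 0 j != 0.
    apply/existsP; rewrite -[X in is_true X]negbK negb_exists; apply/negP => /forallP h.
    by move/eqP: a0; apply; apply/rowP => j; rewrite mxE; move: (h j); rewrite negbK => /eqP.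
  rewrite (bigD1 j) //= ltr_wpDr ?sumr_ge0 // => [k _|]; first exact: mulcJ_ge0.
  by rewrite lt0r mulcJ_ge0 mulf_neq0 ?conjc_eq0.
- by rewrite !cder_cst subrr add0r.
Qed.

Lemma holomorphic_id (D : set E) : open D -> holomorphic D (fun y : E => y).
Proof. by move=> oD k; split; [exact: zcoord_smooth|move=> x _ j; exact: dzbar_zcoord]. Qed.

Lemma pushforward_id x V : Defs.pushforward (fun y : E => y) x V = V.
Proof.
rewrite /Defs.pushforward [RHS]surjective_pairing.
have -> : \matrix_(j, k) dz j (fun y : E => zcoord k y) x = 1%:M :> 'M[C]_m.
  by apply/matrixP => j k; rewrite !mxE dz_zcoord eq_sym.
by rewrite map_mx1 !mulmx1.
Qed.

(** One chart, the identity, with the flat metric. The definition stays transparent because later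
    proofs compute [cimg], [ctrans] and [kmetric]. *)
Definition complex_space : kahlerManifold R m.
Proof.
refine (@KahlerManifold R m E _ _ unit (fun=> setT) (fun _ y => y) (fun _ y => y)
  (fun _ _ => 1%:M) _ _ _ _ _ _ _ _ _).
- exact: norm_hausdorff.
- exact: cspace_second_countable.
- by move=> p; exists tt.
- by move=> _; exact: openT.
- by move=> _; rewrite image_id; exact: openT.
- by [].
- by move=> _ p _; exact: cvg_id.
- by move=> _ p _; exact: cvg_id.
- by move=> _ _; apply: holomorphic_id; rewrite image_id setTI; exact: openT.
- by move=> _; rewrite image_id; exact: cst_kahler.
- by move=> _ _ x _ _ V W; rewrite !pushforward_id.
Defined.

End Coordinates.

(** * The tube |Re z| = 1 and its tangent space *)

Section SphereTube.
Context {R : realType} {m : nat}.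
Local Notation E := (cspace R m).
Local Notation C := R[i].
Local Notation CV := (cvec R m).
Implicit Types (x y v : E) (V : CV) (a b : 'rV[C]_m).

(** Complex bilinear, not Hermitian: [dot a a] is, up to a constant, the torsion of the tube, and it
    equals |a|^2 for real a. *)
Definition dot a b : C := (a *m b^T) 0 0.
Definition xr y : 'rV[C]_m := \row_j (re_coord j y)%:C%C.
Definition rho y : R := \sum_j re_coord j y ^+ 2 - 1.
Definition tube : set E := [set y | rho y = 0].

Lemma dotE a b : dot a b = \sum_j a 0 j * b 0 j.
Proof. by rewrite /dot mxE; apply: eq_bigr => j _; rewrite mxE. Qed.

Lemma smooth_xr U : open U -> msmooth U xr.
Proof.
move=> oU i j; apply: (csmooth_eq (f := fun y => (re_coord j y)%:C%C)) => //.
  by move=> y _; rewrite mxE.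
exact: (csmooth_real (re_coord_smooth j oU)).
Qed.

Lemma mder_xr y V : mder y V xr = 2^-1 *: (V.1 + V.2).
Proof.
apply/matrixP => i j; rewrite !mxE (ord1 i) -(cder_re_coord y); congr cder.
by apply/funext => z; rewrite mxE.
Qed.

Lemma conj_xr y : map_mx conjc (xr y) = xr y.
Proof. by apply/rowP => j; rewrite !mxE; exact: conjc_real. Qed.

Lemma rho_complex y : (rho y)%:C%C = dot (xr y) (xr y) - 1.
Proof.
rewrite /rho rmorphB rmorph1 rmorph_sum dotE; congr (_ - _); apply: eq_bigr => j _.
by rewrite mxE rmorphXn expr2.
Qed.

Lemma tube_dot y : tube y -> dot (xr y) (xr y) = 1.
Proof. by rewrite /tube /= => r0; apply/eqP; rewrite -subr_eq0 -rho_complex r0. Qed.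

Lemma csmooth_rho U : open U -> csmooth U (fun y => (rho y)%:C%C).
Proof.
move=> oU; have sx := smooth_xr oU.
apply: (csmooth_eq (f := fun y => \sum_j xr y 0 j * xr y 0 j + -1)) => //.
  by move=> y _; rewrite rho_complex dotE.
apply: csmoothD => //; last exact: csmooth_cst.
by apply: csmooth_sum => // j; apply: csmoothM => //; exact: sx.
Qed.

Lemma smooth_rho U : open U -> smooth U rho.
Proof. by move=> /csmooth_rho[]. Qed.

Lemma cder_rho y V : cder y V (fun z => (rho z)%:C%C) = dot (xr y) (V.1 + V.2).
Proof.
have oT : open (@setT E) by exact: openT.
have sx := smooth_xr oT.
rewrite (_ : (fun z => _) = fun z => \sum_j xr z 0 j * xr z 0 j + -1); last first.
  by apply/funext => z; rewrite rho_complex dotE.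
have sM j : csmooth setT (fun z => xr z 0 j * xr z 0 j) by exact: csmoothM.
rewrite (cderD _ Logic.I (csmooth_sum _ _ oT sM) (csmooth_cst _ _)) cder_cst addr0.
rewrite (cder_sum _ _ _ oT Logic.I sM) dotE; apply: eq_bigr => j _.
rewrite (cderM _ Logic.I (sx 0 j) (sx 0 j)).
have := mder_xr y V => /matrixP /(_ 0 j); rewrite !mxE => ->.
by move: (re_coord j y)%:C%C (V.1 0 j) (V.2 0 j) => p q r; field.
Qed.

Lemma cder_basis x j f : cder x (delta_mx 0 j, delta_mx 0 j) f = dirder (ex j) f x.
Proof.
Transparent coefv.
rewrite cderE (bigD1 (true, j)) //= big1 => [|[b k] /=]; rewrite /coefv /= !mxE.
  rewrite !eqxx /= addr0 -[ex j]/(basisv (true, j)).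
  by rewrite (_ : 2^-1 * (1%:R + 1%:R) = 1 :> C) ?mul1r //; field.
rewrite xpair_eqE; case: b => /= [/negbTE kj|_]; last by rewrite subrr mulr0 mul0r.
by rewrite kj addr0 mulr0 mul0r.
Qed.
Opaque coefv.

Lemma tube_defining y (S : set E) : S = tube -> S y -> defining_function S y rho.
Proof.
move=> -> Sy; exists setT; split => //; [exact: openT|exact: smooth_rho openT|].
have [j xj] : exists j, re_coord j y != 0.
  apply/existsP; rewrite -[X in is_true X]negbK negb_exists; apply/negP => /forallP h.
  move: Sy; rewrite /tube /= /rho big1 => [|j _]; last first.
    by move: (h j); rewrite negbK => /eqP ->; rewrite expr0n.
  by rewrite sub0r => /eqP; rewrite oppr_eq0 oner_eq0.
exists (ex j); apply: contra_neq xj => D0.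
have := cder_basis y j (fun z => (rho z)%:C%C); rewrite dirder_real D0 cder_rho dotE.
rewrite (bigD1 j) //= big1 => [|k kj]; rewrite !mxE !eqxx.
  rewrite addr0 => /eqP; rewrite mulf_eq0 => /orP[/eqP/complexI //|].
  by rewrite -(natrD _ 1 1) pnatr_eq0.
by rewrite (negbTE kj) addr0 mulr0.
Qed.

Lemma levi_rho x a : levi_form rho x a = 2^-1 * \sum_j a 0 j * conjc (a 0 j).
Proof.
have e j k : dz j (dzbar k (fun y => (rho y)%:C%C)) x = 2^-1 * (k == j)%:R.
  have -> : dzbar k (fun y => (rho y)%:C%C) = fun y => (re_coord k y)%:C%C.
    apply/funext => y; rewrite dzbar_cder cder_rho dotE (bigD1 k) //= big1 => [|l lk].
      by rewrite !mxE !eqxx conjc0 conjc1 add0r mulr1 addr0.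
    by rewrite !mxE eqxx (negbTE lk) conjc0 addr0 mulr0.
  by rewrite dz_cder cder_re_coord !mxE eqxx addr0.
rewrite /levi_form mulr_sumr; apply: eq_bigr => j _.
rewrite (bigD1 j) //= big1 ?addr0 => [|k kj]; rewrite e; first by rewrite eqxx mulr1 mulrA.
by rewrite (negbTE kj) mulr0 !mul0r.
Qed.

Lemma row_neq0 a : a != 0 -> 0 < \sum_j a 0 j * conjc (a 0 j).
Proof.
move=> a0; have [_ _ h _] := @cst_kahler R m.
have := h 0 Logic.I a a0; rewrite sqnorm_holo hprodE mulmx1 mxE.
by under eq_bigr do rewrite !mxE.
Qed.

(* The curve [x + (2 t v - 2 t^2 |v|^2 (Re x, 0)) / (1 + t^2 |v|^2)], a rational
   parametrization of a circle, stays in the tube. *)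
Lemma derive_tube U (f : E -> R) x v : open U -> U x -> tube x -> Ck 1 U f ->
  (forall y, U y -> tube y -> f y = 0) -> \sum_j re_coord j x * re_coord j v = 0 ->
  'D_v f x = 0.
Proof.
move=> oU Ux Sx C1f f0 xv.
pose u : E := (x.1, 0).
pose q := \sum_j re_coord j v ^+ 2.
have q0 : 0 <= q by apply: sumr_ge0 => j _; exact: sqr_ge0.
apply/eqP; rewrite -normr_le0; apply/ler_addgt0Pl => e e0; rewrite addr0.
have e3 : 0 < e / 3 by rewrite divr_gt0 // ltr0n.
have [d d0 dA] := C1_plane oU Ux (fun u y _ => C1_derivable C1f)
  (C1_continuous C1f Ux : {for x, continuous ('D_v f)})
  (C1_continuous C1f Ux : {for x, continuous ('D_u f)}) e3.
have [d' d'0 d'A] := nbhs_plane v u (open_nbhs_nbhs (conj oU Ux)).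
(* K dominates both q and q |D_u f|, so t K <= min(1, e / 3) bounds t q and t q |D_u f| at once. *)
pose K := 1 + q + q * `|'D_u f x|.
have K0 : 0 < K by rewrite /K ltr_wpDr ?mulr_ge0 // ltr_wpDr.
pose t := Num.min (Num.min d d' / 2) (Num.min 1 (e / 3) / K).
have t0 : 0 < t.
  by rewrite lt_min !divr_gt0 ?lt_min ?d0 ?d'0 ?ltr01 ?e3 ?ltr0n.
have td : 2 * t <= d /\ 2 * t <= d'.
  have : t <= Num.min d d' / 2 by rewrite ge_min lexx.
  by rewrite ler_pdivlMr ?ltr0n // mulrC le_min => /andP.
have tK : t * K <= 1 /\ t * K <= e / 3.
  have : t <= Num.min 1 (e / 3) / K by rewrite ge_min lexx orbT.
  by rewrite ler_pdivlMr // le_min => /andP.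
have [tq1 tqe] : t * q <= 1 /\ t * q * `|'D_u f x| <= e / 3.
  have K1 : q <= K /\ q * `|'D_u f x| <= K.
    by rewrite /K; split; rewrite ?lerDr ?addr_ge0 // -addrA addrCA lerDl addr_ge0 ?mulr_ge0.
  split; [apply: le_trans tK.1|rewrite -mulrA; apply: le_trans tK.2].
    by rewrite ler_pM2l // K1.1.
  by rewrite ler_pM2l // K1.2.
pose w := 1 + t ^+ 2 * q.
have w1 : 1 <= w by rewrite lerDl mulr_ge0 ?sqr_ge0.
have w0 : w != 0 by rewrite gt_eqF // (lt_le_trans ltr01).
(* The coefficients of v and of the radial vector u on the circle; t q <= 1 gives |r| <= s. *)
pose s := 2 * t / w; pose r := - (t * q) * s.
have s0 : 0 < s by rewrite divr_gt0 ?mulr_gt0 ?ltr0n // (lt_le_trans ltr01).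
have s2t : s <= 2 * t.
  by rewrite ler_pdivrMr ?(lt_le_trans ltr01) // ler_peMr // mulr_ge0 ?ler0n // ltW.
have rs : `|r| <= s.
  rewrite /r mulNr normrN ger0_norm; first by rewrite ler_piMl // ltW.
  by apply: mulr_ge0; [apply: mulr_ge0 => //|]; exact: ltW.
have ns : `|s| = s by rewrite gtr0_norm.
have zU : U (s *: v + (r *: u + x)).
  by apply: d'A; rewrite ?ns; [|apply: le_trans rs _]; exact: le_trans s2t td.2.
have zS : tube (s *: v + (r *: u + x)).
  rewrite /tube /= /rho.
  under eq_bigr => j _.
    have -> : re_coord j (s *: v + (r *: u + x)) = s * re_coord j v + (r + 1) * re_coord j x.
      by rewrite /re_coord /u /= !mxE; ring.
    rewrite (_ : (s * _ + _) ^+ 2 = s ^+ 2 * re_coord j v ^+ 2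
      + (r + 1) ^+ 2 * re_coord j x ^+ 2
      + 2 * s * (r + 1) * (re_coord j x * re_coord j v)); last by ring.
    over.
  rewrite !big_split /= -!mulr_sumr xv mulr0 addr0 -/q.
  move: Sx; rewrite /tube /= /rho => /eqP; rewrite subr_eq0 => /eqP ->.
  by rewrite /r /s; move: w0; rewrite /w => w0; field.
(* As f vanishes at both points, the expansion bounds s |D_v f - t q D_u f| by (e / 3) (s + |r|) <=
   (2 e / 3) s; the remaining third of e absorbs t q |D_u f|. *)
have := dA s r; rewrite ns (f0 _ zU zS) (f0 _ Ux Sx).
move=> /(_ (le_trans s2t td.1) (le_trans rs (le_trans s2t td.1))).
have rE (A B : R) : s * A + r * B = s * (A - t * q * B) by rewrite /r; ring.
rewrite subrr sub0r normrN rE normrM ns => le1.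
have {}le1 : `|'D_v f x - t * q * 'D_u f x| <= e / 3 * 2.
  rewrite -(ler_pM2l s0); apply: (le_trans le1).
  by rewrite mulrCA ler_pM2l // mulr_natr mulr2n lerD2l.
have -> : 'D_v f x = ('D_v f x - t * q * 'D_u f x) + t * q * 'D_u f x by rewrite subrK.
apply: (le_trans (ler_normD _ _)); rewrite [X in _ + X]normrM [`|t * q|]ger0_norm.
  by apply: (le_trans (lerD le1 tqe)); rewrite (_ : _ + _ = e) //; field.
by rewrite mulr_ge0 // ltW.
Qed.

Lemma derive_sum_basis U (f : E -> R) x (I : Type) (r : seq I) (h : I -> R) (v : I -> E) :
  open U -> U x -> Ck 1 U f ->
  'D_(\sum_(i <- r) h i *: v i) f x = \sum_(i <- r) h i * 'D_(v i) f x.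
Proof.
move=> oU Ux C1f; elim: r => [|i r IH]; first by rewrite !big_nil derive0.
rewrite !big_cons -IH -[X in _ + X]scale1r.
rewrite (derive_plane _ _ oU Ux (fun u y _ => C1_derivable C1f)
  (C1_continuous C1f Ux) (C1_continuous C1f Ux)).
by rewrite mul1r.
Qed.

(** One direction tests V on [rho]. For the other, the real and imaginary parts of the coefficients
    of V form two real vectors whose x-components are orthogonal to Re z, and [derive_tube] applies
    to each. *)
Lemma tube_tangentP x V : tube x -> tangent tube x V <-> dot (xr x) (V.1 + V.2) = 0.
Proof.
move=> Sx; split=> [tV|V0 U f oU Ux sf f0].
  rewrite -cder_rho; apply: (tV setT rho openT Logic.I (smooth_rho openT)).
  by move=> y _.
have C1f : Ck 1 U f := sf 1%N.
have cE : cder x V (fun y => (f y)%:C%C) =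
    ('D_(\sum_p complex.Re (coefv V p) *: basisv p) f x)%:C%C
    + imC * ('D_(\sum_p complex.Im (coefv V p) *: basisv p) f x)%:C%C.
  rewrite !(derive_sum_basis _ _ _ oU Ux C1f) cderE !rmorph_sum mulr_sumr -big_split.
  apply: eq_bigr => p _; rewrite dirder_real !rmorphM /=.
  by case: (coefv V p) => p1 p2; apply/eqP; rewrite eq_complex /=; apply/andP; split;
    apply/eqP; ring.
have coordE (h : bool * 'I_m -> R) j :
    re_coord j (\sum_p h p *: basisv p) = h (true, j).
  rewrite (big_morph (re_coord j) (id1 := 0) (op1 := +%R)); last 2 first.
  - by move=> y z; rewrite /re_coord mxE.
  - by rewrite /re_coord mxE.
  rewrite (bigD1 (true, j)) //= big1 => [|[b k]]; rewrite /re_coord /basisv /= !mxE.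
    by rewrite !eqxx mulr1 addr0.
  rewrite xpair_eqE; case: b => /= [/negbTE kj|_]; rewrite !mxE ?mulr0 //.
  by rewrite [j == k]eq_sym kj andbF mulr0.
have D0 (h : bool * 'I_m -> R) : \sum_j re_coord j x * h (true, j) = 0 ->
    'D_(\sum_p h p *: basisv p) f x = 0.
  move=> hx; apply: (derive_tube oU Ux Sx C1f f0) => //.
  by rewrite -[RHS]hx; apply: eq_bigr => j _; rewrite coordE.
have re0 : \sum_j (re_coord j x)%:C%C * coefv V (true, j) = 0.
  apply: (mulfI (_ : (2%:R : C) != 0)); first by rewrite pnatr_eq0.
  rewrite mulr0 -[RHS]V0 dotE mulr_sumr; apply: eq_bigr => j _.
  Transparent coefv.
  by rewrite /coefv /= !mxE; move: (re_coord j x)%:C%C (V.1 0 j) (V.2 0 j) => p q r; field.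
  Opaque coefv.
have reE (h : bool * 'I_m -> C) : \sum_j (re_coord j x)%:C%C * h (true, j) =
    (\sum_j re_coord j x * complex.Re (h (true, j)))%:C%C
    + imC * (\sum_j re_coord j x * complex.Im (h (true, j)))%:C%C.
  rewrite !rmorph_sum mulr_sumr -big_split; apply: eq_bigr => j _; rewrite !rmorphM /=.
  by case: (h (true, j)) => p1 p2; apply/eqP; rewrite eq_complex /=; apply/andP; split;
    apply/eqP; ring.
have key (A B : R) : A%:C%C + imC * B%:C%C = 0 -> A = 0 /\ B = 0.
  move=> /eqP; rewrite eq_complex /= => /andP[/eqP h1 /eqP h2].
  by move: h1 h2; rewrite !(mul0r, mulr0, mul1r, subr0, addr0, add0r).
have [h1 h2] := key _ _ (etrans (esym (reE _)) re0).
by rewrite cE !D0 // mulr0 addr0.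
Qed.

End SphereTube.

(** * The pseudohermitian structure of the tube *)

Section TubeStructure.
Context {R : realType} {m : nat}.
Local Notation E := (cspace R m).
Local Notation C := R[i].
Local Notation CV := (cvec R m).
Implicit Types (x y : E) (V : CV) (a b : 'rV[C]_m).

(** This is 2 sum x_j dy_j, that is i (dbar - partial) rho, whose differential 2 sum dx_j /\ dy_j is
    the flat Kähler form. The Reeb field [reeb0] is (1/2) sum x_j d/dy_j. *)
Definition theta0 y : CV := ((- imC) *: xr y, imC *: xr y).
Definition reeb0 y : CV := ((imC / 2) *: xr y, (- (imC / 2)) *: xr y).

Lemma dotDr a b b' : dot a (b + b') = dot a b + dot a b'.
Proof. by rewrite /dot linearD mulmxDr mxE. Qed.

Lemma dotZr a c b : dot a (c *: b) = c * dot a b.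
Proof. by rewrite /dot linearZ /= -scalemxAr mxE. Qed.

Lemma dotC a b : dot a b = dot b a.
Proof. by rewrite !dotE; apply: eq_bigr => j _; rewrite mulrC. Qed.

Lemma dotNr a b : dot a (- b) = - dot a b.
Proof. by rewrite -scaleN1r dotZr mulN1r. Qed.

Lemma dotDl a a' b : dot (a + a') b = dot a b + dot a' b.
Proof. by rewrite dotC dotDr !(dotC b). Qed.

Lemma dotZl c a b : dot (c *: a) b = c * dot a b.
Proof. by rewrite dotC dotZr (dotC b). Qed.

Lemma theta0E y V : app (theta0 y) V = imC * dot (xr y) (V.2 - V.1).
Proof.
Transparent app.
rewrite /app dotE mulr_sumr; apply: eq_bigr => j _; rewrite !mxE.
by move: (re_coord j y)%:C%C => p; ring.
Qed.
Opaque app.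

Lemma smooth_theta0 U : open U -> vsmooth U theta0.
Proof.
by move=> oU; split=> j; exact: (msmoothZ oU (csmooth_cst U _) (smooth_xr oU) 0 j).
Qed.

Lemma cder_dot_xr y V b : cder y V (fun z => dot (xr z) b) = 2^-1 * dot (V.1 + V.2) b.
Proof.
have sx := smooth_xr (@openT E).
have sM j : csmooth setT (fun z => xr z 0 j * b 0 j).
  by apply: csmoothM; [exact: openT|exact: sx|exact: csmooth_cst].
rewrite (_ : (fun z => _) = fun z => \sum_j xr z 0 j * b 0 j); last first.
  by apply/funext => z; rewrite dotE.
rewrite (cder_sum _ _ _ (@openT E) Logic.I sM) dotE mulr_sumr; apply: eq_bigr => j _.
rewrite (cderM _ Logic.I (sx 0 j) (csmooth_cst _ _)) cder_cst mulr0 addr0.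
by have := mder_xr y V => /matrixP /(_ 0 j); rewrite mxE => ->; rewrite mxE mulrA.
Qed.

Lemma hprod1 p q (A : 'M[C]_(p, m)) (B : 'M[C]_(q, m)) : hprod 1%:M A B = A *m ctr B.
Proof. by rewrite hprodE mulmx1. Qed.

Lemma kform1 V V' : kform 1%:M V V' = imC * (dot V.1 V'.2 - dot V'.1 V.2).
Proof.
rewrite kformE !hprod1; congr (_ * (_ - _)); congr (fun_of_matrix (_ *m _) _ _);
by apply/matrixP => i j; rewrite !mxE conjcK.
Qed.

Lemma dtheta0 y V V' : dform theta0 y V V' = kform 1%:M V V'.
Proof.
rewrite kform1 /dform.
have e W W' : cder y W (fun z => app (theta0 z) W') =
    imC * (2^-1 * dot (W.1 + W.2) (W'.2 - W'.1)).
  rewrite (_ : (fun z => _) = fun z => imC * dot (xr z) (W'.2 - W'.1)); last first.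
    by apply/funext => z; rewrite theta0E.
  have sx := smooth_xr (@openT E).
  have sd : csmooth setT (fun z : E => dot (xr z) (W'.2 - W'.1)).
    apply: (csmooth_eq (f := fun z => \sum_j xr z 0 j * (W'.2 - W'.1) 0 j)) => //.
      exact: openT.
    by move=> z _; rewrite dotE.
    apply: csmooth_sum => [|j]; first exact: openT.
    by apply: csmoothM; [exact: openT|exact: sx|exact: csmooth_cst].
  by rewrite (cderZ _ _ Logic.I sd) cder_dot_xr.
rewrite !e !dotDl !dotDr !dotNr (dotC V'.1 V.1) (dotC V'.2 V.2) (dotC V'.2 V.1) (dotC V'.1 V.2).
rewrite (dotC V.2 V'.1) .
by move: (dot _ _) (dot _ _) (dot _ _) (dot _ _) => p q r s; field.
Qed.

Lemma conj_scale_xr c y : map_mx conjc (c *: xr y) = conjc c *: xr y.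
Proof. by rewrite map_mxZ conj_xr. Qed.

Lemma theta0_real y : cconj (theta0 y) = theta0 y.
Proof.
by congr pair; rewrite [LHS]conj_scale_xr ?conjcN imC_conj ?opprK.
Qed.

Lemma reeb0P y : tube y ->
  [/\ cconj (reeb0 y) = reeb0 y, tangent tube y (reeb0 y), app (theta0 y) (reeb0 y) = 1
    & forall V, tangent tube y V -> dform theta0 y (reeb0 y) V = 0].
Proof.
move=> Sy; have half : conjc (2^-1 : C) = 2^-1 by rewrite conjc_inv (conjc_nat R 2).
have i2 := @imC2 R.
split.
- by congr pair; rewrite [LHS]conj_scale_xr ?conjcN conjcM half imC_conj ?mulNr ?opprK.
- by apply/tube_tangentP => //=; rewrite scaleNr subrr -(scale0r 0) dotZr mul0r.
- rewrite theta0E /= -scalerBl dotZr (tube_dot Sy) mulr1.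
  by rewrite (_ : imC * _ = - (imC * imC)); [rewrite i2 opprK|field].
- move=> V /tube_tangentP -/(_ Sy) V0; rewrite dtheta0 kform1 /= dotZl dotZr (dotC V.1).
  have -> : imC / 2 * dot (xr y) V.2 - - (imC / 2) * dot (xr y) V.1 =
      imC / 2 * dot (xr y) (V.1 + V.2).
    by rewrite dotDr; move: (dot _ _) (dot _ _) => p q; ring.
  by rewrite V0 !mulr0.
Qed.

Let X : kahlerManifold R m := @complex_space R m.
Definition tubeM : set X := tube.

Lemma trace_tube (c : chart X) : trace_in tubeM c = tube.
Proof.
rewrite /trace_in /cimg /=; apply/seteqP; split => y; first by case.
by move=> ty; split => //; exists y.
Qed.

Definition thetaM (c : chart X) : E -> CV := theta0.

Lemma tubeM_hypersurface : real_hypersurface tubeM.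
Proof. by move=> c x tx; exists rho; apply: tube_defining => //; exact: trace_tube. Qed.

Lemma tubeM_pseudoconvex : strictly_pseudoconvex tubeM.
Proof.
move=> c x tx; exists rho; first by apply: tube_defining => //; exact: trace_tube.
move=> a a0 _; rewrite levi_rho mulr_gt0 ?invr_gt0 ?ltr0n //; exact: row_neq0.
Qed.

Lemma tubeM_induces : induces tubeM thetaM.
Proof. by move=> c x _ V V' _ _; exact: dtheta0. Qed.

Lemma tubeM_pseudohermitian : pseudohermitian tubeM thetaM.
Proof.
split.
- move=> c x _; exists setT; first by split => //; exact: openT.
  exact: smooth_theta0 openT.
- move=> c c' x _ _ V _.
  by have -> : Defs.pushforward (ctrans c c') x V = V by exact: pushforward_id.
- by move=> c x _; exact: theta0_real.
- move=> c x; rewrite trace_tube => tx; have [_ t1 t2 _] := reeb0P tx.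
  by exists (reeb0 x) => //; rewrite /thetaM t2 oner_neq0.
- move=> c x; rewrite trace_tube => tx V rV /tube_tangentP -/(_ tx) V0.
  rewrite /thetaM theta0E; split=> [/eqP|/tube_tangentP -/(_ tx) /= h].
    rewrite mulf_eq0 (negbTE (@imC_neq0 R)) /= => /eqP h.
    apply/tube_tangentP => //=; rewrite addr0.
    move: V0 h; rewrite !dotDr dotNr; move: (dot _ _) (dot _ _) => p q e1 e2.
    apply: (mulfI (_ : (2%:R : C) != 0)); first by rewrite pnatr_eq0.
    by rewrite mulr0 -[RHS](subrr 0) -{1}e1 -{1}e2; ring.
  move: V0 h; rewrite addr0 !dotDr dotNr => + h; rewrite h add0r => ->.
  by rewrite subrr mulr0.
- move=> c x _ a a0 _; rewrite /thetaM dtheta0 kform_holo mulrA mulNr imC2 opprK mul1r.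
  rewrite hprod1 mxE (eq_bigr (fun j => a 0 j * conjc (a 0 j))); first exact: row_neq0.
  by move=> j _; rewrite !mxE.
Qed.

End TubeStructure.

(** * The torsion of the tube *)

Section TubeTorsion.
Context {R : realType} {n : nat} (n0 : (0 < n)%N).
Local Notation m := n.+1.
Local Notation E := (cspace R m).
Local Notation C := R[i].
Local Notation CV := (cvec R m).
Let X : kahlerManifold R m := @complex_space R m.
Let M : set X := @tubeM R m.
Let theta : chart X -> E -> CV := @thetaM R m.

Lemma cov_flat p x V (A : E -> 'M[C]_(p, m)) : cov (fun=> 1%:M) x V A = mder x V A.
Proof.
Transparent cov chern_form.
rewrite /cov /chern_form big1 ?mulmx0 ?addr0 // => j _.
by rewrite christoffelE mder_cst mul0mx scaler0.
Qed.
Opaque cov chern_form.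

(** Uniqueness of the Reeb field gives xi = (i/2) Re z along the tube in every frame, hence |xi|^2 =
    1/4. The derivative of xi along Zbar is (i/4) conj a, which [torsion_cov] converts into the
    torsion. *)
Lemma tube_torsion c x (F : frame R m n) (a : 'rV[C]_m) : trace_in M c x ->
  tw_frame_at (trace_in M c) (theta c) x F -> tangent (trace_in M c) x (holo a) ->
  xi2 (kmetric c) F x = 4^-1 /\
  `|Asec F x a| = `|dot a a| / 4 / \sum_j a 0 j * conjc (a 0 j).
Proof.
move=> Sx tF ta.
have [U [W [[oW Wx WD WU _] [sth twF]]]] :=
  frame_nbhd (@tubeM_pseudohermitian R m) Sx tF openT Logic.I.
have kg := @km_kahler R m X c.
have ker y : trace_in M c y -> forall V, cconj V = V -> tangent (trace_in M c) y V ->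
    (app (theta c y) V = 0 <-> tangent (trace_in M c) y (holo V.1)).
  by move=> Sy V rV tV; exact: (ph_kernel (@tubeM_pseudohermitian R m) Sy rV tV).
have kf y : trace_in M c y -> forall V V', tangent (trace_in M c) y V ->
    tangent (trace_in M c) y V' -> dform (theta c) y V V' = kform (kmetric c y) V V'.
  by move=> Sy V V' tV tV'; exact: (@tubeM_induces R m c y Sy).
have xiE y : W y -> trace_in M c y -> xi F y = (imC / 2) *: xr y.
  move=> Wy Sy; rewrite -[RHS]/((reeb0 y).1).
  apply: (reeb_unique kg (WD _ Wy) (ker _ Sy) (kf _ Sy) (tw_reeb twF (WU _ Wy) Sy)).
  by move: (Sy); rewrite /theta /M trace_tube => /reeb0P.
have hN : hprod (kmetric c x) a a 0 0 = \sum_j a 0 j * conjc (a 0 j).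
  by rewrite hprod1 mxE; apply: eq_bigr => j _; rewrite !mxE.
have half : conjc (2^-1 : C) = 2^-1 by rewrite conjc_inv (conjc_nat R 2).
have i2 := @imC2 R.
have tx : tube x by rewrite -(trace_tube c).
split.
  rewrite /xi2 (xiE x Wx Sx) hprod1 ctrZ -scalemxAl -scalemxAr !mxE.
  have -> : \sum_j xr x 0 j * ctr (xr x) j 0 = 1.
    rewrite -(tube_dot tx) dotE; apply: eq_bigr => j _; congr (_ * _).
    by rewrite !mxE; exact: conjc_real.
  rewrite conjcM half imC_conj mulr1.
  by rewrite (_ : _ * _ = - (imC * imC) / 4); [rewrite i2 opprK mul1r|field].
rewrite (AsecE kg kf WD WU twF Wx Sx ta) hN.
rewrite -(torsion_cov kg (fun y Sy => ph_real (@tubeM_pseudohermitian R m) (proj1 Sy)) ker kf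
  oW WD WU sth twF Wx Sx ta).
have -> : cov (kmetric c) x (cconj (holo a)) (xi F) = (imC / 4) *: map_mx conjc a.
  rewrite [LHS]cov_flat.
  have sx := msmoothZ oW (csmooth_cst W (imC / 2)) (smooth_xr oW).
  rewrite (tangent_mder_eq oW Wx (smooth_xi WU twF) sx (tangent_conj ta) xiE).
  rewrite (mderZ _ Wx (csmooth_cst W (imC / 2)) (smooth_xr oW)) cder_cst scale0r add0r.
  rewrite mder_xr cconj_holo1 add0r scalerA; congr (_ *: _); by field.
rewrite -[kmetric c x]/(1%:M : 'M[C]_m) hprod1 ctrZ -scalemxAr mx11Z.
have -> : ctr (map_mx conjc a) = a^T by apply/matrixP => i j; rewrite !mxE conjcK.
rewrite -/(dot a a) !normrM normfV normcJ normrM normfV.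
have -> : `|imC : C| = 1 by rewrite normc_def /= expr0n expr1n add0r sqrtr1.
rewrite !mul1r [_^-1 * _]mulrC normr_nat [`|\sum_j _|]ger0_norm //.
by apply: sumr_ge0 => j _; exact: mulcJ_ge0.
Qed.

(** By [tube_torsion] the bound to check is |sum a_j^2| <= sum |a_j|^2. *)
Lemma tubeM_Cconvex : Cconvex n M theta.
Proof.
apply: (torsion_bound_Cconvex n0 (@tubeM_pseudohermitian R m) (@tubeM_induces R m)).
move=> c x Sx a a0 ta F tF H _.
have [-> ->] := tube_torsion Sx tF ta.
have N0 := row_neq0 a0.
rewrite ler_pdivrMr // mulrC ler_pM2l ?invr_gt0 ?ltr0n // dotE.
apply: le_trans (ler_norm_sum _ _ _) _; apply: ler_sum => j _.
by rewrite -sqr_normc normrM expr2.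
Qed.

End TubeTorsion.

(** * A unitary frame of the tube built from Householder reflections *)

Section HouseholderFrame.
Context {R : realType} {n : nat}.
Local Notation m := n.+1.
Local Notation E := (cspace R m).
Local Notation C := R[i].
Local Notation CV := (cvec R m).
Implicit Types (y : E) (V : CV).

Definition e0 : 'rV[C]_m := delta_mx 0 ord0.
Definition Jm : 'M[C]_(n, m) := row' ord0 1%:M.
Definition frame_dom : set E := [set y | 0 < 1 + re_coord ord0 y].
(** On the tube |xr + e0|^2 = 2 (1 + Re z_0), so this is the factor 2 / |xr + e0|^2 of the
    reflection along xr + e0. *)
Definition scal y : C := (1 + (re_coord ord0 y)%:C%C)^-1.

(* The rows are the images of the last [n] basis vectors under the Householder reflection
   that maps [- e0] to [xr y]. *)
Definition Zc y : 'M[C]_(n, m) := Jm - scal y *: (Jm *m (xr y)^T *m (xr y + e0)).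

Lemma open_frame_dom : open frame_dom.
Proof.
have -> : frame_dom = re_coord ord0 @^-1` [set t : R | -1 < t].
  by apply/seteqP; split => y /=; rewrite /frame_dom /= -ltrBlDl sub0r.
apply: open_comp; last exact: open_gt.
by move=> y _; exact: re_coord_continuous.
Qed.

Lemma scal_unit y : frame_dom y -> 1 + (re_coord ord0 y)%:C%C != 0 :> C.
Proof.
rewrite /frame_dom /= => h; have -> : 1 + (re_coord ord0 y)%:C%C = (1 + re_coord ord0 y)%:C%C.
  by rewrite rmorphD rmorph1.
by apply/eqP => /complexI e; rewrite e ltxx in h.
Qed.

Lemma smooth_Zc : msmooth frame_dom Zc.
Proof.
have oU := open_frame_dom; have sx := smooth_xr oU.
apply: msmoothD => //; first exact: msmooth_cst.
apply: msmoothN => //; apply: msmoothZ => //.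
  apply: csmoothV => //; first exact: scal_unit.
  by apply: csmoothD => //; [exact: csmooth_cst|exact: (csmooth_real (re_coord_smooth ord0 oU))].
apply: msmoothM => //; last by apply: msmoothD => //; exact: msmooth_cst.
apply: msmoothM => //; first exact: msmooth_cst.
by move=> i j; apply: (csmooth_eq _ _ (sx j i)) => // z _; rewrite [RHS]mxE.
Qed.

Lemma Zc_conj y : map_mx conjc (Zc y) = Zc y.
Proof.
have cJ : map_mx conjc Jm = Jm by apply/matrixP => i j; rewrite !mxE conjc_nat.
have ce : map_mx conjc e0 = e0 by apply/matrixP => i j; rewrite !mxE conjc_nat.
rewrite /Zc map_mxB map_mxZ !map_mxM map_mxD -map_trmx conj_xr cJ ce.
congr (_ - _ *: _); rewrite [LHS]conjc_inv conjcD conjc1; congr (_^-1).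
by congr (_ + _); exact: conjc_real.
Qed.

Section OnTube.
Variable y : E.
Hypotheses (Uy : frame_dom y) (Sy : tube y).
Let x := xr y.

Lemma Jm_orth : Jm *m Jm^T = 1%:M.
Proof.
apply/matrixP => a b; rewrite !mxE (bigD1 (lift ord0 a)) //= big1 => [|k ka]; rewrite !mxE.
  by rewrite eqxx mul1r addr0 (inj_eq lift_inj) eq_sym.
by rewrite eq_sym (negbTE ka) mul0r.
Qed.

Lemma Jm_e0 : Jm *m e0^T = 0.
Proof.
apply/matrixP => a b; rewrite !mxE (bigD1 ord0) //= big1 => [|k k0]; rewrite !mxE.
  by rewrite mul0r addr0.
by rewrite (negbTE k0) andbF mulr0.
Qed.

Lemma xr_unit : x *m x^T = 1%:M.
Proof. by rewrite [LHS]mx11_scalar -[(_ *m _) 0 0]/(dot x x) (tube_dot Sy). Qed.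

Lemma xr_e0 : x *m e0^T = (re_coord ord0 y)%:C%C%:M.
Proof.
rewrite [LHS]mx11_scalar -[(_ *m _) 0 0]/(dot x e0) dotE (bigD1 ord0) //= big1 => [|k k0].
  by rewrite !mxE eqxx mulr1 addr0.
by rewrite !mxE (negbTE k0) andbF mulr0.
Qed.

Lemma e0_unit : e0 *m e0^T = 1%:M.
Proof.
rewrite [LHS]mx11_scalar -[(_ *m _) 0 0]/(dot e0 e0) dotE (bigD1 ord0) //= big1 => [|k k0].
  by rewrite !mxE eqxx mulr1 addr0.
by rewrite !mxE (negbTE k0) andbF mulr0.
Qed.

Lemma Zc_xr : Zc y *m x^T = 0.
Proof.
rewrite /Zc mulmxBl -scalemxAl -/x -(mulmxA _ (x + e0)) mulmxDl xr_unit.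
have -> : e0 *m x^T = (re_coord ord0 y)%:C%C%:M.
  by rewrite -[RHS]tr_scalar_mx -xr_e0 trmx_mul trmxK.
rewrite -raddfD mul_mx_scalar scalerA /scal mulVf; last exact: scal_unit.
by rewrite scale1r subrr.
Qed.

Lemma Zc_orth : Zc y *m (Zc y)^T = 1%:M.
Proof.
rewrite {2}/Zc linearB linearZ /= !trmx_mul trmxK mulmxBr -scalemxAr -/x.
rewrite linearD /= !mulmxA mulmxDr Zc_xr add0r.
rewrite /Zc -/x !mulmxBl -!scalemxAl Jm_orth Jm_e0 !mul0mx sub0r.
rewrite -!(mulmxA (Jm *m x^T)) !mulmxDl.
have -> : e0 *m Jm^T = 0 by rewrite -[RHS]trmx0 -Jm_e0 trmx_mul trmxK.
rewrite addr0 xr_e0 e0_unit.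
have -> : (re_coord ord0 y)%:C%C%:M *m x *m Jm^T + 1%:M *m x *m Jm^T =
    (1 + (re_coord ord0 y)%:C%C) *: (x *m Jm^T).
  by rewrite !mul_scalar_mx -!scalemxAl scalerDl addrC.
rewrite -scalemxAr [scal y *: (_ *: _)]scalerA {2}/scal mulVf ?scal_unit // scale1r.
by rewrite scalerN opprK subrK.
Qed.

(** The square matrix with rows x and those of [Zc y] has orthonormal rows, hence orthonormal
    columns. *)
Lemma Zc_complete : (Zc y)^T *m Zc y = 1%:M - x^T *m x.
Proof.
pose P : 'M[C]_(1 + n) := col_mx x (Zc y).
have PP : P *m P^T = 1%:M.
  rewrite /P tr_col_mx mul_col_row xr_unit Zc_xr Zc_orth.
  have -> : x *m (Zc y)^T = 0 by rewrite -[RHS]trmx0 -Zc_xr trmx_mul trmxK.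
  by rewrite -scalar_mx_block.
have := mulmx1C PP; rewrite /P tr_col_mx mul_row_col => <-.
by rewrite addrAC subrr add0r.
Qed.

End OnTube.

Definition eta0 (b : 'I_n) y : CV := (row b (Zc y), 0).

(** Forced by [cov_tangent_Zm]: in flat space the tangential part <dZ_a, Z_b> of the derivative is
    the connection form plus i |xi|^2 theta times delta_ab, and |xi|^2 = 1/4. The two rows list the
    values on d/dz_k and on d/dzbar_k. *)
Definition om0 (a b : 'I_n) y : CV :=
  (\row_k (mder y (ez k) Zc *m (Zc y)^T) a b, \row_k (mder y (cconj (ez k)) Zc *m (Zc y)^T) a b)
  + (- (imC / 4) * (a == b)%:R) *: theta0 y.

(** The torsion coefficient i/4 is dictated by [cov_Lfc_xi]: the derivative of (i/2) Re z along the
    conjugate of a real frame vector Z_a is (i/4) Z_a. *)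
Definition frame0 : frame R m n :=
  @Frame R m n (fun a y => row a (Zc y)) (@reeb0 R m) eta0 (fun=> 1%:M) om0
    (fun b a _ => imC / 4 * (b == a)%:R).

Lemma eta0E b y V : app (eta0 b y) V = (V.1 *m (Zc y)^T) 0 b.
Proof.
Transparent app.
by rewrite /app mxE; apply: eq_bigr => j _; rewrite !mxE mul0r addr0 mulrC.
Qed.

Lemma app_pD (p q V : CV) : app (p + q) V = app p V + app q V.
Proof.
by rewrite /app -big_split; apply: eq_bigr => j _ /=; rewrite !mxE; ring.
Qed.

Lemma app_pZ c (p V : CV) : app (c *: p) V = c * app p V.
Proof.
by rewrite /app mulr_sumr; apply: eq_bigr => j _ /=; rewrite !mxE; ring.
Qed.

Lemma om0E a b y V : app (om0 a b y) V =
  (mder y V Zc *m (Zc y)^T) a b - imC / 4 * (a == b)%:R * app (theta0 y) V.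
Proof.
rewrite /om0 app_pD app_pZ !mulNr; congr (_ + _).
have VE : V = \sum_k V.1 0 k *: ez k + \sum_k V.2 0 k *: cconj (ez k).
  rewrite {1}[V]cvec_split holo_sum; congr (_ + _).
  rewrite holo_sum cconj_sum; apply: eq_bigr => k _.
  by congr (_ *: _); rewrite mxE conjcK.
rewrite {2}VE -[\sum_k V.1 0 k *: ez k]scale1r mderL !mder_sumL scale1r.
rewrite mulmxDl mxE !mulmx_suml !summxE /app -big_split; apply: eq_bigr => k _.
by rewrite -!scalemxAl !mxE; congr (_ + _); rewrite mulrC.
Qed.
Opaque app.

End HouseholderFrame.

Section HouseholderTanakaWebster.
Context {R : realType} {n : nat}.
Local Notation m := n.+1.
Local Notation E := (cspace R m).
Local Notation C := R[i].
Local Notation CV := (cvec R m).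
Local Notation tube := (@tube R m).
Local Notation frame_dom := (@frame_dom R n).
Local Notation Zc := (@Zc R n).
Implicit Types (y : E) (V : CV).

Lemma msmooth_tr p q U (A : E -> 'M[C]_(p, q)) : msmooth U A -> msmooth U (fun y => (A y)^T).
Proof.
move=> sA i j; have -> : (fun y => (A y)^T i j) = fun y => A y j i; last exact: sA.
by apply/funext => y; rewrite mxE.
Qed.

Lemma mder_tr p q (A : E -> 'M[C]_(p, q)) y V : mder y V (fun z => (A z)^T) = (mder y V A)^T.
Proof.
apply/matrixP => i j; rewrite !mxE; congr cder.
by apply/funext => z; rewrite mxE.
Qed.

Lemma smooth_eta0 b : vsmooth frame_dom (eta0 b : E -> CV).
Proof.
have oU := @open_frame_dom R n; split=> j.
  by apply: (csmooth_eq oU _ (smooth_Zc b j)) => z _; rewrite [RHS]mxE.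
by apply: (csmooth_eq oU _ (csmooth_cst _ 0)) => z _; rewrite [RHS]mxE.
Qed.

Lemma smooth_om0 a b : vsmooth frame_dom (om0 a b : E -> CV).
Proof.
have oU := @open_frame_dom R n.
have sM (W : CV) := msmoothM oU (msmooth_mder oU smooth_Zc (vsmooth_cst _ W))
  (msmooth_tr smooth_Zc).
have [t1 t2] := smooth_theta0 oU.
pose k : C := - (imC / 4) * (a == b)%:R.
split=> j.
  apply: (csmooth_eq (f := fun z => (mder z (ez j) Zc *m (Zc z)^T) a b
    + k * (theta0 z).1 0 j)) => // [z _|]; first by rewrite /om0 !mxE.
  apply: csmoothD => //; first exact: sM.
  by apply: csmoothM => //; exact: csmooth_cst.
apply: (csmooth_eq (f := fun z => (mder z (cconj (ez j)) Zc *m (Zc z)^T) a b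
  + k * (theta0 z).2 0 j)) => // [z _|]; first by rewrite /om0 !mxE.
apply: csmoothD => //; first exact: sM.
by apply: csmoothM => //; exact: csmooth_cst.
Qed.

Lemma smooth_reeb0 U : open U -> vsmooth U (@reeb0 R m).
Proof.
by move=> oU; split=> j; exact: (msmoothZ oU (csmooth_cst U _) (smooth_xr oU) 0 j).
Qed.

Lemma Zc_ctr y : ctr (Zc y) = (Zc y)^T.
Proof. by rewrite /ctr Zc_conj. Qed.

Section AtPoint.
Variable y : E.
Hypotheses (Uy : frame_dom y) (Sy : tube y).
Let oU := @open_frame_dom R n.
Let sZ := @smooth_Zc R n.
Let sx := smooth_xr oU.
Local Notation "V |Z" := (V *m (Zc y)^T) (at level 30).

Lemma mder_Zc_orth V : tangent tube y V ->
  mder y V Zc *m (Zc y)^T = - (Zc y *m (mder y V Zc)^T).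
Proof.
move=> tV; apply/eqP; rewrite -addr_eq0 -mder_tr -(mderM _ oU Uy sZ (msmooth_tr sZ)).
rewrite -(mder_cst y V (1%:M : 'M[C]_n)); apply/eqP.
apply: (tangent_mder_eq oU Uy (msmoothM oU sZ (msmooth_tr sZ)) (msmooth_cst _ _) tV).
by move=> z Uz Sz; exact: Zc_orth.
Qed.

(** Obtained by differentiating [Zc_xr] along the tube, Re z having derivative (V.1 + V.2) / 2. *)
Lemma mder_Zc_xr V : tangent tube y V ->
  mder y V Zc *m (xr y)^T = - (2^-1 *: (Zc y *m (V.1 + V.2)^T)).
Proof.
move=> tV; apply/eqP; rewrite -addr_eq0 scalemxAr -linearZ /= -(mder_xr y V) -mder_tr.
rewrite -(mderM _ oU Uy sZ (msmooth_tr sx)) -(mder_cst y V (0 : 'M[C]_(n, 1))); apply/eqP.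
apply: (tangent_mder_eq oU Uy (msmoothM oU sZ (msmooth_tr sx)) (msmooth_cst _ _) tV).
by move=> z Uz Sz; exact: Zc_xr.
Qed.

(** Tangency fixes the sum of the two radial components of V, and theta fixes their difference. *)
Lemma tangent_theta0 V : tangent tube y V ->
  dot (xr y) V.1 = imC / 2 * app (theta0 y) V /\ dot (xr y) V.2 = - (imC / 2 * app (theta0 y) V).
Proof.
move=> /tube_tangentP -/(_ Sy); rewrite theta0E !dotDr dotNr; have i2 := @imC2 R.
move: (dot _ _) (dot _ _) => p q /eqP; rewrite addr_eq0 => /eqP ->.
have e : imC / 2 * (imC * (p - - p)) = - p.
  by rewrite (_ : _ * _ = imC * imC * p); [rewrite i2 mulN1r|field].
by rewrite e opprK.
Qed.

Lemma mder_Zc_ctr V : ctr (mder y (cconj V) Zc) = (mder y V Zc)^T.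
Proof.
apply: (etrans (esym (mder_ctr V Uy sZ))); apply: (etrans _ (mder_tr Zc y V)).
by congr (mder y V _); apply/funext => z; exact: Zc_ctr.
Qed.

(** V.1 is expanded by [Zc_complete]. The frame part yields the derivative term of the connection
    matrix; the radial part, proportional to theta(V), meets the derivative of [Zc] through
    [mder_Zc_xr]. *)
Lemma Zc_twist V V' : tangent tube y V -> tangent tube y V' ->
  V.1 *m (mder y V' Zc)^T =
  - (V.1 |Z *m (mder y V' Zc *m (Zc y)^T))
  - (imC / 4 * app (theta0 y) V) *: (V'.1 |Z + V'.2 |Z).
Proof.
move=> tV tV'; rewrite (mder_Zc_orth tV') mulmxN opprK !mulmxA -(mulmxA V.1) Zc_complete //.
rewrite mulmxBr mulmx1 mulmxBl mulmxA.
have -> : V.1 *m (xr y)^T = (imC / 2 * app (theta0 y) V)%:M.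
  by rewrite -(tangent_theta0 tV).1 [LHS]mx11_scalar -[(_ *m _) 0 0]/(dot V.1 (xr y)) dotC.
have -> : (imC / 2 * app (theta0 y) V)%:M *m xr y *m (mder y V' Zc)^T =
    - (imC / 4 * app (theta0 y) V) *: (V'.1 |Z + V'.2 |Z).
  move: (app _ _) => t.
  rewrite mul_scalar_mx -scalemxAl.
  have -> : xr y *m (mder y V' Zc)^T = (mder y V' Zc *m (xr y)^T)^T.
    by rewrite trmx_mul trmxK.
  rewrite (mder_Zc_xr tV') linearN linearZ /= trmx_mul trmxK mulmxDl scalerN scalerA scaleNr.
  by congr (- (_ *: _)); field.
by rewrite scaleNr opprK addrK.
Qed.

End AtPoint.

Lemma sum_deltal (a : 'I_n) (f : 'I_n -> C) : \sum_b (b == a)%:R * f b = f a.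
Proof.
rewrite (bigD1 a) //= big1 => [|b /negbTE ->]; last by rewrite mul0r.
by rewrite eqxx mul1r addr0.
Qed.

Lemma sum_mulr1 (a : 'I_n) (f : 'I_n -> C) : \sum_b f b * (1%:M : 'M[C]_n) b a = f a.
Proof. by rewrite -[RHS]sum_deltal; apply: eq_bigr => b _; rewrite mxE mulrC. Qed.

Lemma sum_mul1r (a : 'I_n) (f : 'I_n -> C) : \sum_b (1%:M : 'M[C]_n) a b * f b = f a.
Proof. by rewrite -[RHS]sum_deltal; apply: eq_bigr => b _; rewrite mxE eq_sym. Qed.

Lemma eta0_conjE b y V : app (cconj (eta0 b y)) V = (V.2 *m (Zc y)^T) 0 b.
Proof.
rewrite app_conj eta0E -[RHS]conjcK; congr conjc.
have -> : (cconj V).1 *m (Zc y)^T = map_mx conjc (V.2 *m (Zc y)^T).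
  by rewrite map_mxM -map_trmx Zc_conj.
by rewrite mxE.
Qed.

(** In [Zc_twist] the theta-term multiplies the frame components of both V'.1 and V'.2: the former
    account for the theta-part of [om0], the latter for the torsion. *)
Lemma frame0_structure y : frame_dom y -> tube y -> forall b V V',
  tangent tube y V -> tangent tube y V' ->
  dform (eta0 b) y V V' =
    \sum_a wedge (eta0 a y) (om0 a b y) V V'
    + \sum_a imC / 4 * (b == a)%:R * wedge (theta0 y) (cconj (eta0 a y)) V V'.
Proof.
move=> Uy Sy b V V' tV tV'.
have deta W W' : cder y W (fun z => app (eta0 b z) W') = (W'.1 *m (mder y W Zc)^T) 0 b.
  have -> : (fun z => app (eta0 b z) W') = fun z => (W'.1 *m (Zc z)^T) 0 b.
    by apply/funext => z; exact: eta0E.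
  have sT := msmooth_tr (@smooth_Zc R n).
  have := mderM W (@open_frame_dom R n) Uy (msmooth_cst frame_dom W'.1) sT.
  by rewrite mder_cst mul0mx add0r mder_tr => /matrixP /(_ 0 b); rewrite [LHS]mxE.
rewrite /dform !deta (Zc_twist Uy Sy tV' tV) (Zc_twist Uy Sy tV tV').
set D := mder y V Zc *m _; set D' := mder y V' Zc *m _.
set p := V.1 *m _; set q := V.2 *m _; set p' := V'.1 *m _; set q' := V'.2 *m _.
set t := app (theta0 y) V; set t' := app (theta0 y) V'.
have -> : \sum_a wedge (eta0 a y) (om0 a b y) V V' =
    (p *m D') 0 b - imC / 4 * t' * p 0 b - ((p' *m D) 0 b - imC / 4 * t * p' 0 b).
  rewrite -(sum_deltal b (fun a => imC / 4 * t' * p 0 a)).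
  rewrite -(sum_deltal b (fun a => imC / 4 * t * p' 0 a)) !mxE -!sumrB.
  apply: eq_bigr => a _; rewrite /wedge !eta0E !om0E -/D -/D' -/t -/t' -/p -/p'.
  by move: (p 0 a) (p' 0 a) (D a b) (D' a b) => *; ring.
have -> : \sum_a imC / 4 * (b == a)%:R * wedge (theta0 y) (cconj (eta0 a y)) V V' =
    imC / 4 * (t * q' 0 b - t' * q 0 b).
  rewrite -(sum_deltal b (fun a => imC / 4 * (t * q' 0 a - t' * q 0 a))).
  apply: eq_bigr => a _; rewrite /wedge !eta0_conjE -/t -/t' -/q -/q' eq_sym.
  by move: (q 0 a) (q' 0 a) => *; ring.
move: (p *m D') (p' *m D) => A B.
move: p q p' q' t t' A B => p q p' q' t t' A B.
rewrite !mxE; ring.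
Qed.

(** The radial components contribute theta(V) theta(V') / 4 to the product of V.1 and V'.2; being
    symmetric, this drops out of the alternating form. *)
Lemma frame0_h y : frame_dom y -> tube y -> forall V V',
  tangent tube y V -> tangent tube y V' ->
  dform theta0 y V V' = imC * \sum_a \sum_b (1%:M : 'M[C]_n) a b *
    wedge (eta0 a y) (cconj (eta0 b y)) V V'.
Proof.
move=> Uy Sy V V' tV tV'; rewrite dtheta0 kform1; congr (_ * _).
transitivity (\sum_a wedge (eta0 a y) (cconj (eta0 a y)) V V'); last first.
  apply: eq_bigr => a _.
  by rewrite (sum_mul1r a (fun b => wedge (eta0 a y) (cconj (eta0 b y)) V V')).
have dE W W' : tangent tube y W -> tangent tube y W' ->
    dot W.1 W'.2 = \sum_a (W.1 *m (Zc y)^T) 0 a * (W'.2 *m (Zc y)^T) 0 a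
      + 4^-1 * app (theta0 y) W * app (theta0 y) W'.
  move=> tW tW'.
  have -> : \sum_a (W.1 *m (Zc y)^T) 0 a * (W'.2 *m (Zc y)^T) 0 a =
      dot (W.1 *m (Zc y)^T) (W'.2 *m (Zc y)^T) by rewrite dotE.
  rewrite /dot trmx_mul trmxK mulmxA -(mulmxA W.1) (Zc_complete Uy Sy).
  rewrite mulmxBr mulmx1 mulmxBl mulmxA.
  have -> : W.1 *m (xr y)^T = (imC / 2 * app (theta0 y) W)%:M.
    by rewrite -(tangent_theta0 Sy tW).1 [LHS]mx11_scalar -[(_ *m _) 0 0]/(dot W.1 (xr y)) dotC.
  rewrite mul_scalar_mx -scalemxAl mx11D mx11N mx11Z -[X in _ * X]/(dot (xr y) W'.2).
  rewrite (tangent_theta0 Sy tW').2 -/(dot W.1 W'.2).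
  have i2 := @imC2 R; move: (app _ W) (app _ W') (dot _ _) => s s' d.
  by rewrite (_ : imC / 2 * s * _ = - (imC * imC) / 4 * s * s'); [rewrite i2; field|field].
rewrite (dE V V' tV tV') (dE V' V tV' tV) opprD addrACA.
rewrite [4^-1 * app _ V' * _]mulrAC subrr addr0 -sumrB.
by apply: eq_bigr => a _; rewrite /wedge !eta0E !eta0_conjE.
Qed.

(** With h = 1 the connection matrix has to be skew-Hermitian. For its derivative part this is
    orthonormality of a real frame; the other part is an imaginary multiple of the real form
    theta. *)
Lemma frame0_metric y : frame_dom y -> tube y -> forall a b V, tangent tube y V ->
  cder y V (fun=> (1%:M : 'M[C]_n) a b) =
    \sum_k app (om0 a k y) V * (1%:M : 'M[C]_n) k b
    + \sum_k (1%:M : 'M[C]_n) a k * app (cconj (om0 b k y)) V.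
Proof.
move=> Uy Sy a b V tV; rewrite cder_cst.
rewrite (sum_mulr1 b (fun k => app (om0 a k y) V)).
rewrite (sum_mul1r a (fun k => app (cconj (om0 b k y)) V)).
have tE : conjc (app (theta0 y) (cconj V)) = app (theta0 y) V.
  by rewrite -app_conj theta0_real.
have dE : conjc ((mder y (cconj V) Zc *m (Zc y)^T) b a) = (Zc y *m (mder y V Zc)^T) a b.
  have e : ctr (Zc y)^T = Zc y by apply: etrans (ctrK (Zc y)); rewrite Zc_ctr.
  by rewrite -(mder_Zc_ctr Uy) -[X in X *m ctr _]e -ctrM [RHS]mxE [RHS]mxE.
have skew (A B : 'M[C]_n) s s' : conjc (B b a) = A a b -> conjc s' = s ->
    0 = (- A) a b - imC / 4 * (a == b)%:R * s + conjc (B b a - imC / 4 * (b == a)%:R * s').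
  move=> eA es; have four : conjc (4^-1 : C) = 4^-1 by rewrite conjc_inv (conjc_nat R 4).
  rewrite conjcD conjcN !conjcM eA es four imC_conj conjc_nat [b == a]eq_sym mxE.
  by move: (A a b) => *; ring.
apply: (etrans (skew _ _ _ _ dE tE)); apply: esym; apply: congr2.
  by rewrite -(mder_Zc_orth Uy tV); exact: om0E.
by apply: (etrans (app_conj (om0 b a y) V)); congr conjc; exact: om0E.
Qed.

Lemma frame0_tw : tw_frame tube theta0 frame_dom (@frame0 R n).
Proof.
have oU := @open_frame_dom R n.
have tE y (a : 'rV[C]_m) : tube y -> tangent tube y (holo a) <-> dot (xr y) a = 0.
  by move=> Sy; rewrite (tube_tangentP _ Sy) /= addr0.
have dZ y b : frame_dom y -> tube y -> dot (xr y) (row b (Zc y)) = 0.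
  by move=> Uy Sy; rewrite dotC /dot -row_mul Zc_xr // !mxE.
split.
- split; [|exact: smooth_reeb0|exact: smooth_eta0| |].
  + by move=> a j; apply: (csmooth_eq oU _ (smooth_Zc a j)) => z _; rewrite [RHS]mxE.
  + by move=> a b; exact: csmooth_cst.
  + by split=> a b; [exact: smooth_om0|exact: csmooth_cst].
- by move=> y Uy Sy a; apply/tE => //; exact: dZ.
- move=> y Uy Sy a /(tE _ _ Sy) xa; rewrite /frame0 /=.
  under eq_bigr do rewrite eta0E.
  rewrite -mulmx_sum_row -mulmxA Zc_complete // mulmxBr mulmx1 mulmxA.
  by rewrite [a *m _]mx11_scalar -[(_ *m _) 0 0]/(dot a (xr y)) dotC xa mul_scalar_mx scale0r subr0.
- by move=> y _; exact: reeb0P.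
- move=> y Uy Sy a; split=> [b|b|]; rewrite eta0E /=.
  + have /matrixP /(_ b a) := Zc_orth Uy Sy; rewrite -row_mul !mxE => ->.
    by rewrite eq_sym.
  + by rewrite map_mx0 mul0mx mxE.
  + rewrite -scalemxAl (_ : xr y *m _ = 0) ?scaler0 ?mxE //.
    by rewrite -[RHS]trmx0 -(Zc_xr Uy Sy) trmx_mul trmxK.
- exact: frame0_h.
- exact: frame0_structure.
- exact: frame0_metric.
Qed.

End HouseholderTanakaWebster.

(** * Equality in both bounds *)

Section SharpExample.
Context {R : realType} {n : nat} (n0 : (0 < n)%N).
Local Notation m := n.+1.
Local Notation E := (cspace R m).
Local Notation C := R[i].
Let X : kahlerManifold R m := @complex_space R m.
Let M : set X := @tubeM R m.
Let theta : chart X -> E -> cvec R m := @thetaM R m.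

Lemma tube_sharp : exists c x a H t k,
  [/\ trace_in M c x, a != 0 & tangent (trace_in M c) x (holo a)] /\
  [/\ is_mean_curvature n M theta c x H, is_Asec n M theta c x a t
    & is_Ksec n M theta c x a k] /\
  `|t| = sqnorm (kmetric c x) H /\
  k = (Ktilde (kmetric c) x a + sqnorm (kmetric c x) H) / 2.
Proof.
have [c _] := @km_cover R m X (0 : E).
(* Base point e_0, in the domain of the frame, and direction e_1, which exists because n > 0. It is
   orthogonal to Re x = e_0 and, being real, satisfies |dot a a| = |a|^2. *)
pose x : E := (delta_mx 0 ord0, 0).
pose j : 'I_m := lift ord0 (Ordinal n0).
pose a : 'rV[C]_m := delta_mx 0 j.
have rx k : re_coord k x = (k == ord0)%:R by rewrite /re_coord !mxE.
have Tx : tube x.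
  rewrite /tube /= /rho (bigD1 ord0) //= big1 => [|k /negbTE k0]; rewrite rx.
    by rewrite eqxx expr1n addr0 subrr.
  by rewrite k0 expr0n.
have Sx : trace_in M c x by rewrite trace_tube.
have Ux : @frame_dom R n x by rewrite /frame_dom /= rx eqxx -(natrD _ 1 1) ltr0n.
have aE (f : 'I_m -> C) : \sum_k a 0 k * f k = f j.
  rewrite (bigD1 j) //= big1 => [|k /negbTE kj]; rewrite !mxE eqxx.
    by rewrite eqxx mul1r addr0.
  by rewrite kj mul0r.
have a0 : a != 0.
  by apply/eqP => /matrixP /(_ 0 j); rewrite !mxE !eqxx => /eqP; rewrite oner_eq0.
have ta : tangent (trace_in M c) x (holo a).
  rewrite trace_tube; apply/tube_tangentP => //=.
  by rewrite addr0 dotC dotE aE mxE rx.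
have uF : unitary_frame_at (trace_in M c) (theta c) x (@frame0 R n).
  exists frame_dom; first by split => //; exact: open_frame_dom.
  by rewrite trace_tube; split=> //; exact: frame0_tw.
have tF : tw_frame_at (trace_in M c) (theta c) x (@frame0 R n).
  by have [U oU [tw _]] := uF; exists U.
have mH : is_mean_curvature n M theta c x
    (mean_curvature (kmetric c) (theta c) (@frame0 R n) x) by exists (@frame0 R n).
have [xi4 A4] := tube_torsion Sx tF ta.
have [_ H4] := mean_curvature_frame n0 (@tubeM_pseudohermitian R m) (@tubeM_induces R m) Sx tF mH.
have [K4 _] := Ksec_frame (@tubeM_pseudohermitian R m) (@tubeM_induces R m) Sx a0 ta tF.
exists c, x, a, (mean_curvature (kmetric c) (theta c) (@frame0 R n) x).
exists (Asec (@frame0 R n) x a), (Ksec (@frame0 R n) x a).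
have A1 : `|Asec (@frame0 R n) x a| = 4^-1.
  rewrite A4 dotE !aE mxE !eqxx conjc1 normr1; by field.
split=> //; split; first by split=> //; exists (@frame0 R n).
rewrite H4 xi4 A1; split=> //.
(* With |A| = |H|^2 = 1/4 the Gauss equation reads K = Ktilde / 2 + 1/4 - 1/8. *)
rewrite K4 xi4 A1; move: (Ktilde _ _ _) => K; by field.
Qed.

End SharpExample.

Theorem theorem1p2 (R : realType) (n : nat) (hn : (1 <= n)%N) :
  (forall (X : kahlerManifold R n.+1) (M : set X)
      (theta : chart X -> cspace R n.+1 -> cvec R n.+1),
    real_hypersurface M -> strictly_pseudoconvex M ->
    pseudohermitian M theta -> induces M theta ->
    (Cconvex n M theta <->
      (forall c x, trace_in M c x ->
       forall a, a != 0 -> tangent (trace_in M c) x (holo a) ->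
       forall H t, is_mean_curvature n M theta c x H ->
         is_Asec n M theta c x a t ->
         `|t| <= sqnorm (kmetric c x) H))
    /\
    (Cconvex n M theta ->
      (forall c x, trace_in M c x ->
       forall a, a != 0 -> tangent (trace_in M c) x (holo a) ->
       forall H k, is_mean_curvature n M theta c x H ->
         is_Ksec n M theta c x a k ->
         (Ktilde (kmetric c) x a + sqnorm (kmetric c x) H) / 2 <= k)))
  /\
  (exists (X : kahlerManifold R n.+1) (M : set X)
      (theta : chart X -> cspace R n.+1 -> cvec R n.+1),
    [/\ real_hypersurface M, strictly_pseudoconvex M,
        pseudohermitian M theta, induces M theta & Cconvex n M theta] /\
    exists c x a H t k,
      [/\ trace_in M c x, a != 0 & tangent (trace_in M c) x (holo a)] /\
      [/\ is_mean_curvature n M theta c x H, is_Asec n M theta c x a t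
        & is_Ksec n M theta c x a k] /\
      `|t| = sqnorm (kmetric c x) H /\
      k = (Ktilde (kmetric c) x a + sqnorm (kmetric c x) H) / 2).
Proof.
split=> [X M theta _ _ ph ind|].
  split; first exact: (Cconvex_iff_torsion hn ph ind).
  exact: (Cconvex_Ksec hn ph ind).
exists (@complex_space R n.+1), (@tubeM R n.+1), (@thetaM R n.+1).
split; last exact: (tube_sharp hn).
split; [exact: tubeM_hypersurface|exact: tubeM_pseudoconvex|exact: tubeM_pseudohermitian| |].
  exact: tubeM_induces.
exact: (tubeM_Cconvex hn).
Qed.
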